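(* Let $\mathbb{K}$ be a number field, $\mathcal{O}_{\mathbb{K}}$ its ring of integers, and $G_{\mathbb{K}}$ the set of non-zero ideals of $\mathcal{O}_{\mathbb{K}}$. Let $(X,\mathcal{X},\mu,T)$ be an ergodic invertible measure-preserving system with $\mu$ non-atomic. Let $c\colon G_{\mathbb{K}}\to\mathbb{N}\cup\{0\}$ be either $c=\Omega_{\mathbb{K}}$ or $c=\omega_{\mathbb{K}}$. Then for every $\varepsilon>0$ there exists a set $A\in\mathcal{X}$ such that $\mu(A)<\varepsilon$ and, for $\mu$-almost every $x\in X$, \[ \limsup_{N\to\infty}\frac{1}{\#\{\mathfrak{a}\in G_{\mathbb{K}}:\mathcal{N}(\mathfrak{a})\le N\}}\sum_{\substack{\mathfrak{a}\in G_{\mathbb{K}}\\ \mathcal{N}(\mathfrak{a})\le N}}\mathbf{1}_A(T^{c(\mathfrak{a})}x)=1 \] and \[ \liminf_{N\to\infty}\frac{1}{\#\{\mathfrak{a}\in G_{\mathbb{K}}:\mathcal{N}(\mathfrak{a})\le N\}}\sum_{\substack{\mathfrak{a}\in G_{\mathbb{K}}\\ \mathcal{N}(\mathfrak{a})\le N}}\mathbf{1}_A(T^{c(\mathfrak{a})}x)=0. \]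
   Context: For a non-zero ideal $\mathfrak{a}$ of $\mathcal{O}_{\mathbb{K}}$: $\mathcal{N}(\mathfrak{a})$ is its absolute norm; $\omega_{\mathbb{K}}(\mathfrak{a})$ is the number of distinct prime ideals dividing $\mathfrak{a}$; $\Omega_{\mathbb{K}}(\mathfrak{a})$ is the total number of prime ideal factors of $\mathfrak{a}$ counted with multiplicity. A measure-preserving system is a quadruple $(X,\mathcal{X},\mu,T)$ with $(X,\mathcal{X},\mu)$ a probability space and $T\colon X\to X$ measurable with $\mu(T^{-1}A)=\mu(A)$ for all $A\in\mathcal{X}$; by standing convention $X$ is a compact metric space, $\mathcal{X}$ its Borel $\sigma$-algebra and $\mu$ a Borel probability measure. It is invertible if $T$ is invertible with measurable inverse, and ergodic if $A=T^{-1}A$, $A\in\mathcal{X}$, implies $\mu(A)\in\{0,1\}$. Non-atomic means $\mu(\{x\})=0$ for all $x\in X$. $\mathbf{1}_A$ is the indicator function of $A$. *)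

(* Defs.v *)
From HB Require Import structures.
From mathcomp Require Import all_boot all_order all_algebra all_field.
From mathcomp Require Import finmap.
From mathcomp Require Import all_classical all_reals all_analysis.
Set Implicit Arguments.
Unset Strict Implicit.
Unset Printing Implicit Defensive.
Import Order.TTheory GRing.Theory Num.Theory.
Local Open Scope classical_set_scope.
Local Open Scope ring_scope.

Definition integral_pred (K : fieldExtType rat) : {pred K} :=
  fun x => `[< integralOver (intr : int -> K) x >].

Fact integral_pred_closed (K : fieldExtType rat) :
  subring_closed (@integral_pred K).
Proof.
split=> [|x y|x y].
- exact/asboolP/integral1.
- by move=> /asboolP xZ /asboolP yZ; exact/asboolP/integral_sub.
- by move=> /asboolP xZ /asboolP yZ; exact/asboolP/integral_mul.
Qed.

HB.instance Definition _ (K : fieldExtType rat) :=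
  GRing.isSubringClosed.Build K (@integral_pred K) (@integral_pred_closed K).

Record ringOfIntegers (K : fieldExtType rat) := RingOfIntegers {
  ringOfIntegers_val :> K;
  _ : ringOfIntegers_val \in @integral_pred K }.

HB.instance Definition _ (K : fieldExtType rat) :=
  [isSub for @ringOfIntegers_val K].
HB.instance Definition _ (K : fieldExtType rat) :=
  [Choice of ringOfIntegers K by <:].
HB.instance Definition _ (K : fieldExtType rat) :=
  [SubChoice_isSubComNzRing of ringOfIntegers K by <:].

Section Ideals.
Context {A : comNzRingType}.
Implicit Types a b p : set A.

(* [idealr] of ring_quotient excludes the unit ideal, which is needed here. *)
Definition is_ideal a :=
  [/\ a 0, forall x y, a x -> a y -> a (x + y) & forall r x, a x -> a (r * x)].

Definition is_prime_ideal p :=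
  [/\ is_ideal p, ~ p 1 & forall x y, p (x * y) -> p x \/ p y].

Definition ideal_mul a b : set A :=
  [set x | exists s : seq (A * A),
    (forall u, u \in s -> a u.1 /\ b u.2) /\ x = \sum_(u <- s) u.1 * u.2].

Definition ideal_exp a (k : nat) : set A := iter k (ideal_mul a) [set: A].

Definition ideal_dvd b a := exists c, is_ideal c /\ a = ideal_mul b c.

(* [fset_set] is the empty set on infinite sets: the norm of an ideal of
   infinite index is 0. *)
Definition ideal_norm a : nat :=
  #|` fset_set [set [set y | a (y - x)] | x in [set: A]]|.

(* For [a] non-zero, the zero ideal does not divide [a], so only non-zero primes
   occur here. *)
Definition prime_divisors a : set (set A) :=
  [set p | is_prime_ideal p /\ ideal_dvd p a].

Definition ideal_multiplicity p a : nat :=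
  xget 0%N [set k | ideal_dvd (ideal_exp p k) a /\
                    forall j, ideal_dvd (ideal_exp p j) a -> (j <= k)%N].

Definition omega_ideal a : nat := #|` fset_set (prime_divisors a)|.

Definition Omega_ideal a : nat :=
  \big[addn/0%N]_(p \in prime_divisors a) ideal_multiplicity p a.

Definition nonzero_ideals : set (set A) :=
  [set a | is_ideal a /\ a <> [set 0]].

Definition ideals_upto (N : nat) : set (set A) :=
  [set a | nonzero_ideals a /\ (ideal_norm a <= N)%N].

End Ideals.

#[short(type="metricMeasurableType")]
HB.structure Definition MetricMeasurable (d : measure_display)
  (R : numDomainType) := { X of Measurable d X & Metric R X }.

Section Systems.
Context {d : measure_display} {X : measurableType d} {R : realType}.
Implicit Types (mu : set X -> \bar R) (T : X -> X).

Definition measure_preserving mu T :=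
  measurable_fun [set: X] T /\
  forall A, measurable A -> mu (T @^-1` A) = mu A.

Definition measurably_invertible T :=
  exists S : X -> X, [/\ cancel T S, cancel S T & measurable_fun [set: X] S].

Definition ergodic mu T :=
  forall A, measurable A -> A = T @^-1` A -> mu A = 0%E \/ mu A = 1%E.

Definition non_atomic mu := forall x, mu [set x] = 0%E.

End Systems.

Definition ideal_average (R : realType) (K : fieldExtType rat) (X : Type)
    (T : X -> X) (c : set (ringOfIntegers K) -> nat) (A : set X) (x : X)
    (N : nat) : R :=
  (\sum_(a \in @ideals_upto (ringOfIntegers K) N) (\1_A (iter (c a) T x) : R))
  / (#|` fset_set (@ideals_upto (ringOfIntegers K) N)|)%:R.

(* Main.v *)
Require Import Defs.
From HB Require Import structures.
From mathcomp Require Import all_boot all_order all_algebra all_field.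
From mathcomp Require Import finmap.
From mathcomp Require Import ring lra zify.
From mathcomp Require Import all_classical all_reals all_analysis.
Set Implicit Arguments.
Unset Strict Implicit.
Unset Printing Implicit Defensive.
Import Order.TTheory GRing.Theory Num.Theory.
Local Open Scope classical_set_scope.
Local Open Scope ring_scope.

(** Why the theorem holds.  The average of order [N] is the integral of
    [k |-> \1_A (T^k x)] against the distribution [nu_N] of [c] on the ideals of
    norm at most [N].  If [nu_N] is concentrated on an interval of times that is
    long, but short compared with its starting point, then the average is close
    to [1] as soon as the orbit of [x] stays in [A] during that interval, and
    close to [0] as soon as it stays outside [A].  It is then enough to find a
    small set [A] such that almost every orbit contains infinitely many such
    intervals of each kind.

    Concentration.  Give the ideal [a] a probability proportional to [N(a)^-s]
    with [s > 1].  By unique factorization being a multiple of [p] has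
    probability [N(p)^-s], so the number of distinct prime factors has mean
    [m(s) = \sum_p N(p)^-s] and second moment at most [m(s)^2 + m(s)], and
    Chebyshev's inequality puts it near [m(s)] ([omega_chebyshev]); repeated
    factors contribute a bounded amount on average ([excess_moment]).  Summation
    by parts writes this probability as a mixture of the uniform distributions
    on the ideals of norm at most [N] ([zeta_mixture]), so that concentration is
    inherited by some [nu_N], and one [N] for each interval is all that is needed.
    This avoids the asymptotic counting of ideals.  Finally [m] takes values
    close to every large number ([mean_at_near]) because it is continuous and
    unbounded as [s] tends to [1]: the Euler product gives
    [zeta(s) <= exp(2 m(s))] ([zeta_le_expR]), and [\sum_a 1 / N(a)] diverges.

    Arithmetic input.  Only three facts about the ring of integers are used.
    Ideals factor uniquely and the norm is multiplicative; here factorization is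
    proved by induction on the norm, a prime [p] being inverted with the help
    of a fraction [y / x] outside the ring that maps [p] into the ring
    ([prime_inverse], [prime_quotient]).  There are [O(X)] ideals of norm at most
    [X] ([ideals_upto_bound]): by the box principle [a] contains an element [v]
    of size about [N(a)^(1/n)], and the cofactor of [a] in the ideal of [v] has
    bounded norm.  And [\sum_a 1 / N(a)] diverges ([inverse_norms_diverge]): the
    elements [X + beta] with [beta] small are about [X^n] in number, and at most
    a proportion [O(1 / N(a))] of them can generate a given ideal [a].  The
    lattice structure behind these estimates comes from the trace form
    ([integral_coordinates_exist]).

    Dynamics.  Take a set [B] of very small positive measure, which exists
    because [mu] is non-atomic, and cut the waiting time to reach [B] modulo
    [m l] into [m] slots of length [l].  One slot has measure at most [1 / m],
    and every orbit starting far from [B] crosses the whole slot before the time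
    [m l + l] ([slab]).  Combining such slabs at faster and faster growing
    scales, alternately put into [A] and kept out of [A], gives the result for
    almost every point by the Borel-Cantelli lemma ([strong_sweeping]). *)

(** * Elementary ideal theory *)

Section IdealBasics.
Context {A : comNzRingType}.
Implicit Types (a b c p : set A) (x y z r : A) (s t : seq A).

Lemma ideal0 a : is_ideal a -> a 0. Proof. by case. Qed.

Lemma idealD a x y : is_ideal a -> a x -> a y -> a (x + y).
Proof. by case=> _ aD _; exact: aD. Qed.

Lemma idealMl a r x : is_ideal a -> a x -> a (r * x).
Proof. by case=> _ _ aM; exact: aM. Qed.

Lemma idealMr a r x : is_ideal a -> a x -> a (x * r).
Proof. by move=> ia ax; rewrite mulrC; exact: idealMl. Qed.

Lemma idealN a x : is_ideal a -> a x -> a (- x).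
Proof. by move=> ia ax; rewrite -mulN1r; exact: idealMl. Qed.

Lemma idealB a x y : is_ideal a -> a x -> a y -> a (x - y).
Proof. by move=> ia ax ay; apply: idealD => //; exact: idealN. Qed.

Lemma ideal_sum a (I : eqType) (l : seq I) (F : I -> A) :
  is_ideal a -> (forall i, i \in l -> a (F i)) -> a (\sum_(i <- l) F i).
Proof.
move=> ia aF; rewrite big_seq; elim/big_ind: _ => //; first exact: ideal0.
by move=> x y; exact: idealD.
Qed.

Lemma idealT : is_ideal [set: A]. Proof. by []. Qed.
#[local] Hint Resolve idealT : core.

Lemma ideal_eqT a : is_ideal a -> a 1 -> a = [set: A].
Proof.
by move=> ia a1; apply/seteqP; split=> // x _; rewrite -(mulr1 x); exact: idealMl.
Qed.

Lemma nonzero_idealP a : is_ideal a ->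
  a <> [set 0] <-> exists2 x, a x & x <> 0.
Proof.
move=> ia; split=> [an0|[x ax x0] a0]; last by move: ax; rewrite a0 => /x0.
apply: contrapT => h; apply: an0; apply/seteqP; split=> [x ax|_ ->] /=.
  by apply: contrapT => x0; apply: h; exists x.
exact: ideal0.
Qed.

Lemma nonzero_sub a b : is_ideal a -> is_ideal b ->
  a `<=` b -> a <> [set 0] -> b <> [set 0].
Proof.
move=> ia ib ab /(nonzero_idealP ia)[x ax x0]; apply/(nonzero_idealP ib).
by exists x => //; exact: ab.
Qed.

Lemma nonzero_idealT : nonzero_ideals [set: A].
Proof.
by split=> //; apply/nonzero_idealP => //; exists 1 => //; exact/eqP/oner_neq0.
Qed.

Definition principal x : set A := [set y | exists r, y = r * x].

Lemma principal_ideal x : is_ideal (principal x).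
Proof.
split=> [|_ _ [r ->] [s ->]|r _ [s ->]]; first by exists 0; rewrite mul0r.
  by exists (r + s); rewrite mulrDl.
by exists (r * s); rewrite mulrA.
Qed.

Lemma principal_id x : principal x x.
Proof. by exists 1; rewrite mul1r. Qed.

Lemma principal_sub a x : is_ideal a -> a x -> principal x `<=` a.
Proof. by move=> ia ax _ [r ->]; exact: idealMl. Qed.

Definition ideal_add a b : set A :=
  [set z | exists x y, [/\ a x, b y & z = x + y]].

Lemma ideal_add_ideal a b : is_ideal a -> is_ideal b -> is_ideal (ideal_add a b).
Proof.
move=> ia ib; split.
- by exists 0, 0; rewrite addr0; split=> //; exact: ideal0.
- move=> _ _ [x [y [ax bYy ->]]] [x' [y' [ax' by' ->]]].
  by exists (x + x'), (y + y'); rewrite addrACA; split=> //; exact: idealD.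
- move=> r _ [x [y [ax bYy ->]]].
  by exists (r * x), (r * y); rewrite mulrDr; split=> //; exact: idealMl.
Qed.

Lemma ideal_addl a b : is_ideal b -> a `<=` ideal_add a b.
Proof. by move=> ib x ax; exists x, 0; rewrite addr0; split=> //; exact: ideal0. Qed.

Lemma ideal_addr a b : is_ideal a -> b `<=` ideal_add a b.
Proof. by move=> ia x ax; exists 0, x; rewrite add0r; split=> //; exact: ideal0. Qed.

Lemma mem_ideal_mul a b x y : a x -> b y -> ideal_mul a b (x * y).
Proof.
move=> ax bYy; exists [:: (x, y)]; split; last by rewrite big_seq1.
by move=> u; rewrite inE => /eqP ->.
Qed.

Lemma ideal_mul_sub a b c : is_ideal c ->
  (forall x y, a x -> b y -> c (x * y)) -> ideal_mul a b `<=` c.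
Proof.
move=> ic h _ [s [hs ->]]; apply: ideal_sum => // u /hs[au bu]; exact: h.
Qed.

Lemma ideal_mul_ideal a b : is_ideal a -> is_ideal (ideal_mul a b).
Proof.
move=> ia; split.
- by exists [::]; rewrite big_nil.
- move=> _ _ [s [hs ->]] [t [ht ->]]; exists (s ++ t); rewrite big_cat; split=> //.
  by move=> u; rewrite mem_cat => /orP[/hs|/ht].
- move=> r _ [s [hs ->]]; exists [seq (r * u.1, u.2) | u <- s].
  rewrite big_map big_distrr /=; split; last by apply: eq_bigr => u _; rewrite mulrA.
  by move=> _ /mapP[u /hs[au bu] ->]; split=> //=; exact: idealMl.
Qed.

Lemma ideal_mulC a b : ideal_mul a b = ideal_mul b a.
Proof.
have sub c e : ideal_mul c e `<=` ideal_mul e c.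
  move=> _ [s [hs ->]]; exists [seq (u.2, u.1) | u <- s]; rewrite big_map; split.
    by move=> _ /mapP[u /hs[cu eu] ->].
  by apply: eq_bigr => u _; rewrite mulrC.
by apply/seteqP; split; exact: sub.
Qed.

Lemma ideal_mul_mono a a' b b' : a `<=` a' -> b `<=` b' ->
  ideal_mul a b `<=` ideal_mul a' b'.
Proof.
move=> aa bb _ [s [hs ->]]; exists s; split=> // u /hs[/aa ? /bb ?]; by split.
Qed.

Lemma ideal_mulA a b c : is_ideal a -> is_ideal b -> is_ideal c ->
  ideal_mul a (ideal_mul b c) = ideal_mul (ideal_mul a b) c.
Proof.
move=> ia ib ic.
have iabc : is_ideal (ideal_mul (ideal_mul a b) c) by do 2!apply: ideal_mul_ideal.
have iabc' : is_ideal (ideal_mul a (ideal_mul b c)) by apply: ideal_mul_ideal.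
apply/seteqP; split.
  apply: ideal_mul_sub => // x _ ax [s [hs ->]]; rewrite mulr_sumr.
  apply: ideal_sum => // u /hs[bu cu]; rewrite mulrA.
  by apply: mem_ideal_mul => //; exact: mem_ideal_mul.
apply: ideal_mul_sub => // _ y [s [hs ->]] cy; rewrite mulr_suml.
apply: ideal_sum => // u /hs[au bu]; rewrite -mulrA.
by apply: mem_ideal_mul => //; exact: mem_ideal_mul.
Qed.

Lemma ideal_mulT a : is_ideal a -> ideal_mul a [set: A] = a.
Proof.
move=> ia; apply/seteqP; split; first by apply: ideal_mul_sub => // x y ? _; exact: idealMr.
by move=> x ax; rewrite -(mulr1 x); exact: mem_ideal_mul.
Qed.

Lemma ideal_mulTl a : is_ideal a -> ideal_mul [set: A] a = a.
Proof. by rewrite ideal_mulC; exact: ideal_mulT. Qed.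

Lemma ideal_mul_subl a b : is_ideal a -> ideal_mul a b `<=` a.
Proof. by move=> ia; apply: ideal_mul_sub => // x y ? _; exact: idealMr. Qed.

Lemma ideal_mul_subr a b : is_ideal b -> ideal_mul a b `<=` b.
Proof. by rewrite ideal_mulC; exact: ideal_mul_subl. Qed.

Lemma ideal_dvd_sub b a : is_ideal b -> ideal_dvd b a -> a `<=` b.
Proof. by move=> ib [c [ic ->]]; exact: ideal_mul_subl. Qed.

Lemma ideal_exp_ideal p k : is_ideal p -> is_ideal (ideal_exp p k).
Proof. by move=> ip; elim: k => //= k ih; exact: ideal_mul_ideal. Qed.

Lemma prime_mul_sub p a b : is_prime_ideal p -> is_ideal a ->
  ideal_mul a b `<=` p -> a `<=` p \/ b `<=` p.
Proof.
move=> [ip _ pM] ia abp; case: (pselect (a `<=` p)) => [|nap]; [by left|right].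
have [x ax npx] : exists2 x, a x & ~ p x.
  by apply: contrapT => h; apply: nap => x ax; apply: contrapT => npx; apply: h; exists x.
by move=> y bYy; have /abp/pM[|//] : ideal_mul a b (x * y) by exact: mem_ideal_mul.
Qed.

(** A complete system of representatives, without repetition, of the cosets
    of [a].  Indices are computed by exhibiting such lists. *)
Definition transversal a s :=
  [/\ uniq s, {in s &, forall y z, a (y - z) -> y = z} &
      forall x, exists2 y, y \in s & a (y - x)].

Lemma coset_eq a x y : is_ideal a -> a (x - y) ->
  [set z | a (z - x)] = [set z | a (z - y)].
Proof.
move=> ia axy; apply/seteqP; split=> z /= az.
  by rewrite -(subrK x z) -addrA; exact: idealD.
by rewrite -(subrK y z) -addrA -(opprB x y); exact: idealB.
Qed.

Lemma ideal_norm_transversal a s : is_ideal a -> transversal a s ->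
  ideal_norm a = size s.
Proof.
move=> ia [us injs covs]; rewrite /ideal_norm.
pose f x := [set z | a (z - x)].
have -> : [set [set y | a (y - x)] | x in [set: A]] = f @` [set` s].
  apply/seteqP; split=> _ [x _ <-]; last by exists x.
  by have [y sy ayx] := covs x; exists y => //; exact: coset_eq.
have -> : f @` [set` s] = [set` map f s].
  apply/seteqP; split=> [_ [x xs <-]|_ /= /mapP[x xs ->]]; last by exists x.
  by apply/mapP; exists x.
have umap : uniq (map f s).
  rewrite map_inj_in_uniq // => x y xs ys fxy; apply: injs => //.
  by have : f y x by rewrite -fxy /f /= subrr; exact: ideal0.
rewrite -(size_map f s) -(undup_id umap) -card_fseq; congr (#|` _|).
apply/fsetP => x; rewrite in_fset_set; last exact: finite_seq.
by rewrite undup_id //; apply/idP/idP; rewrite !inE.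
Qed.

Lemma covering_transversal a s : is_ideal a ->
  (forall x, exists2 y, y \in s & a (y - x)) ->
  exists2 t, transversal a t & (size t <= size s)%N.
Proof.
move=> ia cov.
suff [t [ut st injt covt]] : exists t, [/\ uniq t, (size t <= size s)%N,
    {in t &, forall y z, a (y - z) -> y = z} &
    forall x, x \in s -> exists2 y, y \in t & a (y - x)].
  exists t => //; split=> // x; have [y /covt[z zt azy] ayx] := cov x.
  by exists z => //; rewrite -(subrK y z) -addrA; exact: idealD.
elim: s {cov} => [|x s [t [ut st injt covt]]]; first by exists [::].
case: (pselect (exists2 y, y \in t & a (y - x))) => [h|h].
  exists t; split=> //; first by rewrite /=; exact: leqW.
  by move=> z; rewrite inE => /orP[/eqP ->//|]; exact: covt.
exists (x :: t); split=> //=.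
- rewrite ut andbT; apply/negP => xt; apply: h; exists x => //.
  by rewrite subrr; exact: ideal0.
- move=> y z; rewrite !inE => /orP[/eqP->|yt] /orP[/eqP->|zt] // ayz.
  + by exfalso; apply: h; exists z => //; rewrite -opprB; exact: idealN.
  + by exfalso; apply: h; exists y.
  + exact: injt.
- move=> z; rewrite inE => /orP[/eqP->|/covt[y yt ay]].
    by exists x; rewrite ?inE ?eqxx // subrr; exact: ideal0.
  by exists y => //; rewrite inE yt orbT.
Qed.

Lemma transversal_sub a s b : is_ideal a -> transversal a s -> a `<=` b ->
  is_ideal b -> exists t, transversal b t.
Proof.
move=> ia [us _ cov] ab ib; have [] := @covering_transversal b s ib; last by move=> t; exists t.
by move=> x; have [y ? /ab] := cov x; exists y.
Qed.

Lemma transversal_size_gt0 a s : transversal a s -> (0 < size s)%N.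
Proof. by case=> _ _ /(_ 0)[y]; case: s. Qed.

(* The injection sends a representative for [b] to one for [a] of the same
   element; a point of [b] outside [a] yields a coset of [a] that is missed. *)
Lemma ideal_norm_lt a b s x : is_ideal a -> is_ideal b -> transversal a s ->
  a `<=` b -> b x -> ~ a x -> (ideal_norm b < ideal_norm a)%N.
Proof.
move=> ia ib ts ab bx nax; have [t tt] := transversal_sub ia ts ab ib.
rewrite (ideal_norm_transversal ia ts) (ideal_norm_transversal ib tt).
have [us injs covs] := ts; have [ut injt covt] := tt.
pose f y := xget 0 [set z | z \in s /\ a (z - y)].
have fP y : f y \in s /\ a (f y - y).
  by apply: (@xgetPex _ 0 [set z | z \in s /\ a (z - y)]); have [z] := covs y; exists z.
have [y0 y0t _] := covt 0; have [z zs az] := covs (f y0 + x).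
have finj : {in t &, injective f}.
  move=> y y' yt y't e; apply: injt => //; apply: ab.
  rewrite -(subrK (f y) y) -addrA {2}e; apply: idealD => //; last by case: (fP y').
  by rewrite -opprB; apply: idealN => //; case: (fP y).
have zn : z \notin map f t.
  apply/negP => /mapP[y yt ze].
  have [_ a1] := fP y; have [_ a2] := fP y0.
  have yy0 : y = y0.
    apply: injt => //.
    have -> : y - y0 = - (f y - y) + (f y - (f y0 + x)) + (f y0 - y0) + x.
      by ring.
    apply: (idealD ib _ bx); apply: (idealD ib _ (ab _ a2)).
    by apply: (idealD ib (idealN ib (ab _ a1))); apply: ab; rewrite -ze.
  apply: nax; rewrite -(opprK x); apply: idealN => //.
  by move: az; rewrite ze yy0 opprD addNKr.
have : (size (z :: map f t) <= size s)%N.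
  apply: uniq_leq_size; first by rewrite /= zn map_inj_in_uniq.
  by move=> y; rewrite inE => /orP[/eqP->//|/mapP[y' _ ->]]; case: (fP y').
by rewrite /= size_map.
Qed.

Lemma transversal_collision a s (I : finType) (f : I -> A) :
  is_ideal a -> transversal a s -> (size s < #|I|)%N ->
  exists i j, i != j /\ a (f i - f j).
Proof.
move=> ia [us injs covs] sI.
pose g i := xget 0 [set z | z \in s /\ a (z - f i)].
have gP i : g i \in s /\ a (g i - f i).
  by apply: (@xgetPex _ 0 [set z | z \in s /\ a (z - f i)]); have [z] := covs (f i); exists z.
apply: contrapT => h.
suff ginj : injective g.
  suff : (#|I| <= size s)%N by rewrite leqNgt sI.
  rewrite cardE -(size_map g); apply: uniq_leq_size.
    by rewrite map_inj_uniq // enum_uniq.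
  by move=> _ /mapP[i _ ->]; case: (gP i).
move=> i j gij; apply: contrapT => /eqP ij; apply: h; exists i, j; split=> //.
have [_ ai] := gP i; have [_ aj] := gP j.
have -> : f i - f j = (g j - f j) - (g i - f i) by rewrite gij; ring.
exact: idealB.
Qed.

End IdealBasics.
#[global] Hint Resolve idealT : core.

(** * Unique factorization of ideals *)

(** A domain with finite quotients that is integrally closed: the last clause
    says that an element [y / x] of the fraction field that maps a non-zero
    ideal into itself lies in the ring.  Finiteness of the quotients plays the
    part of both the noetherian and the dimension-one hypotheses in the usual
    definition of Dedekind domains, and it gives inductions on the norm. *)
Definition dedekind_finite (A : comNzRingType) : Prop :=
  [/\ forall x y : A, x * y = 0 -> x = 0 \/ y = 0,
      forall a : set A, nonzero_ideals a -> exists s, transversal a s &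
      forall (a : set A) x y, nonzero_ideals a -> x <> 0 ->
        (forall u, a u -> exists2 v, a v & y * u = x * v) ->
        exists w, y = x * w].

Definition nonzero_primes {A : comNzRingType} : set (set A) :=
  [set p | is_prime_ideal p /\ p <> [set 0]].

Section Dedekind.
Context {A : comNzRingType} (dedA : dedekind_finite A).
Implicit Types (a b c p q : set A) (x y z r : A) (l : seq (set A)).

Let mulA0 x y : x * y = 0 -> x = 0 \/ y = 0. Proof. by case: dedA => h _ _; exact: h. Qed.

Let mulA_neq0 x y : x <> 0 -> y <> 0 -> x * y <> 0.
Proof. by move=> x0 y0 /mulA0[]. Qed.

Let mulAI x y z : x <> 0 -> x * y = x * z -> y = z.
Proof.
move=> x0 /eqP; rewrite -subr_eq0 -mulrBr => /eqP /mulA0[//|/eqP].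
by rewrite subr_eq0 => /eqP.
Qed.

Lemma nonzero_ideal_mul a b :
  nonzero_ideals a -> nonzero_ideals b -> nonzero_ideals (ideal_mul a b).
Proof.
move=> [ia /(nonzero_idealP ia)[x ax x0]] [ib /(nonzero_idealP ib)[y bYy y0]].
have iab : is_ideal (ideal_mul a b) by exact: ideal_mul_ideal.
split=> //; apply/nonzero_idealP => //; exists (x * y); last exact: mulA_neq0.
exact: mem_ideal_mul.
Qed.

Lemma nonzero_principal x : x <> 0 -> nonzero_ideals (principal x).
Proof.
move=> x0; have ix := principal_ideal x.
by split=> //; apply/nonzero_idealP => //; exists x => //; exact: principal_id.
Qed.

Lemma transversal_exists a : nonzero_ideals a -> exists s, transversal a s.
Proof. by case: dedA => _ h _; exact: h. Qed.

Lemma ideal_norm_gt0 a : nonzero_ideals a -> (0 < ideal_norm a)%N.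
Proof.
move=> na; have [s ts] := transversal_exists na.
by rewrite (ideal_norm_transversal na.1 ts) (transversal_size_gt0 ts).
Qed.

Lemma ideal_normT : ideal_norm [set: A] = 1%N.
Proof.
rewrite (@ideal_norm_transversal A _ [:: 0]) //; split=> // [x y|x].
  by rewrite !inE => /eqP-> /eqP->.
by exists 0; rewrite ?inE.
Qed.

Lemma norm_lt a b x : nonzero_ideals a -> is_ideal b -> a `<=` b -> b x -> ~ a x ->
  (ideal_norm b < ideal_norm a)%N.
Proof.
by move=> na ib; have [s ts] := transversal_exists na; exact: (ideal_norm_lt na.1 ib ts).
Qed.

Lemma norm_leq a b : nonzero_ideals a -> is_ideal b -> a `<=` b ->
  (ideal_norm b <= ideal_norm a)%N.
Proof.
move=> na ib ab; case: (pselect (b `<=` a)) => [ba|nba].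
  by rewrite (_ : a = b) //; apply/seteqP.
have [x bx nax] : exists2 x, b x & ~ a x.
  by apply: contrapT => h; apply: nba => x bx; apply: contrapT => nax; apply: h; exists x.
exact/ltnW/(norm_lt na ib ab bx nax).
Qed.

Lemma prime_norm_gt1 p : nonzero_primes p -> (1 < ideal_norm p)%N.
Proof.
move=> [[ip p1 _] p0]; rewrite -ideal_normT.
exact: (@norm_lt p setT 1).
Qed.

Lemma norm_ind (P : set A -> Prop) :
  (forall a, nonzero_ideals a ->
    (forall b, nonzero_ideals b -> (ideal_norm b < ideal_norm a)%N -> P b) -> P a) ->
  forall a, nonzero_ideals a -> P a.
Proof.
move=> h a; have [n] := ubnP (ideal_norm a); elim: n => // n ih in a *.
move=> an na; apply: h => // b nb ba; apply: ih => //; exact: leq_trans ba _.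
Qed.

(** Two powers of [x] agree modulo [p], and [x] can be cancelled from their
    difference. *)
Lemma prime_inv_mod p x : nonzero_primes p -> ~ p x -> exists r, p (1 - r * x).
Proof.
move=> [[ip p1 pM] p0] npx; have [s ts] := transversal_exists (conj ip p0).
have [] := transversal_collision (fun i : 'I_(size s).+1 => x ^+ i) ip ts.
  by rewrite card_ord.
suff main : forall i j : nat, (i < j)%N -> p (x ^+ i - x ^+ j) -> exists r, p (1 - r * x).
  move=> i [j [ij pij]]; case: (ltngtP i j) => [lt|lt|e]; first exact: (main i j).
    by apply: (main j i) => //; rewrite -opprB; exact: idealN.
  by move: ij; rewrite (val_inj e) eqxx.
move=> i j ij pij.
have pX k : ~ p (x ^+ k).
  by elim: k => [|k ih]; rewrite ?expr0 // exprS => /pM[].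
exists (x ^+ (j - i).-1); rewrite -exprSr prednK ?subn_gt0 //.
have : p (x ^+ i * (1 - x ^+ (j - i))) by rewrite mulrBr mulr1 -exprD subnKC // ltnW.
by move=> /pM[/pX|].
Qed.

Lemma prime_maximal p a : nonzero_primes p -> is_ideal a -> p `<=` a ->
  a = p \/ a = [set: A].
Proof.
move=> pP ia pa; case: (pselect (a `<=` p)) => [ap|nap].
  by left; apply/seteqP.
right; have [x ax npx] : exists2 x, a x & ~ p x.
  by apply: contrapT => h; apply: nap => x ax; apply: contrapT => npx; apply: h; exists x.
have [r pr] := prime_inv_mod pP npx; apply: ideal_eqT => //.
by rewrite -(subrK (r * x) 1); apply: idealD => //; [exact: pa|exact: idealMl].
Qed.

Lemma prime_sub_eq p q : nonzero_primes p -> nonzero_primes q -> p `<=` q -> p = q.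
Proof.
move=> pP [[iq q1 _] _] pq; have [//|qT] := prime_maximal pP iq pq.
by exfalso; apply: q1; rewrite qT.
Qed.

Lemma nonprime_split a : is_ideal a -> ~ a 1 -> ~ is_prime_ideal a ->
  exists x y, [/\ ~ a x, ~ a y & a (x * y)].
Proof.
move=> ia a1 npa; apply: contrapT => h; apply: npa; split=> // x y axy.
apply: contrapT => /not_orP[nx ny]; apply: h; by exists x, y.
Qed.

Lemma norm_add_lt a x : nonzero_ideals a -> ~ a x ->
  nonzero_ideals (ideal_add a (principal x)) /\
  (ideal_norm (ideal_add a (principal x)) < ideal_norm a)%N.
Proof.
move=> [ia a0] nax; have ix := principal_ideal x.
have ias := ideal_add_ideal ia ix; have sub := @ideal_addl _ a _ ix.
split; first by split=> //; exact: nonzero_sub a0.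
apply: (norm_lt (conj ia a0) ias sub _ nax).
by apply: ideal_addr => //; exact: principal_id.
Qed.

(** If [x y] is in [a] but neither factor is, then [a + (x)] is still proper,
    for otherwise [y] would be in [a]. *)
Lemma prime_above a : nonzero_ideals a -> ~ a 1 ->
  exists2 p, nonzero_primes p & a `<=` p.
Proof.
elim/norm_ind=> {}a na ih a1; have ia := na.1.
case: (pselect (is_prime_ideal a)) => [pa|/(nonprime_split ia a1)[x [y [ax ay axy]]]].
  by exists a => //; split=> //; case: na.
have [nb lt] := norm_add_lt na ax.
have [|p pP sp] := ih _ nb lt.
  move=> [u [_ [au [r ->] e]]]; apply: ay.
  rewrite -(mul1r y) e mulrDl; apply: idealD => //; first exact: idealMr.
  by rewrite -mulrA; exact: idealMl.
by exists p => //; apply: subset_trans sp; exact/ideal_addl/principal_ideal.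
Qed.

Definition ideal_prod l : set A := foldr ideal_mul [set: A] l.

Lemma ideal_prod_ideal l : (forall q, q \in l -> is_ideal q) -> is_ideal (ideal_prod l).
Proof.
case: l => //= q l h; apply: ideal_mul_ideal; apply: h; exact: mem_head.
Qed.

Lemma ideal_prod_cat l l' : (forall q, q \in l ++ l' -> is_ideal q) ->
  ideal_prod (l ++ l') = ideal_mul (ideal_prod l) (ideal_prod l').
Proof.
elim: l => [|q l ih] /= h; first by rewrite ideal_mulTl //; exact: ideal_prod_ideal.
have hl q' : q' \in l ++ l' -> is_ideal q' by move=> ql; apply: h; rewrite inE ql orbT.
rewrite ih // ideal_mulA //; first by apply: h; exact: mem_head.
  by apply: ideal_prod_ideal => q' ql; apply: hl; rewrite mem_cat ql.
by apply: ideal_prod_ideal => q' ql; apply: hl; rewrite mem_cat ql orbT.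
Qed.

Lemma ideal_prod_rem p l : (forall q, q \in l -> is_ideal q) -> p \in l ->
  ideal_prod l = ideal_mul p (ideal_prod (rem p l)).
Proof.
elim: l => //= q l ih h; rewrite inE => /orP[/eqP ->|pl]; first by rewrite eqxx.
case: eqP => [->//|_] /=.
have hl q' : q' \in l -> is_ideal q' by move=> ql; apply: h; rewrite inE ql orbT.
have iq : is_ideal q by apply: h; exact: mem_head.
have ip := hl _ pl.
have ir : is_ideal (ideal_prod (rem p l)).
  by apply: ideal_prod_ideal => q' /mem_rem/hl.
by rewrite ih // !ideal_mulA // (ideal_mulC q).
Qed.

Lemma prime_prod_sub p l : is_prime_ideal p -> (forall q, q \in l -> is_ideal q) ->
  ideal_prod l `<=` p -> exists2 q, q \in l & q `<=` p.
Proof.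
move=> pp; elim: l => [|q l ih] h /=.
  by case: pp => _ p1 _ /(_ 1 I).
move=> /(prime_mul_sub pp)[|qp|]; first by apply: h; exact: mem_head.
  by exists q => //; exact: mem_head.
move=> /ih[q' ql|q' ql qp]; first by apply: h; rewrite inE ql orbT.
by exists q' => //; rewrite inE ql orbT.
Qed.

(** If [x y] is in [a], then [a] contains [(a + (x)) (a + (y))]. *)
Lemma contains_prime_prod a : nonzero_ideals a ->
  exists2 l, (forall q, q \in l -> nonzero_primes q) & ideal_prod l `<=` a.
Proof.
elim/norm_ind=> {}a na ih; have [ia a0] := na.
case: (pselect (a 1)) => [/(ideal_eqT ia)->|a1]; first by exists [::].
case: (pselect (is_prime_ideal a)) => [pa|/(nonprime_split ia a1)[x [y [ax ay axy]]]].
  exists [:: a] => [q|]; first by rewrite inE => /eqP ->.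
  exact: ideal_mul_subl.
have [nb /(ih _ nb)[l1 h1 s1]] := norm_add_lt na ax.
have [nc /(ih _ nc)[l2 h2 s2]] := norm_add_lt na ay.
have hc q : q \in l1 ++ l2 -> nonzero_primes q.
  by rewrite mem_cat => /orP[/h1|/h2].
exists (l1 ++ l2) => //; rewrite ideal_prod_cat; last by move=> q /hc[[]].
apply: subset_trans (ideal_mul_mono s1 s2) _; apply: ideal_mul_sub => //.
move=> _ _ [u [_ [au [r ->] ->]]] [v [_ [av [t ->] ->]]].
have -> : (u + r * x) * (v + t * y) = u * (v + t * y) + r * x * v + r * t * (x * y) by ring.
apply: idealD => //; last exact: idealMl.
by apply: idealD => //; [exact: idealMr|exact: idealMl].
Qed.

(** A product of as few primes as possible inside [principal x], with [x] in
    [p], must involve [p]; the other factors provide [y], that is the fraction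
    [y / x] in the inverse of [p] and outside the ring. *)
Lemma prime_fraction p : nonzero_primes p ->
  exists x y, [/\ x <> 0, p x, forall u, p u -> exists w, y * u = x * w &
    ~ exists w, y = x * w].
Proof.
move=> pP; have [[ip p1 pM] p0] := pP.
have [x px x0] := (nonzero_idealP ip).1 p0.
pose Q n := `[< exists l, [/\ size l = n, forall q, q \in l -> nonzero_primes q
   & ideal_prod l `<=` principal x] >].
have exQ : exists n, Q n.
  have [l hl sl] := contains_prime_prod (nonzero_principal x0).
  by exists (size l); apply/asboolP; exists l.
case: (ex_minnP exQ) => n /asboolP[l [ln hl sl]] nmin.
have hil q : q \in l -> is_ideal q by move=> /hl[[]].
have [q ql qp] := prime_prod_sub pP.1 hil (subset_trans sl (principal_sub ip px)).
have qE := prime_sub_eq (hl _ ql) pP qp; rewrite {q qp}qE in ql.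
have [y ly nxy] : exists2 y, ideal_prod (rem p l) y & ~ principal x y.
  apply: contrapT => h.
  have /nmin : Q (size (rem p l)).
    apply/asboolP; exists (rem p l); split=> // [q /mem_rem/hl//|y ly].
    by apply: contrapT => nxy; apply: h; exists y.
  by rewrite size_rem // ln; case: (n) ln ql => [/size0nil->//|m _ _]; rewrite ltnn.
exists x, y; split=> //.
- move=> u pu; have : ideal_prod l (u * y).
    by rewrite (ideal_prod_rem hil ql); exact: mem_ideal_mul.
  by move=> /sl[w e]; exists w; rewrite mulrC e mulrC.
- by move=> [w e]; apply: nxy; exists w; rewrite mulrC.
Qed.

(** Clearing denominators in [1 = u + (y / x) v] with [u], [v] in [p]: the
    ideal [p] is invertible. *)
Lemma prime_inverse p : nonzero_primes p ->
  exists x y u v, [/\ x <> 0, p u /\ p v, x = x * u + y * v,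
    forall t, p t -> exists w, y * t = x * w & ~ exists w, y = x * w].
Proof.
move=> pP; have [[ip p1 pM] p0] := pP.
have [x [y [x0 px hy ny]]] := prime_fraction pP.
have [t pt nt] : exists2 t, p t & ~ exists2 w, p w & y * t = x * w.
  apply: contrapT => h; apply: ny.
  case: dedA => _ _ /(_ p x y (conj ip p0) x0); apply=> u pu.
  by apply: contrapT => nu; apply: h; exists u.
have [w yt] := hy _ pt.
have npw : ~ p w by move=> pw; apply: nt; exists w.
have [r pr] := prime_inv_mod pP npw.
exists x, y, (1 - r * w), (r * t); split=> //; first by split=> //; exact: idealMl.
have -> : y * (r * t) = r * (y * t) by ring.
by rewrite yt; ring.
Qed.

(** Multiplying by the inverse of [p]. *)
Lemma prime_mul_cancel p b c : nonzero_primes p -> is_ideal c ->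
  ideal_mul p b `<=` ideal_mul p c -> b `<=` c.
Proof.
move=> pP ic sub z bz; have [x [y [u [v [x0 [pu pv] xE hy _]]]]] := prime_inverse pP.
have [w cw yvz] : exists2 w, c w & y * (v * z) = x * w.
  pose e := [set t | exists2 w, c w & y * t = x * w].
  have ie : is_ideal e.
    split; first by exists 0; [exact: ideal0|ring].
      by move=> t t' [w cw E] [w' cw' E']; exists (w + w'); [exact: idealD|rewrite !mulrDr E E'].
    by move=> r t [w cw E]; exists (r * w); [exact: idealMl|rewrite mulrCA E; ring].
  suff : ideal_mul p c `<=` e by apply; apply: sub; exact: mem_ideal_mul.
  apply: ideal_mul_sub => // t t' pt ct'; have [w yt] := hy _ pt.
  by exists (w * t'); [exact: idealMl|rewrite mulrA yt mulrA].
have -> : z = u * z + w.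
  apply: (mulAI x0); rewrite mulrDr -yvz {1}xE; ring.
apply: idealD => //; apply: (ideal_mul_subr ic (a := p)).
by apply: sub; exact: mem_ideal_mul.
Qed.

(** The quotient is [a + (y / x) a], strictly larger than [a] because [y / x]
    is not integral. *)
Lemma prime_quotient p a : nonzero_primes p -> nonzero_ideals a -> a `<=` p ->
  exists b, [/\ nonzero_ideals b, a = ideal_mul p b & (ideal_norm b < ideal_norm a)%N].
Proof.
move=> pP na ap; have [ia a0] := na; have [[ip p1 pM] p0] := pP.
have [x [y [u [v [x0 [pu pv] xE hy ny]]]]] := prime_inverse pP.
pose b : set A := [set z | exists s t, [/\ a s, a t & x * z = x * s + y * t]].
have ib : is_ideal b.
  split; first by exists 0, 0; rewrite !mulr0 addr0; split=> //; exact: ideal0.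
    move=> z z' [s [t [as_ at_ E]]] [s' [t' [as' at' E']]]; exists (s + s'), (t + t').
    by split; [exact: idealD|exact: idealD|rewrite mulrDr E E'; ring].
  move=> r z [s [t [as_ at_ E]]]; exists (r * s), (r * t).
  by split; [exact: idealMl|exact: idealMl|rewrite mulrCA E; ring].
have ab : a `<=` b.
  by move=> s as_; exists s, 0; rewrite mulr0 addr0; split=> //; exact: ideal0.
have nb : nonzero_ideals b by split=> //; exact: nonzero_sub a0.
have [z bz naz] : exists2 z, b z & ~ a z.
  apply: contrapT => h; apply: ny; case: dedA => _ _ /(_ a x y na x0); apply=> t at_.
  have [w yt] := hy _ (ap _ at_); exists w => //; apply: contrapT => naw; apply: h.
  exists w => //; exists 0, t; rewrite mulr0 add0r; split=> //; exact: ideal0.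
exists b; split=> //; last exact: norm_lt bz naz.
apply/seteqP; split.
  move=> s as_; have [w ys] := hy _ (ap _ as_).
  have -> : s = u * s + v * w.
    by apply: (mulAI x0); rewrite mulrDr [x * (v * w)]mulrCA -ys {1}xE; ring.
  have ipb : is_ideal (ideal_mul p b) by exact: ideal_mul_ideal.
  apply: (idealD ipb); apply: mem_ideal_mul => //; first exact: ab.
  exists 0, s; rewrite mulr0 add0r; split=> //; exact: ideal0.
apply: ideal_mul_sub => // t s pt [s1 [s2 [as1 as2 E]]].
have [w yt] := hy _ pt.
have -> : t * s = t * s1 + w * s2.
  apply: (mulAI x0); rewrite mulrCA E !mulrDr [x * (w * _)]mulrA -yt.
  by ring.
by apply: idealD => //; exact: idealMl.
Qed.

(** Every non-zero ideal is obtained from the unit ideal by multiplying by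
    primes. *)
Lemma factorization_ind (P : set A -> Prop) : P [set: A] ->
  (forall p b, nonzero_primes p -> nonzero_ideals b -> P b -> P (ideal_mul p b)) ->
  forall a, nonzero_ideals a -> P a.
Proof.
move=> PT Pp a; elim/norm_ind=> {}a na ih; have [ia a0] := na.
case: (pselect (a 1)) => [/(ideal_eqT ia)->//|a1].
have [p pP /(prime_quotient pP na)[b [nb aE lt]]] := prime_above na a1.
by rewrite aE; apply: Pp => //; exact: ih.
Qed.

Lemma nonzero_prime_ideal p : nonzero_primes p -> nonzero_ideals p.
Proof. by move=> [[ip _ _] p0]; split. Qed.

Lemma ideal_mul_cancel a b c : nonzero_ideals a -> is_ideal b -> is_ideal c ->
  ideal_mul a b `<=` ideal_mul a c -> b `<=` c.
Proof.
move=> na; elim/(factorization_ind): a / na b c => [|p a pP na ih] b c ib ic.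
  by rewrite !ideal_mulTl.
have [ip _] := nonzero_prime_ideal pP; have [ia _] := na.
rewrite -!ideal_mulA // => /(prime_mul_cancel pP) h; apply: ih => //; apply: h.
exact: ideal_mul_ideal.
Qed.

Lemma ideal_mul_inj a b c : nonzero_ideals a -> is_ideal b -> is_ideal c ->
  ideal_mul a b = ideal_mul a c -> b = c.
Proof. by move=> na ib ic e; apply/seteqP; split; apply: (ideal_mul_cancel na) => //; rewrite e. Qed.

(** To contain is to divide: cancel the primes of [b] one by one. *)
Lemma sub_ideal_dvd b a : nonzero_ideals b -> nonzero_ideals a -> a `<=` b ->
  exists2 c, nonzero_ideals c & a = ideal_mul b c.
Proof.
move=> nb; elim/(factorization_ind): b / nb a => [|p b pP nb ih] a na ab.
  by exists a; rewrite ?ideal_mulTl //; case: na.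
have [[ip _] [ib _]] := (nonzero_prime_ideal pP, nb).
have [a' [na' aE _]] := prime_quotient pP na (subset_trans ab (@ideal_mul_subl _ p b ip)).
have [|c nc a'E] := ih a' na'; first by apply: (prime_mul_cancel pP ib); rewrite -aE.
by exists c => //; rewrite aE a'E ideal_mulA //; case: nc.
Qed.

Lemma ideal_dvdP b a : nonzero_ideals b -> nonzero_ideals a ->
  ideal_dvd b a <-> a `<=` b.
Proof.
move=> nb na; split=> [|ab]; first exact: ideal_dvd_sub nb.1.
by have [c [ic _] ->] := sub_ideal_dvd nb na ab; exists c.
Qed.

(** With [x] in [b] outside [p b], multiplication by [x] identifies the
    quotient by [p] with [b / p b], so that the sums [z + x r] over
    representatives [z] for [b] and [r] for [p] represent [p b]. *)
Lemma ideal_norm_prime_mul p b : nonzero_primes p -> nonzero_ideals b ->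
  ideal_norm (ideal_mul p b) = (ideal_norm p * ideal_norm b)%N.
Proof.
move=> pP nb; have [np [ib b0]] := (nonzero_prime_ideal pP, nb).
have [[ip p1 pM] p0] := pP.
have ipb : is_ideal (ideal_mul p b) by exact: ideal_mul_ideal.
have [x bx npx] : exists2 x, b x & ~ ideal_mul p b x.
  apply: contrapT => h; apply: p1; apply: (ideal_mul_cancel nb (idealT)) => //.
  rewrite ideal_mulT // ideal_mulC => x bx; apply: contrapT => nx; apply: h.
  by exists x.
have ix := principal_ideal x.
have bE z : b z -> exists r w, ideal_mul p b w /\ z = x * r + w.
  move=> bz; pose c := ideal_add (ideal_mul p b) (principal x).
  have ic : is_ideal c by exact: ideal_add_ideal.
  have pbc : ideal_mul p b `<=` c by exact: ideal_addl.
  have nc : nonzero_ideals c.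
    by split=> //; apply: nonzero_sub pbc (nonzero_ideal_mul np nb).2.
  have cb : c `<=` b.
    move=> _ [w [_ [pbw [r ->] ->]]]; apply: idealD => //; last exact: idealMl.
    exact: ideal_mul_subr pbw.
  have [e ne cE] := sub_ideal_dvd nb nc cb.
  have pe : p `<=` e by apply: (ideal_mul_cancel nb ip ne.1); rewrite -cE ideal_mulC.
  have [ep|eT] := prime_maximal pP ne.1 pe.
    exfalso; apply: npx; rewrite ideal_mulC -ep -cE; apply: ideal_addr => //.
    exact: principal_id.
  have : c z by rewrite cE eT ideal_mulT.
  by move=> [w [_ [pbw [r ->] ->]]]; exists r, w; rewrite addrC (mulrC r).
have xp r : p r -> ideal_mul p b (x * r) by move=> pr; rewrite mulrC; exact: mem_ideal_mul.
have xpI r : ideal_mul p b (x * r) -> p r.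
  move=> pbxr; apply: contrapT => /(prime_inv_mod pP)[w pw]; apply: npx.
  rewrite -(mulr1 x) -(subrK (w * r) 1) mulrDr; apply: idealD => //; first exact: xp.
  by rewrite mulrCA; exact: idealMl.
have [s ts] := transversal_exists np; have [t tt] := transversal_exists nb.
have [us injs covs] := ts; have [ut injt covt] := tt.
rewrite (ideal_norm_transversal ip ts) (ideal_norm_transversal ib tt).
have inj2 : {in [seq (r, z) | r <- s, z <- t] &,
    forall u u', ideal_mul p b ((u.2 + x * u.1) - (u'.2 + x * u'.1)) -> u = u'}.
  move=> _ _ /allpairsP[[r z] [/= rs zt ->]] /allpairsP[[r' z'] [/= rs' zt' ->]] /= h.
  have zz : z = z'.
    apply: injt => //; have := ideal_mul_subr ib h => bh.
    have -> : z - z' = (z + x * r - (z' + x * r')) + x * (r' - r) by ring.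
    by apply: idealD => //; exact: idealMr.
  rewrite zz; congr (_, _); apply: injs => //; apply: xpI.
  by move: h; rewrite zz (_ : _ - _ = x * (r - r')) //; ring.
have -> : (size s * size t)%N = size [seq u.2 + x * u.1 | u <- [seq (r, z) | r <- s, z <- t]].
  by rewrite size_map size_allpairs.
apply: ideal_norm_transversal => //; split.
- rewrite map_inj_in_uniq; first by rewrite allpairs_uniq // => -[? ?] [? ?].
  move=> u u' us' uu' e; apply: inj2 => //; rewrite e subrr; exact: ideal0.
- by move=> _ _ /mapP[u us' ->] /mapP[u' uu' ->] h; rewrite (inj2 u u').
- move=> z; have [z' zt bzz'] := covt z.
  have [r [w [pbw E]]] : exists r w, ideal_mul p b w /\ z - z' = x * r + w.
    by apply: bE; rewrite -opprB; exact: idealN.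
  have [r' rs prr'] := covs r; exists (z' + x * r').
    by apply/mapP; exists (r', z') => //; apply/allpairsP; exists (r', z').
  have -> : z' + x * r' - z = x * (r' - r) - w.
    by rewrite -[z](subrK z') E; ring.
  by apply: idealB => //; exact: xp.
Qed.

Lemma ideal_normM a b : nonzero_ideals a -> nonzero_ideals b ->
  ideal_norm (ideal_mul a b) = (ideal_norm a * ideal_norm b)%N.
Proof.
move=> na nb; elim/(factorization_ind): a / na => [|p a pP na ih].
  by rewrite ideal_mulTl ?ideal_normT ?mul1n //; case: nb.
have [[[ip _] [ia _]] [ib _]] := (nonzero_prime_ideal pP, na, nb).
rewrite -ideal_mulA // (ideal_norm_prime_mul pP na).
by rewrite (ideal_norm_prime_mul pP (nonzero_ideal_mul na nb)) ih mulnA.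
Qed.

End Dedekind.

(** * Bounded denominators in a ring of integers *)

Section IntegralElements.
Context {K : fieldExtType rat}.

Lemma integralP (x : K) :
  reflect (integralOver (intr : int -> K) x) (x \in @integral_pred K).
Proof. exact: asboolP. Qed.

(** An element acting on a finitely generated subgroup is an eigenvalue of an
    integer matrix, so a root of its characteristic polynomial. *)
Lemma module_integral m (x : 'I_m -> K) (g : K) : (exists i, x i != 0) ->
  (forall j, exists z : 'I_m -> int, g * x j = \sum_i (z i)%:~R * x i) ->
  g \in @integral_pred K.
Proof.
move=> [i0 xi0] /choice[f hf]; apply/integralP.
pose A : 'M[int]_m := \matrix_(i, j) f j i.
exists (char_poly A); first exact: char_poly_monic.
rewrite map_char_poly -eigenvalue_root_char; apply/eigenvalueP.
exists (\row_i x i); last first.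
  by apply: contraNneq xi0 => /rowP/(_ i0); rewrite !mxE => ->.
apply/rowP => j; rewrite !mxE hf; apply: eq_bigr => i _.
by rewrite !mxE mulrC.
Qed.

(** [q] is the family of coordinate forms of the rational basis [e]. *)
Definition coordinates n (e : 'I_n -> K) (q : 'I_n -> K -> rat) : Prop :=
  [/\ forall x, x = \sum_i q i x *: e i,
      forall i j, q i (e j) = (i == j)%:R &
      forall i (a : rat) x y, q i (a *: x + y) = a * q i x + q i y].

Section Coordinates.
Context {n : nat} {e : 'I_n -> K} {q : 'I_n -> K -> rat} (eq_ : coordinates e q).

Lemma coordE x : x = \sum_i q i x *: e i. Proof. by case: eq_. Qed.

Lemma coord0 i : q i 0 = 0.
Proof.
case: eq_ => _ _ /(_ i 1 0 0); rewrite scale1r addr0 mul1r => h.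
by apply: (addrI (q i 0)); rewrite -h addr0.
Qed.

Lemma coordZ i a x : q i (a *: x) = a * q i x.
Proof. by case: eq_ => _ _ /(_ i a x 0); rewrite addr0 coord0 addr0. Qed.

Lemma coordD i x y : q i (x + y) = q i x + q i y.
Proof. by case: eq_ => _ _ /(_ i 1 x y); rewrite scale1r mul1r. Qed.

Lemma coordN i x : q i (- x) = - q i x.
Proof. by rewrite -scaleN1r coordZ mulN1r. Qed.

Lemma coordB i x y : q i (x - y) = q i x - q i y.
Proof. by rewrite coordD coordN. Qed.

Lemma coord_sum i (I : Type) (s : seq I) (P : pred I) (F : I -> K) :
  q i (\sum_(j <- s | P j) F j) = \sum_(j <- s | P j) q i (F j).
Proof. by elim/big_rec2: _ => [|j y x _ <-]; rewrite ?coord0 ?coordD. Qed.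

Lemma coord_lin i (c : 'I_n -> rat) : q i (\sum_j c j *: e j) = c i.
Proof.
rewrite coord_sum (bigD1 i) //= big1 ?addr0 => [|j ji]; rewrite coordZ.
  by case: eq_ => _ -> _; rewrite eqxx mulr1.
by case: eq_ => _ -> _; rewrite eq_sym (negPf ji) mulr0.
Qed.

Lemma coord_inj x y : (forall i, q i x = q i y) -> x = y.
Proof. by move=> h; rewrite (coordE x) (coordE y); apply: eq_bigr => i _; rewrite h. Qed.

(** The matrix of multiplication by [x], acting on rows. *)
Definition mulmat x : 'M[rat]_n := \matrix_(i, j) q j (x * e i).

Lemma mulmatM x y : mulmat (x * y) = mulmat y *m mulmat x.
Proof.
apply/matrixP => i k; rewrite !mxE -mulrA {1}(coordE (y * e i)) mulr_sumr coord_sum.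
by apply: eq_bigr => j _; rewrite !mxE -scalerAr coordZ.
Qed.

Lemma mulmatD x y : mulmat (x + y) = mulmat x + mulmat y.
Proof. by apply/matrixP => i j; rewrite !mxE mulrDl coordD. Qed.

Lemma mulmat0 : mulmat 0 = 0.
Proof. by apply/matrixP => i j; rewrite !mxE mul0r coord0. Qed.

Lemma mulmatZ a x : mulmat (a *: x) = a *: mulmat x.
Proof. by apply/matrixP => i j; rewrite !mxE -scalerAl coordZ. Qed.

Lemma mulmat1 : mulmat 1 = 1%:M.
Proof.
by apply/matrixP => i j; rewrite !mxE mul1r; case: eq_ => _ -> _; rewrite eq_sym.
Qed.

(** The powers of [x] act on an eigenvector through the powers of the
    eigenvalue, so an integral equation of [x] is one of the eigenvalue. *)
Lemma mulmat_eigenvalue_Aint x (r : algC) : x \in @integral_pred K ->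
  eigenvalue (map_mx ratr (mulmat x)) r -> r \in Aint.
Proof.
move=> /integralP[p pmon /eqP px] /eigenvalueP[v vr v0].
have vX k : v *m map_mx ratr (mulmat (x ^+ k)) = r ^+ k *: v.
  elim: k => [|k ih]; first by rewrite mulmat1 map_mx1 mulmx1 scale1r.
  by rewrite exprSr mulmatM map_mxM mulmxA vr -scalemxAl ih scalerA -exprS.
apply: (@root_monic_Aint (map_poly intr p)).
- have wide (R : nzRingType) (y : R) : (map_poly intr p).[y] =
      \sum_(k < size p) (p`_k)%:~R * y ^+ k.
    rewrite (@horner_coef_wide _ (size p)) ?size_poly //.
    by apply: eq_bigr => k _; rewrite coef_map_id0.
  have sumM (I : finType) (c : I -> int) (z : I -> K) :
      mulmat (\sum_k (c k)%:~R * z k) = \sum_k (c k)%:~R *: mulmat (z k).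
    elim/big_rec2: _ => [|k y w _ <-]; first exact: mulmat0.
    rewrite mulmatD -mulmatZ; congr (mulmat _ + _).
    by rewrite mulrzl scaler_int.
  have : v *m map_mx ratr (mulmat (map_poly intr p).[x]) = 0.
    by rewrite px mulmat0 map_mx0 mulmx0.
  rewrite (wide K x) sumM raddf_sum mulmx_sumr => e0; apply/eqP.
  rewrite (wide algC r).
  have /eqP : (\sum_(k < size p) (p`_k)%:~R * r ^+ k) *: v = 0.
    rewrite scaler_suml -[RHS]e0; apply: eq_bigr => k _.
    by rewrite /= map_mxZ -scalemxAr vX scalerA rmorph_int.
  by rewrite scaler_eq0 (negPf v0) orbF => /eqP.
- exact: monic_map.
- by apply/polyOverP => k; rewrite coef_map /= rpred_int.
Qed.

(** The coefficients of the characteristic polynomial are rational numbers and,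
    by the factorization over the algebraic numbers, algebraic integers. *)
Lemma trace_int x : x \in @integral_pred K -> \tr (mulmat x) \is a Num.int.
Proof.
move=> xint; have [n0|n0] := posnP n.
  by rewrite /mxtrace big1 // => i; have := ltn_ord i; rewrite {2}n0.
pose A := map_mx (ratr : rat -> algC) (mulmat x).
have [s sE] := closed_field_poly_normal (char_poly A).
move: sE; rewrite (monicP (char_poly_monic _)) scale1r => sE.
have : char_poly A \is a polyOver Aint.
  rewrite sE big_seq; apply: rpred_prod => r rs; rewrite polyOverXsubC.
  apply: (mulmat_eigenvalue_Aint xint).
  by rewrite eigenvalue_root_char sE root_prod_XsubC.
move=> /polyOverP/(_ n.-1); rewrite char_poly_trace // rpredN => tint.
have : \tr A \is a Num.int.
  by apply: Cint_rat_Aint => //; rewrite trace_map_mx Crat_rat.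
by rewrite trace_map_mx Cint_rat.
Qed.

Lemma trace_lin (c : 'I_n -> rat) (z : 'I_n -> K) :
  \tr (mulmat (\sum_i c i *: z i)) = \sum_i c i * \tr (mulmat (z i)).
Proof.
elim/big_rec2: _ => [|i a x _ <-]; first by rewrite mulmat0 mxtrace0.
by rewrite mulmatD mxtraceD mulmatZ mxtraceZ.
Qed.

Definition trace_form : 'M[rat]_n := \matrix_(i, j) \tr (mulmat (e i * e j)).

Lemma trace_form_mul x j :
  ((\row_i q i x) *m trace_form) 0 j = \tr (mulmat (x * e j)).
Proof.
rewrite !mxE {2}(coordE x) mulr_suml.
under [X in mulmat X]eq_bigr do rewrite -scalerAl.
by rewrite trace_lin; apply: eq_bigr => i _; rewrite !mxE.
Qed.

(** A non-zero [x] pairs with its inverse to the trace of [1], that is [n]. *)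
Lemma trace_form_unit : trace_form \in unitmx.
Proof.
rewrite -row_free_unit -kermx_eq0; apply/rowV0P => v /sub_kermxP vG.
pose x := \sum_i v 0 i *: e i.
have vE : v = \row_i q i x by apply/rowP => i; rewrite mxE coord_lin.
have xe j : \tr (mulmat (x * e j)) = 0 by rewrite -trace_form_mul -vE vG mxE.
have xy y : \tr (mulmat (x * y)) = 0.
  rewrite (coordE y) mulr_sumr; under [X in mulmat X]eq_bigr do rewrite -scalerAr.
  by rewrite trace_lin big1 // => i _; rewrite xe mulr0.
have [x0|x0] := eqVneq x 0.
  by rewrite vE x0; apply/rowP => i; rewrite !mxE coord0.
have := xy x^-1; rewrite divff // mulmat1 mxtrace1 => /eqP; rewrite pnatr_eq0.
by move=> /eqP n0; apply/rowP => i; have := ltn_ord i; rewrite {2}n0.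
Qed.

End Coordinates.

Lemma common_denominator (I : finType) (f : I -> rat) :
  exists2 D : nat, (0 < D)%N & forall i, D%:R * f i \is a Num.int.
Proof.
exists (\prod_i `|denq (f i)|)%N.
  by apply: prodn_gt0 => i; rewrite absz_gt0 denq_neq0.
move=> i; rewrite (bigD1 i) //= natrM mulrAC rpredM ?rpred_nat //.
by rewrite pmulrn absz_denq mulrC -numqE rpred_int.
Qed.

(** Coordinates in which the ring of integers lies between the standard
    lattice and one of its homothetic images. *)
Definition integral_coordinates n (e : 'I_n -> K) (q : 'I_n -> K -> rat) (D : nat) :=
  [/\ coordinates e q, forall i, e i \in @integral_pred K, (0 < D)%N &
      forall x i, x \in @integral_pred K -> D%:R * q i x \is a Num.int].

(** Multiplying a basis by a common denominator of its structure constants makes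
    it span a multiplicatively closed lattice, hence integral.  The coordinates of
    an integral [x] then solve a linear system with the trace form as matrix and
    the integers [trace (x * e j)] as right-hand side. *)
Lemma integral_coordinates_exist :
  exists n (e : 'I_n -> K) (q : 'I_n -> K -> rat) (D : nat),
    integral_coordinates e q D.
Proof.
pose n := \dim {:K}; pose b := vbasis {:K}.
have [m m0 mP] := common_denominator (fun u : 'I_n * 'I_n * 'I_n =>
  coord b u.2 (b`_u.1.1 * b`_u.1.2)).
have m0' : m%:R != 0 :> rat by rewrite pnatr_eq0 -lt0n.
pose e (i : 'I_n) : K := m%:R *: b`_i.
pose q i x : rat := m%:R^-1 * coord b i x.
have eq_ : coordinates e q.
  split=> [x|i j|i a x y].
  - rewrite [LHS](coord_vbasis (memvf x)); apply: eq_bigr => i _.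
    by rewrite /q /e scalerA mulrAC mulVf // mul1r.
  - by rewrite /q linearZ /= mulKf // coord_free ?(eq_sym j) //; exact: basis_free (vbasisP _).
  - by rewrite /q linearP /= mulrDr mulrCA.
have eint i : e i \in @integral_pred K.
  apply: (@module_integral _ e).
    have [x x0] : exists x : K, x != 0 by exists 1; exact: oner_neq0.
    apply: contrapT => h; move/eqP: x0; apply.
    rewrite (coordE eq_ x) big1 // => j _.
    have [->|ej] := eqVneq (e j) 0; first by rewrite scaler0.
    by exfalso; apply: h; exists j.
  move=> j.
  have /choice[z hz] k : exists z : int, q k (e i * e j) = z%:~R.
    apply/intrP; rewrite /q /e -scalerAl -scalerAr !linearZ /=.
    rewrite mulKf //; exact: (mP (i, j, k)).
  exists z; rewrite [LHS](coordE eq_); apply: eq_bigr => k _.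
  by rewrite hz mulrzl scaler_int.
have [D D0 DP] := common_denominator (fun u : 'I_n * 'I_n =>
  invmx (trace_form (e := e) (q := q)) u.1 u.2).
exists n, e, q, D; split=> // x i xint.
have : (\row_i q i x) = (\row_i q i x) *m trace_form (e := e) (q := q)
          *m invmx (trace_form (e := e) (q := q)).
  by rewrite -mulmxA mulmxV ?mulmx1 // trace_form_unit.
move/rowP/(_ i); rewrite !mxE => ->; rewrite mulr_sumr rpred_sum // => j _.
rewrite trace_form_mul // mulrCA rpredM //; last exact: (DP (j, i)).
by apply: (trace_int eq_); apply: rpredM; [exact: xint|exact: eint].
Qed.

End IntegralElements.

(** * Ideals of a number field as lattices *)

Lemma floor_root n N : (0 < n)%N -> exists k, (k ^ n <= N < k.+1 ^ n)%N.
Proof.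
move=> n0; have ex : exists k, (N < k.+1 ^ n)%N.
  by exists N; rewrite (leq_trans (ltnSn N)) // -{1}(expn1 N.+1) leq_pexp2l.
case: (ex_minnP ex) => k kN kmin; exists k; rewrite kN andbT.
case: k kmin {kN} => [|k] kmin; first by rewrite exp0n.
by rewrite leqNgt; apply/negP => /kmin; rewrite ltnn.
Qed.

Section Lattice.
Context {K : fieldExtType rat} {n : nat} {e : 'I_n -> K} {q : 'I_n -> K -> rat}
  {D : nat} (frame : integral_coordinates e q D).
Local Notation O := (ringOfIntegers K).
Implicit Types (x y : K) (u v w : O) (a b : set O) (r s : rat).

Let qP : coordinates e q. Proof. by case: frame. Qed.
Let D0 : (0 < D)%N. Proof. by case: frame. Qed.

Lemma val_integral u : (u : K) \in @integral_pred K.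
Proof. by case: u. Qed.

Lemma lift_integral x : x \in @integral_pred K -> exists u : O, (u : K) = x.
Proof. by move=> xint; exists (RingOfIntegers xint). Qed.

Lemma valD u v : ((u + v : O) : K) = (u : K) + (v : K). Proof. exact: (rmorphD val). Qed.
Lemma valB u v : ((u - v : O) : K) = (u : K) - (v : K). Proof. exact: (rmorphB val). Qed.
Lemma valM u v : ((u * v : O) : K) = (u : K) * (v : K). Proof. exact: (rmorphM val). Qed.
Lemma val0 : ((0 : O) : K) = 0. Proof. exact: (rmorph0 val). Qed.
Lemma val_nat k : ((k%:R : O) : K) = k%:R. Proof. exact: (rmorph_nat val). Qed.
Lemma val_int z : ((z%:~R : O) : K) = z%:~R. Proof. exact: (rmorph_int val). Qed.
Lemma val_sum (I : Type) (l : seq I) (F : I -> O) :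
  ((\sum_(i <- l) F i : O) : K) = \sum_(i <- l) (F i : K).
Proof. exact: (rmorph_sum val). Qed.
Lemma ringOfIntegers_inj u v : (u : K) = v -> u = v. Proof. exact: val_inj. Qed.

Lemma val_neq0 u : u <> 0 -> (u : K) != 0.
Proof. by move=> u0; apply/eqP => h; apply: u0; apply: ringOfIntegers_inj; rewrite h val0. Qed.

Lemma natr_neq0 k : (0 < k)%N -> (k%:R : O) <> 0.
Proof.
move=> k0 /(congr1 (@ringOfIntegers_val K)); rewrite val_nat val0.
by move/eqP; rewrite -(scaler_nat k (1 : K)) scaler_eq0 oner_eq0 orbF pnatr_eq0 gtn_eqF.
Qed.

Lemma O_mul_eq0 u v : u * v = 0 -> u = 0 \/ v = 0.
Proof.
move=> /(congr1 (@ringOfIntegers_val K)); rewrite valM val0 => /eqP.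
by rewrite mulf_eq0 => /orP[/eqP h|/eqP h]; [left|right]; apply: ringOfIntegers_inj; rewrite h val0.
Qed.

Lemma dim_gt0 : (0 < n)%N.
Proof.
rewrite lt0n; apply/eqP => n0; have := oner_neq0 K.
rewrite (coordE qP 1) big1 ?eqxx // => i; have := ltn_ord i; by rewrite {2}n0.
Qed.

(** ** The sup norm of coordinates *)

Definition nrm x : rat := \big[Num.max/0]_i `|q i x|.

Lemma nrm_le x r : 0 <= r -> nrm x <= r <-> forall i, `|q i x| <= r.
Proof.
move=> r0; split=> [/bigmax_leP[_ h] i|h]; first exact: h.
by apply/bigmax_leP.
Qed.

Lemma coord_le_nrm x i : `|q i x| <= nrm x.
Proof. exact: le_bigmax. Qed.

Lemma nrm_ge0 x : 0 <= nrm x.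
Proof. exact: bigmax_ge_id. Qed.

Lemma nrmD x y : nrm (x + y) <= nrm x + nrm y.
Proof.
apply/nrm_le => [|i]; first by rewrite addr_ge0 ?nrm_ge0.
by rewrite (coordD qP) (le_trans (ler_normD _ _)) // lerD ?coord_le_nrm.
Qed.

Lemma nrmN x : nrm (- x) = nrm x.
Proof. by apply: eq_bigr => i _; rewrite (coordN qP) normrN. Qed.

Lemma nrmZ_le (c : rat) x : nrm (c *: x) <= `|c| * nrm x.
Proof.
apply/nrm_le => [|i]; first by rewrite mulr_ge0 ?nrm_ge0.
by rewrite (coordZ qP) normrM ler_wpM2l ?coord_le_nrm.
Qed.

Lemma nrmZ_ge (c : rat) x : `|c| * nrm x <= nrm (c *: x).
Proof.
have [->|c0] := eqVneq c 0; first by rewrite normr0 mul0r nrm_ge0.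
rewrite -{1}(scale1r x) -(mulVf c0) -scalerA -ler_pdivlMl ?normr_gt0 //.
by rewrite -normfV nrmZ_le.
Qed.

Lemma nrm_gt0 x : x != 0 -> 0 < nrm x.
Proof.
move=> x0; rewrite lt_neqAle nrm_ge0 andbT eq_sym; apply: contraNneq x0 => h.
apply/eqP/(coord_inj qP) => i; rewrite (coord0 qP); apply/eqP.
by rewrite -normr_le0 -h coord_le_nrm.
Qed.

Lemma integral_nrm_ge x : x \in @integral_pred K -> x != 0 -> 1 <= D%:R * nrm x.
Proof.
move=> xint x0; have [i qi] : exists i, q i x != 0.
  apply: contrapT => h; move/eqP: x0; apply; apply: (coord_inj qP) => i.
  by rewrite (coord0 qP); apply: contrapT => /eqP qi; apply: h; exists i.
case: frame => _ _ _ /(_ x i xint) /intrP[m mE].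
apply: (@le_trans _ _ (D%:R * `|q i x|)); last by rewrite ler_wpM2l ?coord_le_nrm.
rewrite -[D%:R]ger0_norm // -normrM mE -intr_norm -[1]/(1%:~R) ler_int.
have : m != 0.
  by apply: contraNneq qi => m0; move: mE; rewrite m0 => /eqP; rewrite mulf_eq0 pnatr_eq0 gtn_eqF.
by rewrite -normr_gt0.
Qed.

(** A constant for which the sup norm is submultiplicative. *)
Definition mul_const : nat :=
  Num.bound (\sum_k \sum_i \sum_j `|q k (e i * e j)|).
Local Notation C := mul_const.

Let sum_le_C : \sum_k \sum_i \sum_j `|q k (e i * e j)| < C%:R.
Proof. by apply: archi_boundP; do 3!apply: sumr_ge0 => ? _. Qed.

Lemma mul_const_gt0 : (0 < C)%N.
Proof.
rewrite -(ltr_nat rat); apply: le_lt_trans sum_le_C.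
by do 3!apply: sumr_ge0 => ? _.
Qed.

Lemma nrmM x y : nrm (x * y) <= C%:R * nrm x * nrm y.
Proof.
apply/nrm_le => [|k]; first by rewrite !mulr_ge0 ?nrm_ge0.
have -> : q k (x * y) = \sum_i \sum_j q i x * q j y * q k (e i * e j).
  rewrite {1}(coordE qP x) mulr_suml (coord_sum qP); apply: eq_bigr => i _.
  rewrite {1}(coordE qP y) mulr_sumr (coord_sum qP); apply: eq_bigr => j _.
  by rewrite -scalerAl -scalerAr !(coordZ qP) mulrA.
apply: (@le_trans _ _ (\sum_i \sum_j nrm x * nrm y * `|q k (e i * e j)|)).
  rewrite (le_trans (ler_norm_sum _ _ _)) //; apply: ler_sum => i _.
  rewrite (le_trans (ler_norm_sum _ _ _)) //; apply: ler_sum => j _.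
  by rewrite !normrM ler_wpM2r // ler_pM ?coord_le_nrm.
under eq_bigr do rewrite -mulr_sumr.
rewrite -mulr_sumr mulrC -mulrA ler_wpM2r ?mulr_ge0 ?nrm_ge0 //.
apply: le_trans (ltW sum_le_C); rewrite [leRHS](bigD1 k) //= lerDl.
by do 3!apply: sumr_ge0 => ? _.
Qed.

Lemma nrm_nat_bound x : exists M : nat, nrm x <= M%:R.
Proof. by exists (Num.bound (nrm x)); exact/ltW/archi_boundP/nrm_ge0. Qed.

(** Integers of bounded size are determined by bounded integral numerators. *)
Lemma lattice_points M : exists2 s : seq O, size s = ((2 * D * M).+1 ^ n)%N &
  forall u, nrm u <= M%:R -> u \in s.
Proof.
pose P (g : {ffun 'I_n -> 'I_(2 * D * M).+1}) : set O :=
  [set u | forall i, D%:R * q i u = (g i)%:R - (D * M)%:R].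
exists [seq xget 0 (P g) | g <- enum {: {ffun 'I_n -> 'I_(2 * D * M).+1}}].
  by rewrite size_map -cardE card_ffun !card_ord.
move=> u /(nrm_le _ (ler0n _ _)) uM.
have /choice[g gP] : forall i, exists m : 'I_(2 * D * M).+1, D%:R * q i u = m%:R - (D * M)%:R.
  move=> i; case: frame => _ _ _ /(_ u i (val_integral u)) /intrP[z zE].
  have := uM i; rewrite -(ler_pM2l (_ : 0 < D%:R)) ?ltr0n //.
  rewrite -{1}[D%:R]ger0_norm // -normrM zE -natrM -intr_norm [_%:R]pmulrn ler_int => zle.
  (* Translating by [D * M] makes the numerator a natural number. *)
  have z0 : 0 <= z + (D * M)%:Z by lia.
  have zlt : (absz (z + (D * M)%:Z)%R < (2 * D * M).+1)%N by lia.
  exists (Ordinal zlt) => /=; rewrite natr_absz ger0_norm // rmorphD /=.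
  by rewrite -pmulrn addrK.
apply/mapP; exists (finfun g); first by rewrite mem_enum.
have Pu : P (finfun g) u by move=> i; rewrite ffunE.
have Pw := xgetPex 0 (ex_intro _ u Pu); apply/val_inj/(coord_inj qP) => i /=.
have D0' : D%:R != 0 :> rat by rewrite pnatr_eq0 -lt0n.
by apply: (mulfI D0'); rewrite Pu Pw.
Qed.

Definition lattice_basis i : O :=
  RingOfIntegers (let: And4 _ h _ _ := frame in h i).
Local Notation E := lattice_basis.

(** Rounding the coordinates of [u / v]. *)
Lemma lattice_division u v : v <> 0 ->
  exists z : 'I_n -> int, nrm (u - v * \sum_i (z i)%:~R * E i : O) <= C%:R * nrm v.
Proof.
move=> v0; pose c i := q i ((u : K) / (v : K)).
exists (fun i => Num.floor (c i)).
pose f := \sum_i (c i - (Num.floor (c i))%:~R) *: e i.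
have -> : ((u - v * \sum_i (Num.floor (c i))%:~R * E i : O) : K) = (v : K) * f.
  rewrite valB valM val_sum /f; under [in RHS]eq_bigr do rewrite scalerBl.
  rewrite sumrB mulrBr -(coordE qP) mulrCA divff ?mulr1 ?val_neq0 //.
  congr (_ - _ * _); apply: eq_bigr => i _.
  by rewrite mulrzl scaler_int; exact: (raddfMz val).
apply: (le_trans (nrmM _ _)); rewrite -[leRHS]mulr1 ler_wpM2l ?mulr_ge0 ?nrm_ge0 //.
apply/nrm_le => // i; rewrite (coord_lin qP).
have /andP[h1 h2] := floor_itv (c i).
rewrite ger0_norm ?subr_ge0 // lerBlDr.
by move: h2; rewrite rmorphD /= addrC => /ltW.
Qed.

(** ** Finiteness of quotients and integral closure *)

Definition index_const : nat := ((3 * D * C) ^ n)%N.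

(** By division every class modulo [v] has a representative of size at most
    [C * r]. *)
Lemma principal_transversal v (r : nat) : v <> 0 -> nrm v <= r%:R ->
  exists2 s, transversal (principal v) s & (size s <= index_const * r ^ n)%N.
Proof.
move=> v0 vr.
have r0 : (0 < r)%N.
  by rewrite -(ltr_nat rat); apply: lt_le_trans vr; exact/nrm_gt0/val_neq0.
have [s ss sP] := lattice_points (C * r).
have [|t tt ts] := @covering_transversal _ (principal v) s (principal_ideal v).
  move=> u; have [z zle] := lattice_division u v0.
  exists (u - v * \sum_i (z i)%:~R * E i).
    apply: sP; apply: (le_trans zle); rewrite natrM ler_wpM2l //.
  by exists (- \sum_i (z i)%:~R * E i); ring.
exists t => //; apply: (leq_trans ts); rewrite ss /index_const -expnMn.
have := mul_const_gt0; rewrite leq_exp2r ?dim_gt0 // => C0.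
have : (0 < D * C * r)%N by rewrite !muln_gt0 D0 C0.
by lia.
Qed.

(** In other words a non-zero element of [a] is at least of the size of the
    [n]-th root of the norm of [a]. *)
Lemma norm_le_nrm a v (r : nat) : nonzero_ideals a -> a v -> v <> 0 ->
  nrm v <= r%:R -> (ideal_norm a <= index_const * r ^ n)%N.
Proof.
move=> [ia a0] av v0 vr; have [s ts ss] := principal_transversal v0 vr.
have ip := principal_ideal v; apply: leq_trans ss.
have sub := principal_sub ia av.
rewrite -(ideal_norm_transversal ip ts).
case: (pselect (a `<=` principal v)) => [sub'|nsub].
  by rewrite (_ : a = principal v) //; apply/seteqP.
have [x ax npx] : exists2 x, a x & ~ principal v x.
  by apply: contrapT => h; apply: nsub => x ax; apply: contrapT => nx; apply: h; exists x.
exact/ltnW/(ideal_norm_lt ip ia ts sub ax npx).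
Qed.

#[local] Arguments fintype.split : simpl never.

(** The finitely many elements of [a] of bounded size, together with the
    multiples of [v] by the lattice basis, generate [a] as a group. *)
Lemma O_integrally_closed a u v : nonzero_ideals a -> v <> 0 ->
  (forall w, a w -> exists2 w', a w' & u * w = v * w') ->
  exists w, u = v * w.
Proof.
move=> [ia a0] v0 uav; have [t at_ t0] := (nonzero_idealP ia).1 a0.
have [M tM] := nrm_nat_bound t.
have [s _ sP] := lattice_points (C * M).
pose x (i : 'I_(n + size s)) : O := match fintype.split i with
  | inl j => t * E j
  | inr j => if `[< a (nth 0 s j) >] then nth 0 s j else 0 end.
have xa i : a (x i).
  rewrite /x; case: (fintype.split i) => j; first exact: idealMr.
  by case: asboolP => // _; exact: ideal0.
have sl (j : 'I_n) : fintype.split (lshift (size s) j) = inl j by exact: (unsplitK (inl j)).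
have sr (j : 'I_(size s)) : fintype.split (rshift n j) = inr j by exact: (unsplitK (inr j)).
have xgen w : a w -> exists z : 'I_(n + size s) -> int, (w : K) = \sum_i (z i)%:~R * (x i : K).
  move=> aw; have [z zle] := lattice_division w t0.
  set y := w - _ in zle.
  have ay : a y by apply: idealB => //; exact: idealMr.
  have ys : y \in s.
    by apply: sP; apply: (le_trans zle); rewrite natrM ler_wpM2l.
  have yi : (index y s < size s)%N by rewrite index_mem.
  exists (fun i => match fintype.split i with inl j => z j | inr j => (j == Ordinal yi)%:Z end).
  rewrite big_split_ord /= [X in _ + X](bigD1 (Ordinal yi)) //= [X in _ + (_ + X)]big1 ?addr0; last first.
    by move=> j jy; rewrite sr (negPf jy) mul0r.
  rewrite /x sr eqxx mul1r /= nth_index //.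
  rewrite asboolT //.
  have -> : w = t * (\sum_i (z i)%:~R * E i) + y by rewrite /y; ring.
  rewrite valD mulr_sumr val_sum; congr (_ + _); apply: eq_bigr => j _.
  by rewrite sl mulrCA valM val_int.
have [w wE] : exists w : O, (w : K) = (u : K) / (v : K).
  apply: lift_integral; apply: (@module_integral _ _ (fun i => x i : K)).
    have /= := val_neq0 t0; have [z ->] := xgen t at_ => h.
    apply: contrapT => h'; move/eqP: h; apply; apply: big1 => i _.
    have [->|xi] := eqVneq (x i : K) 0; first by rewrite mulr0.
    by exfalso; apply: h'; exists i.
  move=> j; have [w' aw' E'] := uav _ (xa j).
  have [z zE] := xgen _ aw'; exists z; rewrite -zE mulrAC -valM E' valM mulrC mulKf //.
  exact: val_neq0.
by exists w; apply: ringOfIntegers_inj; rewrite valM wE mulrCA divff ?mulr1 // val_neq0.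
Qed.

Lemma O_dedekind_frame : dedekind_finite O.
Proof.
split; first exact: O_mul_eq0; last by move=> a x y; exact: O_integrally_closed.
move=> a [ia a0]; have [t at_ t0] := (nonzero_idealP ia).1 a0.
have [M tM] := nrm_nat_bound t.
have [s ts _] := principal_transversal t0 tM.
exact: (transversal_sub (principal_ideal t) ts (principal_sub ia at_) ia).
Qed.

End Lattice.

(** * Counting ideals of bounded norm *)

Section Counting.
Context {K : fieldExtType rat} {n : nat} {e : 'I_n -> K} {q : 'I_n -> K -> rat}
  {D : nat} (frame : integral_coordinates e q D).
Local Notation O := (ringOfIntegers K).
Implicit Types (x y : K) (u v w : O) (a b : set O).
Local Notation E := (lattice_basis frame).
Local Notation nrm := (@nrm K n q).
Local Notation C := (@mul_const K n e q).
Local Notation C1 := (@index_const K n e q D).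

Let qP : coordinates e q. Proof. by case: frame. Qed.
Let D0 : (0 < D)%N. Proof. by case: frame. Qed.
Let dedO : dedekind_finite O. Proof. exact: O_dedekind_frame frame. Qed.
Let n0 : (0 < n)%N. Proof. exact: dim_gt0 frame. Qed.

Lemma index_const_gt0 : (0 < C1)%N.
Proof. by rewrite expn_gt0 !muln_gt0 D0 (mul_const_gt0 (K := K)). Qed.

Lemma coord_lattice_comb (z : 'I_n -> int) i :
  q i (\sum_j (z j)%:~R * E j : O) = (z i)%:~R.
Proof.
rewrite val_sum -(coord_lin qP i (fun j => (z j)%:~R)); congr (q i _).
by apply: eq_bigr => j _; rewrite valM val_int mulrzl scaler_int.
Qed.

(** Box principle: two of the [k.+1 ^ n] points of a box are congruent. *)
Lemma short_vector a k : nonzero_ideals a -> (ideal_norm a < k.+1 ^ n)%N ->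
  exists v, [/\ a v, v <> 0 & nrm v <= k%:R].
Proof.
move=> [ia a0] ak; have [s ts] := transversal_exists dedO (conj ia a0).
rewrite (ideal_norm_transversal ia ts) in ak.
pose f (g : {ffun 'I_n -> 'I_k.+1}) : O := \sum_j (g j)%:Z%:~R * E j.
have [] := transversal_collision f ia ts; first by rewrite card_ffun !card_ord.
move=> g [h [gh afgh]]; exists (f g - f h); split=> //.
  move=> /eqP; rewrite subr_eq0 => /eqP fgh; move/eqP: gh; apply; apply/ffunP => i.
  have := coord_lattice_comb (fun j => (g j)%:Z) i; rewrite -/(f g) fgh coord_lattice_comb.
  by move=> /intr_inj [/val_inj].
apply/(nrm_le _ (ler0n _ _)) => i; rewrite valB (coordB qP) !coord_lattice_comb.
rewrite -rmorphB -intr_norm [k%:R]pmulrn ler_int.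
case: (g i) (h i) => [gi gk] [hi hk] /=; lia.
Qed.

(** Two of the integers [0], ..., [ideal_norm a] agree modulo [a], so that [a]
    contains a positive integer that divides [c`!]. *)
Lemma factorial_mem a c : nonzero_ideals a -> (ideal_norm a <= c)%N -> a c`!%:R.
Proof.
move=> [ia a0] ac; have [s ts] := transversal_exists dedO (conj ia a0).
rewrite (ideal_norm_transversal ia ts) in ac.
have [] := transversal_collision (fun i : 'I_(size s).+1 => i%:R : O) ia ts.
  by rewrite card_ord.
suff main : forall i j : nat, (i < j)%N -> (j <= size s)%N -> a (j%:R - i%:R) -> a c`!%:R.
  move=> i [j [ij aij]]; have [il jl] := (ltn_ord i, ltn_ord j).
  case: (ltngtP i j) => [lt|lt|eij]; last by move: ij; rewrite (val_inj eij) eqxx.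
    by apply: (main i j) => //; rewrite -opprB; exact: idealN.
  exact: (main j i).
move=> i j ij js aij; rewrite -natrB ?(ltnW ij) // in aij.
have /dvdnP[m ->] : (j - i %| c`!)%N.
  by apply: dvdn_fact; rewrite subn_gt0 ij /= (leq_trans _ ac) // (leq_trans (leq_subr _ _)).
by rewrite natrM; exact: idealMl.
Qed.

(** An ideal of norm at most [c] is a union of classes modulo [c`!]. *)
Lemma bounded_norm_finite c : exists t : seq (set O),
  forall a, nonzero_ideals a -> (ideal_norm a <= c)%N -> a \in t.
Proof.
have m0 : (c`!%:R : O) <> 0 by apply: (natr_neq0 (K := K)); rewrite fact_gt0.
have [s [us injs covs]] := transversal_exists dedO (nonzero_principal m0).
pose f (Z : {ffun 'I_(size s) -> bool}) : set O :=
  [set x | exists2 i, Z i & principal c`!%:R (nth 0 s i - x)].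
exists [seq f Z | Z <- enum {: {ffun 'I_(size s) -> bool}}] => a na ac.
have [ia _] := na; have am := factorial_mem na ac.
apply/mapP; exists [ffun i : 'I_(size s) => `[< a (nth 0 s i) >]]; first by rewrite mem_enum.
apply/seteqP; split=> [x ax|x [i]].
  have [y ys yx] := covs x; have yi : (index y s < size s)%N by rewrite index_mem.
  exists (Ordinal yi); rewrite ?ffunE /= nth_index //; apply/asboolP.
  by rewrite -(subrK x y); apply: idealD => //; exact: principal_sub yx.
rewrite ffunE => /asboolP ay pyx.
rewrite (_ : x = nth 0 s i - (nth 0 s i - x)); last by ring.
by apply: idealB => //; exact: principal_sub pyx.
Qed.

(** A short vector [v] of [a] writes the principal ideal of [v] as [a b] with
    [b] of bounded norm, and [v], [b] determine [a]. *)
Lemma ideals_upto_bound : exists2 B : nat, (0 < B)%N &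
  forall X, finite_set (@ideals_upto O X) /\
    (#|` fset_set (@ideals_upto O X)| <= B * X)%N.
Proof.
have [t tP] := bounded_norm_finite C1.
exists ((3 * D) ^ n * (size t).+1)%N => [|X].
  by rewrite muln_gt0 expn_gt0 !muln_gt0 D0.
have [X0|X0] := posnP X.
  have -> : @ideals_upto O X = set0.
    apply/seteqP; split=> // a [na]; rewrite X0 leqn0 => /eqP a0.
    by have := ideal_norm_gt0 dedO na; rewrite a0.
  by rewrite fset_set0 cardfs0.
have [k /andP[kX Xk]] := floor_root X n0.
have [s ss sP] := lattice_points frame k.
pose F u b : set O := xget set0 [set a | nonzero_ideals a /\ ideal_mul b a = principal u].
pose l := [seq F u b | u <- s, b <- t].
have sub : @ideals_upto O X `<=` [set` l].
  move=> a [na aX]; have [ka /andP[kaa aka]] := floor_root (ideal_norm a) n0.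
  have [v [av v0 vk]] := short_vector na aka.
  have kak : (ka <= k)%N.
    by rewrite -ltnS -(ltn_exp2r _ _ n0) (leq_ltn_trans kaa) // (leq_ltn_trans aX).
  have np := nonzero_principal v0.
  have [b nb pE] := sub_ideal_dvd dedO na np (principal_sub na.1 av).
  have vs : v \in s by apply: sP; rewrite (le_trans vk) // ler_nat.
  have bt : b \in t.
    apply: tP => //; rewrite -(leq_pmul2l (ideal_norm_gt0 dedO na)) -(ideal_normM dedO na nb).
    rewrite -pE (leq_trans (norm_le_nrm frame np (principal_id v) v0 vk)) //.
    by rewrite mulnC leq_mul2r kaa orbT.
  apply/allpairsP; exists (v, b); split=> //=.
  have pa : nonzero_ideals a /\ ideal_mul b a = principal v by rewrite ideal_mulC.
  have [nF FE] := xgetPex set0 (ex_intro (fun a => nonzero_ideals a /\ ideal_mul b a = principal v) a pa).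
  by apply: (ideal_mul_inj dedO nb na.1 nF.1); rewrite FE; case: pa.
have fin : finite_set (@ideals_upto O X) by apply: sub_finite_set sub _; exact: finite_seq.
split=> //; apply: (@leq_trans (size l)).
  apply: uniq_leq_size; first exact: fset_uniq.
  by move=> a; rewrite in_fset_set // => /set_mem/sub.
rewrite size_allpairs ss [X in (_ <= X)%N]mulnAC leq_mul //.
apply: (@leq_trans ((3 * D) ^ n * k ^ n)%N); last by rewrite leq_mul2l kX orbT.
rewrite -expnMn leq_exp2r //.
have k0 : (0 < k)%N by case: (k) Xk X0 => //; rewrite exp1n; case: (X).
by have : (0 < D * k)%N; [rewrite muln_gt0 D0 k0|lia].
Qed.

(** The elements [alpha] are the translates by [2 C k] of a box of side [k].
    Multiplication by [alpha] expands the sup norm by [C k] at least, so that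
    [alpha] divides no fixed integer when [k] is large: the ideals generated by
    the [alpha] avoid any given finite set.  On the other hand distinct
    points of an ideal [a] are at distance at least of the order of the
    [n]-th root of its norm, so a proportion at most of the order of
    [1 / ideal_norm a] of the [k.+1 ^ n] elements [alpha] generates [a]. *)
Lemma inverse_norms_diverge : exists2 B : nat, (0 < B)%N &
  forall S0 : seq (set O), exists S1 : seq (set O),
    [/\ uniq S1, forall a, a \in S1 -> nonzero_ideals a /\ a \notin S0 &
      forall R : realFieldType, 1 <= \sum_(a <- S1) (B%:R / (ideal_norm a)%:R : R)].
Proof.
have [M1 M1P] := nrm_nat_bound (q := q) (1 : K).
pose C4 := (2 * C * M1).+1.
exists (C1 * C4.+1 ^ n)%N => [|S0]; first by rewrite muln_gt0 index_const_gt0 expn_gt0.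
(* An integer lying in every non-zero member of [S0]. *)
pose m := (\prod_(a <- S0) (ideal_norm a)`!)%N.
have m0 : (0 < m)%N by rewrite /m; apply: prodn_gt0 => a; rewrite fact_gt0.
pose k := (D * m * M1).+1.
have C0 : (0 < C)%N by exact: (mul_const_gt0 (K := K)).
pose beta (g : {ffun 'I_n -> 'I_k.+1}) : O := \sum_j (g j)%:Z%:~R * E j.
pose alpha g : O := (2 * C * k)%:R + beta g.
have betak g : nrm (beta g) <= k%:R.
  apply/(nrm_le _ (ler0n _ _)) => i; rewrite coord_lattice_comb ger0_norm ?ler0z //.
  by rewrite [k%:R]pmulrn ler_int lez_nat -ltnS ltn_ord.
have nrm_natM (j : nat) y : nrm (j%:R * y) = j%:R * nrm y.
  rewrite mulr_natl -scaler_nat; apply/eqP.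
  by rewrite eq_le -{2 3}[j%:R]ger0_norm // (nrmZ_le frame) (nrmZ_ge frame).
(* Since [2 C k y = alpha y - beta y] and [beta y] has size at most [C k |y|]. *)
have expand g y : (C * k)%:R * nrm y <= nrm ((alpha g : K) * y).
  have : (2 * C * k)%:R * nrm y <= nrm ((alpha g : K) * y) + C%:R * k%:R * nrm y.
    rewrite -nrm_natM.
    have -> : (2 * C * k)%:R * y = (alpha g : K) * y + - ((beta g : K) * y).
      by rewrite valD val_nat; ring.
    rewrite (le_trans (nrmD frame _ _)) // lerD2l (nrmN frame) (le_trans (nrmM frame _ _)) //.
    by rewrite ler_wpM2r ?nrm_ge0 // ler_wpM2l.
  have -> : (2 * C * k)%:R * nrm y = (C * k)%:R * nrm y + C%:R * k%:R * nrm y.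
    by rewrite -mulnA mul2n -addnn natrD mulrDl -natrM.
  by rewrite lerD2r.
have Ck0 : 0 < (C * k)%:R :> rat by rewrite ltr0n muln_gt0 C0.
have alpha_neq0 g : alpha g <> 0.
  move=> ag0; have := expand g 1; rewrite mulr1 ag0 val0 leNgt => /negP; apply.
  apply: (@le_lt_trans _ _ 0); first by apply/nrm_le => // i; rewrite (coord0 qP) normr0.
  by rewrite mulr_gt0 // (nrm_gt0 frame) ?oner_neq0.
pose f g := principal (alpha g).
have fnz g : nonzero_ideals (f g) by exact: nonzero_principal.
have fS0 g : f g \notin S0.
  apply/negP => gS0.
  have [r rE] : f g m%:R.
    rewrite /m (big_rem _ gS0) natrM /=; apply: (idealMr _ (fnz g).1).
    exact: factorial_mem.
  have r0 : (r : K) != 0.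
    apply/eqP => r0; apply: (natr_neq0 (K := K) m0).
    by rewrite rE; apply: ringOfIntegers_inj; rewrite valM r0 mul0r val0.
  have := integral_nrm_ge frame (val_integral r) r0; rewrite leNgt => /negP; apply.
  have : (C * k)%:R * nrm r <= m%:R * M1%:R.
    apply: (le_trans (expand g r)); rewrite mulrC -valM -rE val_nat -[m%:R]mulr1.
    by rewrite nrm_natM ler_wpM2l.
  rewrite -(ler_pM2l (_ : 0 < D%:R)) ?ltr0n // => le1.
  rewrite -(ltr_pM2l Ck0) mulr1 mulrCA (le_lt_trans le1) //.
  by rewrite -!natrM ltr_nat mulnA (@leq_trans k) // leq_pmull.
have fiber a : (#|[pred g | f g == a]| * ideal_norm a <= C1 * C4.+1 ^ n * k ^ n)%N.
  have [/eqP ->//|/pred0Pn[g0 /= /eqP g0a]] := boolP (#|[pred g | f g == a]| == 0)%N.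
  have na : nonzero_ideals a by rewrite -g0a.
  have a_upper : (ideal_norm a <= C1 * (C4 * k) ^ n)%N.
    rewrite -g0a; apply: (norm_le_nrm frame (fnz g0) (principal_id _) (alpha_neq0 g0)).
    have -> : (C4 * k = 2 * C * k * M1 + k)%N by rewrite [LHS]mulSn addnC mulnAC.
    rewrite valD (le_trans (nrmD frame _ _)) // natrD lerD ?betak //.
    by rewrite val_nat -[X in nrm X]mulr1 nrm_natM [leRHS]natrM ler_wpM2l.
  (* Elements of [a] are at distance more than [l], so the cubes of side [l.+1]
     contain at most one of them. *)
  have ex : exists l, (ideal_norm a <= C1 * l.+1 ^ n)%N.
    exists (C4 * k)%N; apply: (leq_trans a_upper).
    by rewrite leq_mul2l leq_exp2r // leqnSn orbT.
  case: (ex_minnP ex) => l al lmin.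
  have a_lower : (C1 * l ^ n < ideal_norm a)%N.
    case: l lmin {al} => [|l] lmin; first by rewrite exp0n // muln0 (ideal_norm_gt0 dedO).
    by rewrite ltnNge; apply/negP => /lmin; rewrite ltnn.
  have lk : (l < C4 * k)%N.
    by rewrite -(ltn_exp2r _ _ n0) -(ltn_pmul2l index_const_gt0) (leq_trans a_lower).
  pose code (g : {ffun 'I_n -> 'I_k.+1}) : {ffun 'I_n -> 'I_(k %/ l.+1).+1} :=
    [ffun i => inord (g i %/ l.+1)].
  have codeE g i : (code g i = g i %/ l.+1 :> nat)%N.
    by rewrite ffunE inordK // ltnS leq_div2r // -ltnS.
  have inj : {in [pred g | f g == a] &, injective code}.
    move=> g h /eqP ga /eqP ha gh; apply: contrapT => ngh.
    have := a_lower; rewrite ltnNge => /negP; apply.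
    apply: (norm_le_nrm frame na (v := alpha g - alpha h)).
    - by apply: (idealB na.1); [rewrite -ga|rewrite -ha]; exact: principal_id.
    - move=> /eqP; rewrite subr_eq0 => /eqP /addrI bgh; apply: ngh; apply/ffunP => i.
      have := coord_lattice_comb (fun j => (g j)%:Z) i.
      by rewrite -/(beta g) bgh coord_lattice_comb => /intr_inj [/val_inj].
    - have -> : alpha g - alpha h = beta g - beta h by rewrite /alpha; ring.
      apply/(nrm_le _ (ler0n _ _)) => i; rewrite valB (coordB qP) !coord_lattice_comb.
      rewrite -rmorphB -intr_norm [l%:R]pmulrn ler_int.
      have : (g i %/ l.+1 = h i %/ l.+1)%N by rewrite -!codeE gh.
      case: (g i) (h i) => [gi gk] [hi hk] /= ee.
      have := divn_eq gi l.+1; have := divn_eq hi l.+1; rewrite ee.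
      have := ltn_pmod gi (ltn0Sn l); have := ltn_pmod hi (ltn0Sn l).
      lia.
  have := @leq_card_in _ _ code _ inj; rewrite card_ffun !card_ord => cardle.
  apply: (@leq_trans ((k %/ l.+1).+1 ^ n * (C1 * l.+1 ^ n))%N); first exact: leq_mul.
  rewrite mulnCA -expnMn -mulnA leq_mul2l -expnMn leq_exp2r // mulSn addnC.
  apply/orP; right; rewrite [X in (_ <= X)%N]mulSn leq_add //; exact: leq_trunc_div.
exists (undup [seq f g | g <- enum {: {ffun 'I_n -> 'I_k.+1}}]); split.
- exact: undup_uniq.
- by move=> a; rewrite mem_undup => /mapP[g _ ->].
- move=> R; set S1 := undup _; set B := (C1 * _)%N.
  have cardE : (#|{: {ffun 'I_n -> 'I_k.+1}}| = \sum_(a <- S1) #|[pred g | f g == a]|)%N.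
    under eq_bigr do rewrite -sum1_card big_mkcond /=.
    rewrite exchange_big /= -sum1_card; apply: eq_bigr => g _.
    rewrite -big_mkcond /= sum1_count (eq_count (a2 := pred1 (f g))) => [|a] /=.
      by rewrite count_uniq_mem ?undup_uniq // mem_undup map_f ?mem_enum.
    by rewrite inE eq_sym.
  have kn0 : 0 < (k ^ n)%:R :> R by rewrite ltr0n expn_gt0.
  rewrite -(ler_pM2l kn0) mulr1 mulr_sumr.
  apply: (@le_trans _ _ (#|{: {ffun 'I_n -> 'I_k.+1}}|%:R)).
    by rewrite card_ffun !card_ord ler_nat leq_exp2r.
  rewrite cardE natr_sum big_seq [leRHS]big_seq; apply: ler_sum => a.
  rewrite mem_undup => /mapP[g _ aE].
  rewrite mulrA ler_pdivlMr; last by rewrite ltr0n aE (ideal_norm_gt0 dedO).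
  by rewrite -!natrM ler_nat mulnC [X in (_ <= X)%N]mulnC mulnC.
Qed.

End Counting.

(** * Prime divisors and multiplicities *)

Section PrimeDivisors.
Context {A : comNzRingType} (dedA : dedekind_finite A).
Context (finA : forall X, finite_set (@ideals_upto A X)).
Implicit Types (a b c p q : set A) (k : nat).

Lemma prime_divisorsE a : nonzero_ideals a ->
  prime_divisors a = nonzero_primes `&` [set p | a `<=` p].
Proof.
move=> na; apply/seteqP; split=> p.
  move=> [pp pa]; have ap := ideal_dvd_sub (let: And3 h _ _ := pp in h) pa.
  split=> //; split=> //; case: (pp) => ip _ _; exact: nonzero_sub na.1 ip ap na.2.
by move=> [pP ap]; split; [case: pP|exact/(ideal_dvdP dedA (nonzero_prime_ideal pP) na)].
Qed.

Lemma finite_prime_divisors a : nonzero_ideals a -> finite_set (prime_divisors a).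
Proof.
move=> na; apply: sub_finite_set (finA (ideal_norm a)).
rewrite prime_divisorsE // => p [pP ap]; have np := nonzero_prime_ideal pP.
by split=> //; apply: (norm_leq dedA na np.1).
Qed.

Lemma nonzero_ideal_exp p k : nonzero_ideals p -> nonzero_ideals (ideal_exp p k).
Proof.
move=> np; elim: k => [|k ih]; first exact: nonzero_idealT.
exact: (nonzero_ideal_mul dedA np ih).
Qed.

Lemma ideal_norm_exp p k : nonzero_ideals p ->
  ideal_norm (ideal_exp p k) = (ideal_norm p ^ k)%N.
Proof.
move=> np; elim: k => [|k ih]; first by rewrite /= ideal_normT.
rewrite -[ideal_exp _ _]/(ideal_mul p (ideal_exp p k)).
by rewrite (ideal_normM dedA np (nonzero_ideal_exp k np)) ih expnS.
Qed.

Lemma ideal_exp_sub p j k : is_ideal p -> (j <= k)%N -> ideal_exp p k `<=` ideal_exp p j.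
Proof.
move=> ip /subnK <-; elim: (k - j)%N => //= i; apply: subset_trans.
by apply: ideal_mul_subr; exact: ideal_exp_ideal.
Qed.

Lemma multiplicityP a p k : nonzero_ideals a -> nonzero_primes p ->
  a `<=` ideal_exp p k <-> (k <= ideal_multiplicity p a)%N.
Proof.
move=> na pP; have np := nonzero_prime_ideal pP.
pose Q k := `[< ideal_dvd (ideal_exp p k) a >].
have QE j : ideal_dvd (ideal_exp p j) a <-> a `<=` ideal_exp p j.
  by apply: ideal_dvdP => //; exact: nonzero_ideal_exp.
have exQ : exists k, Q k by exists 0%N; apply/asboolP/QE.
have bQ j : Q j -> (j <= ideal_norm a)%N.
  move=> /asboolP/QE aj; have nj := nonzero_ideal_exp j np.
  apply: leq_trans (norm_leq dedA na nj.1 aj); rewrite ideal_norm_exp //.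
  exact/ltnW/ltn_expl/(prime_norm_gt1 dedA).
case: (ex_maxnP exQ bQ) => m /asboolP Qm mmax.
have : [set k | ideal_dvd (ideal_exp p k) a /\
  forall j, ideal_dvd (ideal_exp p j) a -> (j <= k)%N] m.
  by split=> // j Qj; apply: mmax; exact/asboolP.
move=> h; have [/QE av vmax] := xgetPex 0%N (ex_intro _ m h).
split=> [/QE/vmax //|kv]; apply: (subset_trans av); exact: ideal_exp_sub np.1 kv.
Qed.

Lemma dvd_mul_prime p q c : nonzero_primes p -> nonzero_primes q ->
  nonzero_ideals c -> ideal_mul p c `<=` q -> q = p \/ c `<=` q.
Proof.
move=> pP qP nc /(prime_mul_sub qP.1)[|pq|]; [by case: pP => -[]| |by right].
by left; rewrite (prime_sub_eq dedA pP qP pq).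
Qed.

Lemma omega_mul_prime p c : nonzero_primes p -> nonzero_ideals c ->
  (omega_ideal (ideal_mul p c) <= (omega_ideal c).+1)%N.
Proof.
move=> pP nc; have npc := nonzero_ideal_mul dedA (nonzero_prime_ideal pP) nc.
rewrite /omega_ideal; set F := fset_set (prime_divisors c).
apply: (@leq_trans (size (p :: F))) => //; apply: uniq_leq_size; first exact: fset_uniq.
move=> q; rewrite in_fset_set; last exact: finite_prime_divisors.
rewrite prime_divisorsE // => /set_mem[qP pcq]; rewrite inE.
have [->|cq] := dvd_mul_prime pP qP nc pcq; first by rewrite eqxx.
apply/orP; right; rewrite in_fset_set; last exact: finite_prime_divisors.
by apply/mem_set; rewrite prime_divisorsE.
Qed.

Lemma Omega_idealE a : nonzero_ideals a -> Omega_ideal a =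
  (\sum_(p <- fset_set (prime_divisors a)) ideal_multiplicity p a)%N.
Proof. by move=> na; rewrite /Omega_ideal fsbig_finite //; exact: finite_prime_divisors. Qed.

(** The number of repetitions among the prime factors of [a]. *)
Definition excess a : nat :=
  \sum_(p <- fset_set (prime_divisors a)) (ideal_multiplicity p a).-1.

Lemma Omega_omega a : nonzero_ideals a ->
  Omega_ideal a = (omega_ideal a + excess a)%N.
Proof.
move=> na; have fin := finite_prime_divisors na.
rewrite Omega_idealE // /excess /omega_ideal -sum1_size -big_split /=.
rewrite big_seq [RHS]big_seq; apply: eq_bigr => p.
rewrite in_fset_set // prime_divisorsE // => /set_mem[pP ap].
rewrite add1n prednK //; apply/multiplicityP => //=.
by rewrite ideal_mulT //; case: pP => -[].
Qed.

End PrimeDivisors.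

(** * The zeta distribution on ideals *)

Local Open Scope ereal_scope.

Section EsumComplements.
Context {R : realType}.

Lemma esum_interchange (T U : choiceType) (I : set T) (J : set U) (f : T -> U -> \bar R) :
  (forall i j, I i -> J j -> 0 <= f i j) ->
  \esum_(i in I) \esum_(j in J) f i j = \esum_(j in J) \esum_(i in I) f i j.
Proof.
move=> f0; rewrite !esum_esum //; last by move=> j i ? ?; exact: f0.
apply: (reindex_esum _ _ (fun x => (x.2, x.1))); split=> [[j i] [] //||].
  by move=> [i j] [i' j'] _ _ [-> ->].
by move=> [i j] [/= Ii Jj]; exists (j, i).
Qed.

Lemma esum_le_sub (T : choiceType) (I J : set T) (f : T -> \bar R) :
  I `<=` J -> (forall i, J i -> 0 <= f i) ->
  \esum_(i in I) f i <= \esum_(i in J) f i.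
Proof.
move=> IJ f0; apply: ge_ereal_sup => _ [X [finX XI] <-].
by apply: ereal_sup_ubound; exists X => //; split=> //; exact: subset_trans IJ.
Qed.

Lemma fset_sum_le_esum (T : choiceType) (I : set T) (f : T -> \bar R) (l : seq T) :
  uniq l -> (forall i, i \in l -> I i) -> (forall i, I i -> 0 <= f i) ->
  \sum_(i <- l) f i <= \esum_(i in I) f i.
Proof.
move=> ul lI f0; apply: esum_ge; exists [set` l]; first by split=> //; exact: finite_seq.
by rewrite fsbig_seq.
Qed.

Lemma esum_le_fset (T : choiceType) (I : set T) (f : T -> \bar R) (b : \bar R) :
  (forall l : seq T, uniq l -> (forall i, i \in l -> I i) -> \sum_(i <- l) f i <= b) ->
  \esum_(i in I) f i <= b.
Proof.
move=> h; apply: ge_ereal_sup => _ [X [finX XI] <-].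
rewrite fsbig_finite //; apply: h; first exact: fset_uniq.
by move=> i; rewrite in_fset_set // => /set_mem/XI.
Qed.

Lemma esumZl (T : choiceType) (I : set T) (c : R) (f : T -> \bar R) :
  (0 <= c)%R -> (forall i, I i -> 0 <= f i) ->
  \esum_(i in I) (c%:E * f i) = c%:E * \esum_(i in I) f i.
Proof.
rewrite le_eqVlt => /predU1P[<-|c0] f0.
  by rewrite mul0e esum1 // => i _; rewrite mul0e.
have main (b : R) (h : T -> \bar R) : (0 < b)%R -> (forall i, I i -> 0 <= h i) ->
    \esum_(i in I) (b%:E * h i) <= b%:E * \esum_(i in I) h i.
  move=> b0 h0; apply: esum_le_fset => l ul lI.
  rewrite big_seq -ge0_sume_distrr => [|i /lI/h0 //].
  by rewrite -big_seq lee_pmul2l // fset_sum_le_esum.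
apply/eqP; rewrite eq_le main //=.
have : \esum_(i in I) (c^-1%:E * (c%:E * f i)) <= c^-1%:E * \esum_(i in I) (c%:E * f i).
  by apply: main; rewrite ?invr_gt0 // => i /f0 fi; rewrite mule_ge0 // lee_fin ltW.
under eq_esum do rewrite muleA -EFinM mulVf ?gt_eqF // mul1e.
by rewrite -(@lee_pmul2l _ c%:E) // muleA -EFinM divff ?gt_eqF // mul1e.
Qed.

Lemma sum_subseq_le (T : choiceType) (f : T -> \bar R) (l l' : seq T) :
  uniq l -> uniq l' -> {subset l <= l'} -> (forall i, i \in l' -> 0 <= f i) ->
  \sum_(i <- l) f i <= \sum_(i <- l') f i.
Proof.
move=> ul ul' ll f0.
rewrite (fsbig_seq _ _ ul') -esum_fset; [|exact: finite_seq|by move=> i /set_mem/f0].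
exact: fset_sum_le_esum.
Qed.

End EsumComplements.

(** The positive non-increasing completely multiplicative functions for which
    [\sum_n g n] converges; by multiplicativity this is the convergence of the
    geometric series of ratio [2 * g 2]. *)
Definition zeta_weight (R : realType) (g : nat -> R) : Prop :=
  [/\ g 1%N = 1%R, forall m n, (0 < m)%N -> (0 < n)%N -> g (m * n)%N = (g m * g n)%R,
      forall n, (0 < n)%N -> (0 < g n)%R,
      forall m n, (0 < m)%N -> (m <= n)%N -> (g n <= g m)%R & (2 * g 2%N < 1)%R].

Section Zeta.
Context {A : comNzRingType} (dedA : dedekind_finite A) {R : realType}.
Context (finA : forall X, finite_set (@ideals_upto A X)).
Context (B : nat) (boundA : forall X, (#|` fset_set (@ideals_upto A X)| <= B * X)%N).
Implicit Types (a b c p q : set A).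
Local Notation G := (@nonzero_ideals A).
Local Notation P := (@nonzero_primes A).
Local Notation upto X := (fset_set (@ideals_upto A X)).

Lemma upto_norm a X : a \in upto X -> G a /\ (ideal_norm a <= X)%N.
Proof. by rewrite in_fset_set // => /set_mem. Qed.

Lemma mem_upto a X : G a -> (ideal_norm a <= X)%N -> a \in upto X.
Proof. by move=> Ga aX; rewrite in_fset_set //; exact: mem_set. Qed.

Lemma sum_upto_filter (V : nmodType) X Y (E : pred (set A)) (f : set A -> V) :
  (X <= Y)%N ->
  (\sum_(a <- upto Y | E a && (ideal_norm a <= X)%N) f a = \sum_(a <- upto X | E a) f a)%R.
Proof.
move=> XY; rewrite -[LHS]big_filter -[RHS]big_filter; apply/perm_big/uniq_perm.
- exact/filter_uniq/fset_uniq.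
- exact/filter_uniq/fset_uniq.
move=> a; rewrite !mem_filter; case: (E a) => //=; apply/andP/idP => [[aX /upto_norm[Ga _]]|].
  exact: mem_upto.
by move=> /upto_norm[Ga aX]; split=> //; apply: mem_upto => //; exact: leq_trans XY.
Qed.

Lemma upto_exhaust (l : seq (set A)) : (forall a, a \in l -> G a) ->
  exists X, {subset l <= upto X}.
Proof.
move=> lG; exists (\max_(a <- l) ideal_norm a)%N => a al.
by apply: mem_upto; [exact: lG|exact: leq_bigmax_seq].
Qed.

Section Weight.
Context (g : nat -> R) (gP : zeta_weight g).

Definition weight a : R := g (ideal_norm a).

Let gM m n : (0 < m)%N -> (0 < n)%N -> g (m * n)%N = (g m * g n)%R.
Proof. by case: gP => _ h _ _ _; exact: h. Qed.

Lemma weight_gt0 a : G a -> (0 < weight a)%R.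
Proof. by move=> Ga; case: gP => _ _ h _ _; apply: h; exact: (ideal_norm_gt0 dedA). Qed.

Let wr0 a : G a -> (0 <= weight a)%R.
Proof. by move=> Ga; exact/ltW/weight_gt0. Qed.

Let w0 a : G a -> 0 <= (weight a)%:E.
Proof. by move=> Ga; rewrite lee_fin wr0. Qed.

Lemma weightM a b : G a -> G b -> weight (ideal_mul a b) = (weight a * weight b)%R.
Proof.
by move=> Ga Gb; rewrite /weight (ideal_normM dedA) // gM // (ideal_norm_gt0 dedA).
Qed.

Lemma weight_exp p k : G p -> weight (ideal_exp p k) = (weight p ^+ k)%R.
Proof.
move=> Gp; elim: k => [|k ih]; first by rewrite /weight /= ideal_normT; case: gP.
rewrite -[ideal_exp _ _]/(ideal_mul p (ideal_exp p k)) weightM ?ih ?exprS //.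
exact: (nonzero_ideal_exp dedA).
Qed.

Lemma prime_weight_le p : P p -> (weight p <= 2^-1)%R.
Proof.
move=> Pp; case: gP => _ _ _ gmono g2.
have := gmono 2%N _ isT (prime_norm_gt1 dedA Pp); rewrite -/(weight p).
by move=> h; apply: (le_trans h); lra.
Qed.

Definition zeta : \bar R := \esum_(a in G) (weight a)%:E.

(** Summation by parts over the norm. *)
Lemma sum_weight_parts X (E : pred (set A)) :
  (\sum_(a <- upto X | E a) weight a =
   g X.+1 * (\sum_(a <- upto X | E a) 1) +
   \sum_(1 <= i < X.+1) (g i - g i.+1) * (\sum_(a <- upto i | E a) 1))%R.
Proof.
transitivity (\sum_(a <- upto X | E a) (g X.+1 +
    \sum_(1 <= i < X.+1 | (ideal_norm a <= i)%N) (g i - g i.+1)))%R.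
  rewrite big_seq_cond [RHS]big_seq_cond; apply: eq_bigr => a /andP[/upto_norm[Ga aX] _].
  have N0 := ideal_norm_gt0 dedA Ga.
  rewrite -(big_nat_widenl _ _ _ xpredT (fun i => g i - g i.+1)%R N0).
  rewrite (@telescope_sumr_eq _ _ _ (fun i => - g i)%R) => [||k _]; [|exact: leqW|by rewrite opprK addrC].
  by rewrite /weight opprK addNKr.
rewrite big_split /= mulr_sumr; congr (_ + _)%R; first by under [RHS]eq_bigr do rewrite mulr1.
rewrite (exchange_big_dep xpredT) //= big_nat_cond [RHS]big_nat_cond.
apply: eq_bigr => i /andP[/andP[_ iX] _]; rewrite mulr_sumr sum_upto_filter //.
by apply: eq_bigr => a _; rewrite mulr1.
Qed.

Lemma sum_upto1 X : (\sum_(a <- upto X) 1 = (#|` upto X|)%:R :> R)%R.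
Proof. by rewrite -sum1_size natr_sum. Qed.

(** Cut the ideals according to the powers of two between which their norm lies:
    [O(2^j)] ideals of weight at most [g 2 ^ j] each. *)
Lemma zeta_fin : zeta \is a fin_num.
Proof.
have [r0 r1] : (0 <= 2 * g 2%N)%R /\ (2 * g 2%N < 1)%R.
  by case: gP => _ _ g0 _ ->; rewrite mulr_ge0 // ltW // g0.
set r := (2 * g 2%N)%R in r0 r1.
have g2X j : g (2 ^ j)%N = (g 2%N ^+ j)%R.
  by elim: j => [|j ih]; [case: gP|rewrite expnS gM ?expn_gt0 // ih exprS].
have bound X : (\sum_(a <- upto X) 1 <= B%:R * X%:R :> R)%R.
  by rewrite sum_upto1 -natrM ler_nat.
have dyadic J : (\sum_(a <- upto (2 ^ J)) weight a <=
    2 * B%:R * (1 + \sum_(j < J) r ^+ j))%R.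
  elim: J => [|J ih].
    rewrite big_ord0 addr0 mulr1 expn0.
    apply: (@le_trans _ _ (\sum_(a <- upto 1) 1)%R).
      rewrite big_seq [leRHS]big_seq; apply: ler_sum => a /upto_norm[Ga _].
      case: gP => g1 _ _ gmono _; rewrite -g1; apply: gmono => //.
      exact: (ideal_norm_gt0 dedA).
    by apply: (le_trans (bound 1%N)); rewrite mulr1 ler_peMl // ler1n.
  rewrite (bigID (fun a => (ideal_norm a <= 2 ^ J)%N)) /=.
  rewrite (sum_upto_filter xpredT) ?leq_exp2l //.
  rewrite big_ord_recr /= addrA mulrDr lerD //.
  apply: (@le_trans _ _ (\sum_(a <- upto (2 ^ J.+1)) g (2 ^ J)%N)%R).
    rewrite big_mkcond /= big_seq [leRHS]big_seq; apply: ler_sum => a /upto_norm[Ga _].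
    case: gP => _ _ g0 gmono _; case: leqP => aJ; first by apply/ltW/g0; rewrite expn_gt0.
    by apply: gmono; rewrite ?expn_gt0 // ltnW.
  have -> : (2 * B%:R * r ^+ J = g (2 ^ J)%N * (B%:R * (2 ^ J.+1)%:R))%R.
    by rewrite g2X /r exprMn natrX exprS; ring.
  under eq_bigr do rewrite -[g _]mulr1.
  rewrite -mulr_sumr ler_wpM2l ?bound // ltW //.
  by case: gP => _ _ g0 _ _; apply: g0; rewrite expn_gt0.
have geom J : (\sum_(j < J) r ^+ j <= (1 - r)^-1)%R.
  rewrite -[leRHS]mul1r ler_pdivlMr ?subr_gt0 // -opprB mulrN mulrC -subrX1 opprB.
  by rewrite lerBlDr lerDl exprn_ge0.
rewrite ge0_fin_numE; last exact: esum_ge0.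
apply: (@le_lt_trans _ _ (2 * B%:R * (1 + (1 - r)^-1))%R%:E); last exact: ltry.
apply: esum_le_fset => l ul lG; have [X lX] := upto_exhaust lG.
apply: (@le_trans _ _ (\sum_(a <- upto (2 ^ X)) (weight a)%:E)).
  apply: sum_subseq_le => //.
    move=> a /lX/upto_norm[Ga aX]; apply: mem_upto => //.
    by rewrite (leq_trans aX) // ltnW // ltn_expl.
  by move=> a /upto_norm[Ga _]; exact: w0.
rewrite sumEFin lee_fin (le_trans (dyadic X)) // ler_wpM2l ?mulr_ge0 //.
by rewrite lerD2l geom.
Qed.

(** The zeta distribution is a mixture of the uniform distributions on the
    ideals of bounded norm: a set that is dense in all of the latter has large
    zeta measure. *)
Lemma zeta_mixture (k : R) (E : set (set A)) : (0 < k)%R ->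
  (forall X, (0 < X)%N -> k * (#|` upto X|)%:R <=
     \sum_(a <- upto X | `[< E a >]) 1 :> R)%R ->
  k%:E * zeta <= \esum_(a in G `&` E) (weight a)%:E.
Proof.
move=> k0 kE.
suff : zeta <= k^-1%:E * \esum_(a in G `&` E) (weight a)%:E.
  by move=> h; rewrite -(@lee_pmul2l _ k^-1%:E) ?lte_fin ?invr_gt0 // muleA -EFinM
    mulVf ?gt_eqF // mul1e.
apply: esum_le_fset => l ul lG; have [X lX] := upto_exhaust lG.
have GE0 a : (G `&` E) a -> 0 <= (weight a)%:E by case=> Ga _; exact: w0.
apply: (@le_trans _ _ (\sum_(a <- upto X) (weight a)%:E)).
  apply: sum_subseq_le => //.
  by move=> a /upto_norm[Ga _]; exact: w0.
apply: (@le_trans _ _ (k^-1%:E * (\sum_(a <- upto X | `[< E a >]) weight a)%:E)); last first.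
  rewrite lee_pmul2l ?lte_fin ?invr_gt0 // -sumEFin -big_filter.
  apply: fset_sum_le_esum => //; first exact/filter_uniq/fset_uniq.
  by move=> a; rewrite mem_filter => /andP[/asboolP Ea /upto_norm[]].
rewrite sumEFin -EFinM lee_fin -(ler_pM2l k0) mulrA divff ?gt_eqF // mul1r.
rewrite (sum_weight_parts X xpredT) (sum_weight_parts X (fun a => `[< E a >])).
case: gP => _ _ g0 gmono _.
have kE' i : (k * \sum_(a <- upto i) 1 <= \sum_(a <- upto i | `[< E a >]) 1 :> R)%R.
  case: i => [|i]; last by rewrite sum_upto1 kE.
  have -> : upto 0%N = fset0.
    by apply/eqP; rewrite -cardfs_eq0 -leqn0; have := boundA 0%N; rewrite muln0.
  by rewrite big_seq_fset0 mulr0; exact: sumr_ge0.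
rewrite mulrDr; apply: lerD.
  by rewrite mulrCA; apply: ler_wpM2l; [exact/ltW/g0|exact: kE'].
rewrite mulr_sumr big_nat_cond [leRHS]big_nat_cond; apply: ler_sum => i /andP[/andP[i0 _] _].
rewrite mulrCA; apply: ler_wpM2l; last exact: kE'.
by rewrite subr_ge0; apply: gmono.
Qed.

Lemma zeta_ge1 : 1 <= zeta.
Proof.
apply: esum_ge; exists [set [set: A]].
  by split=> [|_ ->]; [exact: finite_set1|exact: nonzero_idealT].
by rewrite fsbig_set1 /weight ideal_normT; case: gP => ->.
Qed.

Lemma zeta_fineE : zeta = (fine zeta)%:E. Proof. by rewrite fineK // zeta_fin. Qed.

Lemma zeta_fine_gt0 : (0 < fine zeta)%R.
Proof. by rewrite -lte_fin -zeta_fineE (lt_le_trans _ zeta_ge1) // lte_fin. Qed.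

Lemma zeta_fine_ge0 : (0 <= fine zeta)%R.
Proof. exact/ltW/zeta_fine_gt0. Qed.

Definition dvd_ind b a : R := (`[< a `<=` b >])%:R.

(** Multiplication by [b] maps the ideals onto the multiples of [b]: under the
    zeta distribution, being a multiple of [b] has probability [weight b]. *)
Lemma esum_multiples b (f : set A -> R) : G b -> (forall a, G a -> (0 <= f a)%R) ->
  \esum_(a in G) (weight a * dvd_ind b a * f a)%:E =
  (weight b)%:E * \esum_(c in G) (weight c * f (ideal_mul b c))%:E.
Proof.
move=> Gb f0.
rewrite -esumZl ?wr0 // => [|c Gc]; last first.
  have := nonzero_ideal_mul dedA Gb Gc; rewrite lee_fin => Gbc.
  by rewrite mulr_ge0 ?f0 // wr0.
transitivity (\esum_(a in G `&` [set a | a `<=` b]) (weight a * f a)%:E).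
  rewrite [RHS]esum_mkcondr; apply: eq_esum => a Ga; rewrite /dvd_ind.
  case: asboolP => [ab|nab]; first by rewrite mem_set // mulr1.
  by rewrite memNset // mulr0 mul0r.
rewrite (reindex_esum G _ (ideal_mul b)).
  by apply: eq_esum => c Gc; rewrite weightM // -EFinM mulrA.
split.
- by move=> c Gc; split; [exact: (nonzero_ideal_mul dedA)|apply: ideal_mul_subl; case: Gb].
- move=> c c' /set_mem[ic _] /set_mem[ic' _] e; exact: (ideal_mul_inj dedA Gb).
- move=> a [Ga ab]; have [c Gc aE] := sub_ideal_dvd dedA Gb Ga ab; by exists c.
Qed.

Lemma esum_dvd b : G b ->
  \esum_(a in G) (weight a * dvd_ind b a)%:E = (weight b)%:E * zeta.
Proof.
move=> Gb; transitivity (\esum_(a in G) (weight a * dvd_ind b a * 1)%:E).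
  by apply: eq_esum => a _; rewrite mulr1.
rewrite (esum_multiples (f := fun=> 1%R)) //; congr (_ * _).
by apply: eq_esum => c _; rewrite mulr1.
Qed.

Definition mean : \bar R := \esum_(p in P) (weight p)%:E.

Let P_G : P `<=` G. Proof. by move=> p; exact: nonzero_prime_ideal. Qed.

Lemma mean_fin : mean \is a fin_num.
Proof.
rewrite ge0_fin_numE; last by apply: esum_ge0 => p /P_G; exact: w0.
apply: le_lt_trans (_ : zeta < +oo); last by rewrite -ge0_fin_numE ?zeta_fin // esum_ge0.
exact: esum_le_sub.
Qed.

Lemma mean_fineE : mean = (fine mean)%:E. Proof. by rewrite fineK // mean_fin. Qed.

Lemma mean_ge0 : (0 <= fine mean)%R.
Proof. by apply: fine_ge0; apply: esum_ge0 => p /P_G; exact: w0. Qed.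

Lemma dvd_ind_ge0 b a : (0 <= dvd_ind b a)%R. Proof. exact: ler0n. Qed.

Lemma omega_esum a : G a -> (omega_ideal a)%:R%:E = \esum_(p in P) (dvd_ind p a)%:E.
Proof.
move=> Ga; have fin := finite_prime_divisors dedA finA Ga.
transitivity (\esum_(p in P `&` [set p | a `<=` p]) (1%:E : \bar R)); last first.
  rewrite [LHS]esum_mkcondr; apply: eq_esum => p Pp; rewrite /dvd_ind.
  by case: asboolP => ap; [rewrite mem_set|rewrite memNset].
rewrite -prime_divisorsE // esum_fset // fsbig_finite //= /omega_ideal.
by rewrite sumEFin -sum1_size natr_sum.
Qed.

Lemma first_moment :
  \esum_(a in G) (weight a * (omega_ideal a)%:R)%:E = mean * zeta.
Proof.
transitivity (\esum_(a in G) \esum_(p in P) (weight a * dvd_ind p a)%:E).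
  apply: eq_esum => a Ga; rewrite EFinM omega_esum // -esumZl ?wr0 //.
  by move=> p _; rewrite lee_fin dvd_ind_ge0.
rewrite esum_interchange => [|a p Ga _]; last first.
  by rewrite lee_fin mulr_ge0 ?dvd_ind_ge0 // wr0.
transitivity (\esum_(p in P) (fine zeta)%:E * (weight p)%:E).
  by apply: eq_esum => p /P_G Gp; rewrite esum_dvd // -zeta_fineE muleC.
rewrite esumZl ?zeta_fine_ge0 // => [|p /P_G]; last exact: w0.
by rewrite -zeta_fineE muleC.
Qed.

(** Sum over the primes [p] and substitute [a = p c]: the multiples of [p] have
    at most one prime divisor more than their cofactors. *)
Lemma second_moment :
  \esum_(a in G) (weight a * (omega_ideal a)%:R ^+ 2)%:E <= mean * (mean * zeta + zeta).
Proof.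
have om0 a : (0 <= (omega_ideal a)%:R :> R)%R by [].
have -> : \esum_(a in G) (weight a * (omega_ideal a)%:R ^+ 2)%:E =
    \esum_(a in G) \esum_(p in P) (weight a * dvd_ind p a * (omega_ideal a)%:R)%:E.
  apply: eq_esum => a Ga.
  transitivity ((weight a * (omega_ideal a)%:R)%:E * (omega_ideal a)%:R%:E).
    by rewrite -EFinM expr2 mulrA.
  rewrite omega_esum // -esumZl ?mulr_ge0 // ?wr0 // => [|p _].
    by apply: eq_esum => p _; rewrite -EFinM mulrAC.
  by rewrite lee_fin dvd_ind_ge0.
rewrite esum_interchange => [|a p Ga _]; last first.
  by rewrite lee_fin !mulr_ge0 ?dvd_ind_ge0 // wr0.
have mz : mean * zeta + zeta = (fine mean * fine zeta + fine zeta)%:E.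
  by rewrite EFinD EFinM -mean_fineE -zeta_fineE.
apply: (@le_trans _ _ (\esum_(p in P) (fine mean * fine zeta + fine zeta)%:E * (weight p)%:E)).
  apply: le_esum => p Pp; have Gp := P_G Pp.
  rewrite esum_multiples // muleC -mz lee_wpmul2r ?w0 //.
  rewrite -first_moment -esumD // => [|a Ga]; last first.
    by rewrite lee_fin mulr_ge0 // wr0.
  apply: le_esum => a Ga; rewrite -EFinD lee_fin.
  rewrite -[X in (_ + X)%R]mulr1 -mulrDr ler_wpM2l ?wr0 //.
  by rewrite natr1 ler_nat (omega_mul_prime dedA finA).
rewrite esumZl => [|| p /P_G]; last exact: w0.
  by rewrite muleC -mz.
by rewrite addr_ge0 // ?mulr_ge0 ?mean_ge0 // zeta_fine_ge0.
Qed.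

(** Chebyshev's inequality, the variance being at most the mean.  The sums are
    extended reals, so the square is expanded as
    [(omega - m)^2 + 2 m omega = omega^2 + m^2], without subtraction. *)
Lemma omega_chebyshev (t : R) : (0 < t)%R ->
  ((t ^+ 2)%:E * (\esum_(a in G `&` [set a | (t <= `|(omega_ideal a)%:R - fine mean|)%R])
    (weight a)%:E) <= (fine mean * fine zeta)%:E)%E.
Proof.
move=> t0; set m := fine mean; set z := fine zeta.
have wa a : G a -> (0 <= weight a)%R by move=> Ga; exact/ltW/weight_gt0.
have m0 : (0 <= m)%R by exact: mean_ge0.
have v0 a : G a -> 0 <= (weight a * ((omega_ideal a)%:R - m) ^+ 2)%:E.
  by move=> Ga; rewrite lee_fin; apply: mulr_ge0; [exact: wa|exact: sqr_ge0].
pose V := \esum_(a in G) (weight a * ((omega_ideal a)%:R - m) ^+ 2)%:E.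
have VE : V + (2 * m * (m * z))%:E =
    \esum_(a in G) (weight a * (omega_ideal a)%:R ^+ 2)%:E + (m ^+ 2 * z)%:E.
  have -> : (2 * m * (m * z))%:E =
      \esum_(a in G) ((2 * m)%:E * (weight a * (omega_ideal a)%:R)%:E).
    rewrite esumZl ?mulr_ge0 // => [|a Ga]; last by rewrite lee_fin mulr_ge0 ?wa.
    by rewrite first_moment mean_fineE zeta_fineE.
  have -> : (m ^+ 2 * z)%:E = \esum_(a in G) ((m ^+ 2)%:E * (weight a)%:E).
    by rewrite esumZl ?sqr_ge0 //  -/zeta zeta_fineE.
  rewrite -!esumD; try exact: v0.
  2-4: by move=> a Ga; rewrite -?EFinM lee_fin ?mulr_ge0 ?sqr_ge0 ?wa.
  by apply: eq_esum => a Ga; rewrite -!EFinM -!EFinD; congr (_%:E); ring.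
have Vle : V <= (m * z)%:E.
  have : V + (2 * m * (m * z))%:E <= (m * z)%:E + (2 * m * (m * z))%:E.
    rewrite VE; apply: (le_trans (leeD second_moment (lexx _))).
    rewrite mean_fineE zeta_fineE -/m -/z -!(EFinM, EFinD) lee_fin le_eqVlt; apply/orP; left.
    by apply/eqP; ring.
  by rewrite leeD2rE.
apply: le_trans Vle; rewrite -esumZl ?sqr_ge0 // => [|a [Ga _]]; last exact: w0.
apply: (@le_trans _ _ (\esum_(a in G `&` [set a | (t <= `|(omega_ideal a)%:R - m|)%R])
    (weight a * ((omega_ideal a)%:R - m) ^+ 2)%:E)).
  apply: le_esum => a [Ga /= ta]; rewrite -EFinM lee_fin mulrC ler_wpM2l ?wa //.
  by rewrite -[leRHS]real_normK ?num_real // lerXn2r // nnegrE // ltW.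
by apply: esum_le_sub => [a []//|a Ga]; exact: v0.
Qed.

Lemma excess_le_esum a : G a -> (excess a)%:R%:E <=
  \esum_(p in P) \esum_(k in [set: nat]) (dvd_ind (ideal_exp p k.+2) a)%:E.
Proof.
move=> Ga; have fin := finite_prime_divisors dedA finA Ga.
rewrite /excess natr_sum -sumEFin.
apply: (@le_trans _ _ (\sum_(p <- fset_set (prime_divisors a))
    \esum_(k in [set: nat]) (dvd_ind (ideal_exp p k.+2) a)%:E)).
  rewrite big_seq [leRHS]big_seq; apply: lee_sum => p.
  rewrite in_fset_set // prime_divisorsE // => /set_mem[Pp ap].
  set v := ideal_multiplicity p a.
  apply: (@le_trans _ _ (\sum_(k <- iota 0 v.-1) (dvd_ind (ideal_exp p k.+2) a)%:E)).
    rewrite -[X in (X%:R)](size_iota 0) -sum1_size natr_sum -sumEFin.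
    rewrite big_seq [leRHS]big_seq; apply: lee_sum => k; rewrite mem_iota => /= kv.
    rewrite lee_fin /dvd_ind asboolT //; apply/(multiplicityP dedA k.+2 Ga Pp).
    by rewrite -/v; lia.
  apply: fset_sum_le_esum => //; first exact: iota_uniq.
  by move=> k _; rewrite lee_fin dvd_ind_ge0.
apply: fset_sum_le_esum => // [p|p _].
  by rewrite in_fset_set // prime_divisorsE // => /set_mem[].
by apply: esum_ge0 => k _; rewrite lee_fin dvd_ind_ge0.
Qed.

Lemma esum_geometric (x : R) : (0 <= x <= 2^-1)%R ->
  \esum_(k in [set: nat]) (x ^+ k.+2)%:E <= (2 * x ^+ 2)%:E.
Proof.
move=> /andP[x0 x1]; apply: esum_le_fset => l ul _.
pose n := (\max_(k <- l) k).+1.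
apply: (@le_trans _ _ (\sum_(k <- iota 0 n) (x ^+ k.+2)%:E)).
  apply: sum_subseq_le => //; first exact: iota_uniq.
    by move=> k kl; rewrite mem_iota /= add0n ltnS (@leq_bigmax_seq _ l xpredT id).
  by move=> k _; rewrite lee_fin exprn_ge0.
rewrite sumEFin lee_fin -[iota 0 n]/(index_iota 0 n) big_mkord.
have : (\sum_(k < n) x ^+ k.+2 <= x ^+ 2 * (2 - 2 * x ^+ n) :> R)%R; last first.
  move=> h; apply: (le_trans h); rewrite mulrC ler_wpM2r ?sqr_ge0 //.
  by rewrite lerBlDr lerDl mulr_ge0 ?exprn_ge0.
elim: (n) => [|j ih]; first by rewrite big_ord0 expr0 mulr1 subrr mulr0.
rewrite big_ord_recr /=; apply: (le_trans (lerD ih (lexx _))).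
have xj : (0 <= x ^+ 2 * x ^+ j)%R by rewrite mulr_ge0 ?exprn_ge0.
have -> : (x ^+ j.+2 = x ^+ 2 * x ^+ j)%R by rewrite -exprD.
rewrite [(x ^+ j.+1)%R]exprS.
have : (x ^+ 2 * x ^+ j * x <= x ^+ 2 * x ^+ j * 2^-1)%R by rewrite ler_wpM2l.
lra.
Qed.

(** The prime [p] is repeated when [a] is a multiple of [p^k] with [2 <= k],
    which gives a geometric series comparable to its first term [weight p ^ 2]. *)
Lemma excess_moment :
  \esum_(a in G) (weight a * (excess a)%:R)%:E <=
  (2 * fine zeta)%:E * \esum_(p in P) (weight p ^+ 2)%:E.
Proof.
apply: (@le_trans _ _ (\esum_(a in G) \esum_(p in P) \esum_(k in [set: nat])
    (weight a * dvd_ind (ideal_exp p k.+2) a)%:E)).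
  apply: le_esum => a Ga; rewrite EFinM.
  apply: (le_trans (lee_wpmul2l (w0 Ga) (excess_le_esum Ga))).
  rewrite -esumZl ?wr0 // => [|p _]; last first.
    by apply: esum_ge0 => k _; rewrite lee_fin dvd_ind_ge0.
  apply: le_esum => p _; rewrite -esumZl ?wr0 // => k _.
  by rewrite lee_fin dvd_ind_ge0.
have wd0 a b : G a -> 0 <= (weight a * dvd_ind b a)%:E.
  by move=> Ga; rewrite lee_fin mulr_ge0 ?dvd_ind_ge0 // wr0.
rewrite esum_interchange => [|a p Ga _]; last by apply: esum_ge0 => k _; exact: wd0.
rewrite -esumZl ?mulr_ge0 ?zeta_fine_ge0 // => [|p _]; last first.
  by rewrite lee_fin sqr_ge0.
apply: le_esum => p Pp; have Gp := P_G Pp.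
rewrite esum_interchange => [|a k Ga _]; last exact: wd0.
apply: (@le_trans _ _ (\esum_(k in [set: nat]) (fine zeta)%:E * (weight p ^+ k.+2)%:E)).
  apply: le_esum => k _; rewrite esum_dvd ?weight_exp //; last exact: (nonzero_ideal_exp dedA).
  by rewrite muleC -zeta_fineE.
rewrite esumZl ?zeta_fine_ge0 // => [|k _]; last first.
  by rewrite lee_fin exprn_ge0 // wr0.
have wp : (0 <= weight p <= 2^-1)%R by rewrite prime_weight_le // wr0.
apply: (le_trans (lee_wpmul2l _ (esum_geometric wp))).
  by rewrite lee_fin zeta_fine_ge0.
by rewrite -!EFinM lee_fin mulrCA mulrA.
Qed.

(** ** The Euler product *)

Let supported (l : seq (set A)) a : R :=
  (`[< forall q, P q -> a `<=` q -> q \in l >])%:R.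

Let partial_zeta l := \esum_(a in G) (weight a * supported l a)%:E.

Let partial_zeta_fin l : partial_zeta l \is a fin_num.
Proof.
have ws0 a : G a -> 0 <= (weight a * supported l a)%:E.
  by move=> Ga; rewrite lee_fin mulr_ge0 // wr0.
rewrite ge0_fin_numE; last exact: esum_ge0.
apply: le_lt_trans (_ : zeta < +oo); last by rewrite -ge0_fin_numE ?zeta_fin // esum_ge0.
apply: le_esum => a Ga; rewrite lee_fin -[leRHS]mulr1 ler_wpM2l ?wr0 //.
by rewrite /supported lern1 leq_b1.
Qed.

(** An ideal supported on [p :: l] is supported on [l] or is [p] times an ideal
    supported on [p :: l]. *)
Let partial_zeta_cons p l : P p ->
  partial_zeta (p :: l) <= partial_zeta l + (weight p)%:E * partial_zeta (p :: l).
Proof.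
move=> Pp; have Gp := P_G Pp.
have wa a : G a -> (0 <= weight a)%R by move=> Ga; exact/ltW/weight_gt0.
have s0 a m : G a -> (0 <= weight a * supported m a)%R by move=> Ga; rewrite mulr_ge0 ?wa.
apply: (@le_trans _ _ (partial_zeta l +
    \esum_(a in G) (weight a * dvd_ind p a * supported (p :: l) a)%:E)).
  rewrite -esumD => [||a Ga]; [|by move=> a Ga; rewrite lee_fin s0|by rewrite lee_fin !mulr_ge0 ?wa ?dvd_ind_ge0].
  apply: le_esum => a Ga; rewrite -EFinD lee_fin -mulrA -mulrDr ler_wpM2l ?wa //.
  rewrite /dvd_ind; case: asboolP => [ap|nap]; first by rewrite mul1r lerDr.
  rewrite mul0r addr0 ler_nat; case: asboolP => // h; rewrite asboolT // => q Pq aq.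
  by move: (h q Pq aq); rewrite inE => /predU1P[qp|//]; exfalso; apply: nap; rewrite -qp.
rewrite leeD2l // esum_multiples // lee_wpmul2l ?w0 //.
apply: le_esum => c Gc; rewrite lee_fin ler_wpM2l ?wa // ler_nat.
case: asboolP => // h; rewrite asboolT // => q Pq cq; apply: h => //.
by apply: subset_trans cq; apply: ideal_mul_subr; case: Gc.
Qed.

Let partial_zeta_le l : uniq l -> (forall p, p \in l -> P p) ->
  partial_zeta l <= (expR (2 * \sum_(p <- l) weight p))%:E.
Proof.
elim: l => [|p l ih] /=.
  move=> _ _; rewrite big_nil mulr0 expR0.
  apply: (@le_trans _ _ (\esum_(a in [set [set: A]]) (weight a)%:E)); last first.
    by rewrite esum_set1 ?lee_fin /weight ideal_normT; case: gP => ->.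
  rewrite [leRHS]esum_mkcond [leLHS]esum_mkcond; apply: le_esum => a _.
  case: ifPn => [/set_mem Ga|_]; last by case: ifPn => // /set_mem ->; exact/w0/nonzero_idealT.
  rewrite /supported; case: asboolP => [h|_]; last first.
    by rewrite mulr0; case: ifPn => // _; exact: w0.
  rewrite mulr1 mem_set //=; apply: (ideal_eqT Ga.1); apply: contrapT => a1.
  by have [q Pq aq] := prime_above dedA Ga a1; have := h q Pq aq.
move=> /andP[pl ul] lP; have Pp : P p by apply: lP; exact: mem_head.
have {ih} := ih ul (fun q ql => lP q (mem_behead (s := p :: l) ql)).
have := partial_zeta_cons l Pp.
rewrite -(fineK (partial_zeta_fin l)) -(fineK (partial_zeta_fin (p :: l))).
set z := fine (partial_zeta l); set z' := fine (partial_zeta (p :: l)); rewrite -EFinM -EFinD !lee_fin => h1 h2.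
rewrite big_cons mulrDr expRD.
have x0 : (0 <= weight p)%R by exact/ltW/weight_gt0/P_G.
have x1 := prime_weight_le Pp.
have e1 : (1 + 2 * weight p <= expR (2 * weight p))%R by exact: expR_ge1Dx.
have [z0 z'0] : (0 <= z)%R /\ (0 <= z')%R.
  by split; apply: fine_ge0; apply: esum_ge0 => a Ga; rewrite lee_fin mulr_ge0 // wr0.
have : (z' <= (1 + 2 * weight p) * z)%R.
  have : (0 <= (1 + 2 * weight p) * (z + weight p * z' - z'))%R.
    by rewrite mulr_ge0 ?subr_ge0 //; lra.
  have : (0 <= z' * weight p * (1 - 2 * weight p))%R by rewrite !mulr_ge0 //; lra.
  lra.
move=> h; apply: (le_trans h); apply: ler_pM => //; lra.
Qed.

(** Each Euler factor is at most [1 + 2 weight p], because [weight p <= 1 / 2]. *)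
Lemma zeta_le_expR : zeta <= (expR (2 * fine mean))%:E.
Proof.
apply: esum_le_fset => l ul lG.
pose ps := undup (flatten [seq enum_fset (fset_set (prime_divisors a)) | a <- l]).
have psE p : p \in ps -> P p.
  rewrite mem_undup => /flattenP[_ /mapP[a al ->]].
  rewrite in_fset_set; last exact: (finite_prime_divisors dedA finA (lG _ al)).
  by move=> /set_mem; rewrite (prime_divisorsE dedA (lG _ al)) => -[].
apply: (@le_trans _ _ (partial_zeta ps)).
  apply: (@le_trans _ _ (\sum_(a <- l) (weight a * supported ps a)%:E)); last first.
    apply: fset_sum_le_esum => // a Ga.
    by rewrite lee_fin mulr_ge0 // wr0.
  rewrite big_seq [leRHS]big_seq; apply: lee_sum => a al; have Ga := lG _ al.
  rewrite lee_fin /supported asboolT ?mulr1 // => q Pq aq.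
  rewrite mem_undup; apply/flattenP; exists (enum_fset (fset_set (prime_divisors a))).
    exact: map_f.
  rewrite in_fset_set; last exact: (finite_prime_divisors dedA finA Ga).
  by apply/mem_set; rewrite prime_divisorsE.
apply: (le_trans (partial_zeta_le (undup_uniq _) psE)).
rewrite lee_fin ler_expR ler_wpM2l // -lee_fin -mean_fineE -sumEFin.
apply: fset_sum_le_esum => //; first exact: undup_uniq.
by move=> p /P_G; exact: w0.
Qed.

End Weight.
End Zeta.

(** * Concentration of the number of prime factors *)

Local Close Scope ereal_scope.

Section Dirichlet.
Context {R : realType}.
Implicit Types (s t : R) (n : nat).

(** The function [n ^ (- s)]. *)
Definition dirichlet s n : R := expR (- s * ln n%:R).

Lemma ln_nat_ge0 n : 0 <= ln (n%:R : R).
Proof. by case: n => [|n]; [rewrite ln0|rewrite ln_ge0 // ler1n]. Qed.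

Lemma ln_nat_le n : ln (n%:R : R) <= n%:R.
Proof.
case: n => [|n]; first by rewrite ln0.
by rewrite (le_trans (ltW (ln_sublinear _))) // ltr0n.
Qed.

Lemma dirichlet_weight s : 1 < s -> zeta_weight (dirichlet s).
Proof.
move=> s1; split.
- by rewrite /dirichlet ln1 mulr0 expR0.
- move=> m n m0 n0; rewrite /dirichlet natrM lnM ?posrE ?ltr0n //.
  by rewrite mulrDr expRD.
- by move=> n _; exact: expR_gt0.
- move=> m n m0 mn; rewrite ler_expR !mulNr lerN2 ler_wpM2l //; first by lra.
  by rewrite ler_ln ?posrE ?ltr0n ?(leq_trans m0) // ler_nat.
- have l2 : 0 < ln (2%:R : R) by rewrite ln_gt0 // ltr1n.
  rewrite -[X in X * _](@lnK _ (2%:R : R)) ?posrE ?ltr0n // -expRD.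
  by rewrite expR_lt1; nra.
Qed.

(** The derivative of [n ^ (- s)] is dominated by [n ^ (- u)] for any [u]
    smaller than [s]. *)
Lemma dirichlet_lipschitz s t u n : u < s -> s <= t -> (0 < n)%N ->
  dirichlet s n <= dirichlet t n + (t - s) / (s - u) * dirichlet u n.
Proof.
move=> us st n0; rewrite /dirichlet; set x := ln _.
have x0 : 0 <= x by exact: ln_nat_ge0.
have e1 : expR (- t * x) = expR (- s * x) * expR (- ((t - s) * x)).
  by rewrite -expRD; congr expR; ring.
have e2 : expR (- u * x) = expR (- s * x) * expR ((s - u) * x).
  by rewrite -expRD; congr expR; ring.
rewrite e1 e2 mulrCA -mulrDr -[X in X <= _]mulr1 ler_wpM2l ?expR_ge0 //.
have h1 : 1 - (t - s) * x <= expR (- ((t - s) * x)) by exact: expR_ge1Dx.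
have h2 : (s - u) * x <= expR ((s - u) * x).
  by apply: le_trans (expR_ge1Dx _); rewrite lerDr.
have h3 : (t - s) * x <= (t - s) / (s - u) * expR ((s - u) * x).
  rewrite mulrAC ler_pdivlMr ?subr_gt0 // -mulrA ler_wpM2l ?subr_ge0 //.
  by rewrite mulrC.
lra.
Qed.

End Dirichlet.

Section Concentration.
Context {A : comNzRingType} (dedA : dedekind_finite A) {R : realType}.
Context (finA : forall X, finite_set (@ideals_upto A X)).
Context (B : nat) (boundA : forall X, (#|` fset_set (@ideals_upto A X)| <= B * X)%N).
Context (B' : nat) (B'_gt0 : (0 < B')%N) (divA : forall S0 : seq (set A),
  exists S1 : seq (set A), [/\ uniq S1,
    forall a, a \in S1 -> nonzero_ideals a /\ a \notin S0 &
    forall F : realFieldType, 1 <= \sum_(a <- S1) (B'%:R / (ideal_norm a)%:R : F)]).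
Local Notation G := (@nonzero_ideals A).
Local Notation P := (@nonzero_primes A).
Local Notation upto X := (fset_set (@ideals_upto A X)).
Implicit Types (s t u M : R).

Definition mean_at s : R := fine (@mean A R (dirichlet s)).

Let meanE s : 1 < s -> @mean A R (dirichlet s) = (mean_at s)%:E.
Proof. by move=> s1; rewrite (mean_fineE dedA finA boundA (dirichlet_weight s1)). Qed.

Let P_G : P `<=` G. Proof. by move=> p; exact: nonzero_prime_ideal. Qed.

Lemma mean_at_lipschitz s t u : 1 < u -> u < s -> s <= t ->
  mean_at s <= mean_at t + (t - s) / (s - u) * mean_at u.
Proof.
move=> u1 us st; have s1 := lt_trans u1 us; have t1 := lt_le_trans s1 st.
have c0 : 0 <= (t - s) / (s - u) by rewrite divr_ge0 ?subr_ge0 // ltW.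
have d0 (v : R) p : (0 <= (weight (dirichlet v) p)%:E)%E.
  by rewrite lee_fin expR_ge0.
rewrite -lee_fin EFinD EFinM -!meanE // /mean -esumZl // -esumD //; last first.
  by move=> p _; rewrite mule_ge0.
apply: le_esum => p /P_G Gp; rewrite -EFinM -EFinD lee_fin.
by apply: dirichlet_lipschitz => //; exact: (ideal_norm_gt0 dedA).
Qed.

Lemma inverse_norms_unbounded k : exists S1 : seq (set A), [/\ uniq S1,
    forall a, a \in S1 -> G a &
    k%:R <= \sum_(a <- S1) (B'%:R / (ideal_norm a)%:R : R)].
Proof.
elim: k => [|k [S0 [u0 G0 h0]]]; first by exists [::]; rewrite big_nil.
have [S1 [u1 G1 h1]] := divA S0; exists (S0 ++ S1); split.
- rewrite cat_uniq u0 u1 andbT; apply/hasPn => a /G1[_ na]; exact: na.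
- by move=> a; rewrite mem_cat => /orP[/G0|/G1[]].
- by rewrite big_cat -natr1; exact: lerD h0 (h1 R).
Qed.

(** The zeta function, hence by the Euler product its logarithm, and finally
    the mean, tend to infinity at the abscissa [1]. *)
Lemma mean_at_unbounded M : exists2 s, 1 < s <= 2 & M <= mean_at s.
Proof.
pose k := Num.bound (2 * B'%:R * expR (2 * M)).
have kP : 2 * B'%:R * expR (2 * M) < k%:R.
  by apply: archi_boundP; rewrite !mulr_ge0 ?expR_ge0.
have [l [ul lG lk]] := inverse_norms_unbounded k.
pose Y := (\max_(a <- l) ideal_norm a).+1.
have Y0 : 0 < (Y%:R : R) by rewrite ltr0n.
have Y1 : 1 <= (Y%:R : R) by rewrite ler1n.
exists (1 + (2 * Y%:R)^-1).
  rewrite ltrDl invr_gt0 mulr_gt0 //= -[leRHS]/(1 + 1) lerD2l invf_le1 ?mulr_gt0 //; lra.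
set s := 1 + _.
have s1 : 1 < s by rewrite ltrDl invr_gt0 mulr_gt0.
have half a : a \in l -> 2^-1 * (ideal_norm a)%:R^-1 <= weight (dirichlet s) a.
  move=> al; have Na0 := ideal_norm_gt0 dedA (lG _ al).
  rewrite /weight /dirichlet; set x := ln _.
  have -> : - s * x = - x + - ((2 * Y%:R)^-1 * x) by rewrite /s; ring.
  rewrite expRD expRN lnK ?posrE ?ltr0n // mulrC ler_wpM2l ?invr_ge0 //.
  apply: le_trans (expR_ge1Dx _).
  have : (2 * Y%:R)^-1 * x <= 2^-1; last by lra.
  rewrite invfM -mulrA ler_piMr ?invr_ge0 // mulrC ler_pdivrMr // mul1r.
  by rewrite (le_trans (ln_nat_le _)) // ler_nat leqW // leq_bigmax_seq.
have zeta_ge : ((expR (2 * M))%:E <= @zeta A R (dirichlet s))%E.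
  apply: (@le_trans _ _ (\sum_(a <- l) (weight (dirichlet s) a)%:E)%E); last first.
    by apply: fset_sum_le_esum => // a Ga; rewrite lee_fin expR_ge0.
  rewrite sumEFin lee_fin; apply: (@le_trans _ _ (\sum_(a <- l) 2^-1 * (ideal_norm a)%:R^-1)).
    have B'0 : 0 < 2 * B'%:R :> R by rewrite mulr_gt0 // ltr0n.
    rewrite -(ler_pM2l B'0) (le_trans (ltW kP)) // (le_trans lk) // mulr_sumr.
    by apply: ler_sum => a _; rewrite mulrACA divff ?mul1r.
  by rewrite big_seq [leRHS]big_seq; apply: ler_sum => a /half.
have := le_trans zeta_ge (zeta_le_expR dedA finA boundA (dirichlet_weight s1)).
by rewrite lee_fin ler_expR ler_pM2l.
Qed.

(** The mean is continuous in the exponent, so it comes close to every large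
    number; a discrete intermediate value argument suffices. *)
Lemma mean_at_near M : mean_at 2 <= M -> exists2 s, 1 < s <= 2 & `|mean_at s - M| <= 1.
Proof.
move=> M2; have [r /andP[r1 r2] Mr] := mean_at_unbounded M.
(* On [r, 2] the mean has Lipschitz constant [L]; the grid [v] has [K0] steps,
   each of which changes the mean by at most [1]. *)
pose u := (1 + r) / 2.
have u1 : 1 < u by rewrite /u; lra.
have ur : u < r by rewrite /u; lra.
pose L := mean_at u / (r - u).
have mu0 : 0 <= mean_at u by exact: (mean_ge0 dedA (dirichlet_weight u1)).
have L0 : 0 <= L by rewrite divr_ge0 // subr_ge0 ltW.
have [K0 K0_gt0 Kle] : exists2 K : nat, (0 < K)%N & (2 - r) * L <= K%:R.
  exists (Num.bound ((2 - r) * L)).+1 => //.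
  apply: ltW; apply: lt_trans (_ : _ < (Num.bound ((2 - r) * L))%:R) _; last by rewrite ltr_nat.
  by apply: archi_boundP; rewrite mulr_ge0 // subr_ge0.
pose v i : R := 2 - i%:R * ((2 - r) / K0%:R).
have K00 : 0 < K0%:R :> R by rewrite ltr0n.
have ex : exists i, (i <= K0)%N && (M <= mean_at (v i)).
  exists K0; rewrite leqnn /= /v mulrCA divff ?gt_eqF // mulr1.
  by rewrite opprB addrCA subrr addr0.
case: (ex_minnP ex) => -[|i] /andP[iK Mi] imin.
  exists 2; first by rewrite lexx andbT; lra.
  have v0 : v 0%N = 2 by rewrite /v mul0r subr0.
  rewrite v0 in Mi; rewrite (_ : mean_at 2 = M) ?subrr ?normr0 //.
  by apply/eqP; rewrite eq_le M2.
have st : 0 <= (2 - r) / K0%:R by rewrite divr_ge0 ?subr_ge0 // ltW.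
have rv : r <= v i.+1.
  rewrite /v lerBrDr -lerBrDl mulrCA -[leRHS]mulr1 ler_wpM2l ?subr_ge0 //.
  by rewrite ler_pdivrMr // mul1r ler_nat.
have vi : v i = v i.+1 + (2 - r) / K0%:R by rewrite /v -natr1; ring.
have Mi' : mean_at (v i) < M.
  rewrite ltNge; apply/negP => h; have /imin := introT andP (conj (ltnW iK) h).
  by rewrite ltnn.
exists (v i.+1).
  rewrite (lt_le_trans r1 rv) /= /v lerBlDr lerDl mulr_ge0 //.
have vle : v i.+1 <= v i by rewrite vi lerDl.
have vB : v i - v i.+1 = (2 - r) / K0%:R by rewrite vi [X in X - _]addrC addrK.
have := mean_at_lipschitz u1 (lt_le_trans ur rv) vle; rewrite vB => lip.
have lip2 : (2 - r) / K0%:R / (v i.+1 - u) * mean_at u <= 1.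
  apply: (@le_trans _ _ ((2 - r) / K0%:R / (r - u) * mean_at u)).
    rewrite ler_wpM2r // ler_wpM2l // lef_pV2 ?posrE ?subr_gt0 ?lerD2r //.
    exact: lt_le_trans rv.
  by rewrite -mulrA [_^-1 * mean_at u]mulrC -/L mulrAC ler_pdivrMr // mul1r.
rewrite ger0_norm ?subr_ge0 // lerBlDr.
by rewrite (le_trans lip) // addrC lerD // ltW.
Qed.

Let weight_sqr_le s p : 1 < s -> G p -> weight (dirichlet s) p ^+ 2 <= weight (dirichlet 2) p.
Proof.
move=> s1 Gp; rewrite -expRM_natl ler_expR.
by have := @ln_nat_ge0 R (ideal_norm p); nra.
Qed.

Section Tail.
Context (c : set A -> nat) (cE : c = Omega_ideal \/ c = omega_ideal).
Context (s : R) (s1 : 1 < s).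
Local Notation w := (@weight A R (dirichlet s)).
Local Notation Z := (fine (@zeta A R (dirichlet s))).
Let wP := dirichlet_weight s1.
Let w0 a : (0 <= (w a)%:E)%E. Proof. by rewrite lee_fin expR_ge0. Qed.

Let omega_tail t : 0 < t ->
  (\esum_(a in G `&` [set a | (t <= `|(omega_ideal a)%:R - mean_at s|)%R]) (w a)%:E
    <= (mean_at s / t ^+ 2 * Z)%:E)%E.
Proof.
move=> t0; have t2 : 0 < t ^+ 2 by rewrite exprn_gt0.
rewrite -(@lee_pmul2l _ (t ^+ 2)%:E) //.
apply: (le_trans (omega_chebyshev dedA finA boundA wP t0)).
by rewrite -EFinM mulrA [_ * (_ / _)]mulrC divfK ?gt_eqF.
Qed.

Let excess_tail t : 0 < t ->
  (\esum_(a in G `&` [set a | (t <= (excess a)%:R)%R]) (w a)%:E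
    <= (2 * mean_at 2 / t * Z)%:E)%E.
Proof.
move=> t0; rewrite -(@lee_pmul2l _ t%:E) // -esumZl //; last exact: ltW.
have Z0 := zeta_fine_ge0 dedA finA boundA wP.
apply: (@le_trans _ _ (\esum_(a in G) (w a * (excess a)%:R)%:E)%E).
  apply: (@le_trans _ _ (\esum_(a in G `&` [set a | (t <= (excess a)%:R)%R])
      (w a * (excess a)%:R)%:E)%E).
    by apply: le_esum => a [_ /= ta]; rewrite -EFinM lee_fin mulrC ler_wpM2l ?expR_ge0.
  by apply: esum_le_sub => [a []//|a _]; rewrite lee_fin mulr_ge0 ?expR_ge0.
apply: (le_trans (excess_moment dedA finA boundA wP)).
have -> : (t%:E * (2 * mean_at 2 / t * Z)%:E = (2 * Z)%:E * (mean_at 2)%:E)%E.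
  rewrite -!EFinM; congr (_%:E); rewrite mulrA [t * _]mulrC divfK ?gt_eqF //; ring.
rewrite lee_wpmul2l ?lee_fin ?mulr_ge0 // -meanE; last by lra.
by apply: le_esum => p /P_G Gp; rewrite lee_fin weight_sqr_le.
Qed.

(** Far from the mean, either [omega_ideal] is far from it or there are many
    repeated factors. *)
Lemma prime_factor_tail t : 0 < t ->
  (\esum_(a in G `&` [set a | (2 * t <= `|(c a)%:R - mean_at s|)%R]) (w a)%:E
    <= ((mean_at s / t ^+ 2 + 2 * mean_at 2 / t) * Z)%:E)%E.
Proof.
move=> t0; pose E1 : set (set A) := [set a | (t <= `|(omega_ideal a)%:R - mean_at s|)%R].
rewrite (esumID E1) // [X in (_ <= X%:E)%E]mulrDl EFinD; apply: leeD.
  apply: le_trans (omega_tail t0); apply: esum_le_sub => // a [[Ga _] E1a]; by split.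
apply: le_trans (excess_tail t0); apply: esum_le_sub => // a [[Ga /= ca] nE1]; split=> //=.
have {}nE1 : `|(omega_ideal a)%:R - mean_at s| < t by rewrite ltNge; exact/negP.
case: cE ca => ->; last by move=> ca; exfalso; move: ca; apply/negP; rewrite -ltNge; lra.
rewrite (Omega_omega dedA finA Ga) natrD addrAC => ca.
have := ler_normD ((omega_ideal a)%:R - mean_at s) (excess a)%:R.
rewrite [X in _ <= _ + X](ger0_norm (ler0n R (excess a))) => h; lra.
Qed.

End Tail.

(** A weak form of the Hardy-Ramanujan theorem: take [s] with mean close to [M]
    and transfer the concentration from the zeta distribution to some [N]. *)
Lemma prime_factor_concentration (c : set A -> nat) (eta delta : R) :
  c = Omega_ideal \/ c = omega_ideal -> 0 < eta -> 0 < delta ->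
  exists M0, forall M, M0 <= M -> exists2 N, (0 < N)%N &
    \sum_(a <- upto N | delta * M <= `|(c a)%:R - M|) 1 <= eta * (#|` upto N|)%:R :> R.
Proof.
move=> cE eta0 delta0; pose C0 := mean_at 2.
have C00 : 0 <= C0 by apply: (mean_ge0 dedA (dirichlet_weight _)); lra.
pose k := 32 / delta ^+ 2 + 8 * C0 / delta.
have k0 : 0 <= k by rewrite addr_ge0 // divr_ge0 ?mulr_ge0 ?sqr_ge0 // ltW.
(* The four terms give a mean equal to [M], [1 <= M], [2 <= delta * M] and a tail
   [k / M <= eta / 2]. *)
exists (C0 + 1 + 2 / delta + 2 * k / eta) => M MM0.
have d2 : 0 <= 2 / delta by rewrite divr_ge0 // ltW.
have ke : 0 <= 2 * k / eta by rewrite divr_ge0 ?mulr_ge0 // ltW.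
have M1 : 1 <= M by lra.
have CM : mean_at 2 <= M by rewrite -/C0; lra.
have [s /andP[s1 _] sM] := mean_at_near CM.
pose t := delta * M / 4.
have dM : 2 <= delta * M.
  by rewrite mulrC -ler_pdivrMr //; lra.
have t0 : 0 < t by rewrite /t; lra.
have Z0 := zeta_fine_gt0 dedA finA boundA (dirichlet_weight s1).
have tail : mean_at s / t ^+ 2 + 2 * mean_at 2 / t <= eta / 2.
  apply: (@le_trans _ _ (k / M)).
    have -> : k / M = 32 * M / (delta * M) ^+ 2 + 8 * C0 / (delta * M).
      by rewrite /k; field; rewrite !gt_eqF //; lra.
    have -> : mean_at s / t ^+ 2 = 16 * mean_at s / (delta * M) ^+ 2.
      by rewrite /t; field; rewrite !gt_eqF //; lra.
    have -> : 2 * mean_at 2 / t = 8 * C0 / (delta * M).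
      by rewrite /t /C0; field; rewrite !gt_eqF //; lra.
    rewrite lerD2r ler_wpM2r ?invr_ge0 ?sqr_ge0 //.
    by move: sM; rewrite ler_norml => /andP[]; lra.
  rewrite ler_pdivrMr; last by lra.
  by rewrite mulrAC ler_pdivlMr // mulrC -ler_pdivrMl // mulrC; lra.
apply: contrapT => h.
have big X : (0 < X)%N -> eta * (#|` upto X|)%:R <=
    \sum_(a <- upto X | `[< delta * M <= `|(c a)%:R - M| >]) 1 :> R.
  move=> X0; apply: ltW; rewrite ltNge; apply/negP => hX; apply: h; exists X => //.
  apply: le_trans hX; rewrite le_eqVlt; apply/orP; left; apply/eqP.
  by apply: eq_bigl => a; rewrite asboolb.
have := zeta_mixture dedA finA boundA (dirichlet_weight s1)
  (E := fun a : set A => delta * M <= `|(c a)%:R - M|) eta0 big.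
apply/negP; rewrite -ltNge.
apply: (@le_lt_trans _ _ ((eta / 2) * fine (@zeta A R (dirichlet s)))%:E%E); last first.
  rewrite (zeta_fineE dedA finA boundA (dirichlet_weight s1)) -EFinM lte_fin ltr_pM2r //.
  lra.
apply: (@le_trans _ _ ((mean_at s / t ^+ 2 + 2 * mean_at 2 / t) * fine (@zeta A R (dirichlet s)))%:E%E).
  apply: le_trans (prime_factor_tail cE s1 t0); apply: esum_le_sub => [a [Ga /= ca]|a _].
    split=> //=; have := ler_normD ((c a)%:R - mean_at s) (mean_at s - M).
    rewrite addrA subrK => hh; rewrite /t; lra.
  by rewrite lee_fin expR_ge0.
by rewrite lee_fin ler_wpM2r // ltW.
Qed.

End Concentration.

(** * Slabs of a skyscraper *)

Local Open Scope ereal_scope.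

(** A non-atomic Borel probability on a compact metric space has sets of small
    positive measure: cover the space by finitely many small open balls. *)
Lemma small_positive_set (R : realType) (d : measure_display)
    (X : metricMeasurableType d R) (mu : probability X R) :
  compact [set: X] -> @measurable d X = <<s @open X >> -> non_atomic mu ->
  forall eps : R, (0 < eps)%R ->
  exists B : set X, [/\ measurable B, 0 < mu B & mu B < eps%:E].
Proof.
move=> compactX borelX nonatomic_mu eps eps0.
have openm (U : set X) : open U -> measurable U.
  by move=> oU; rewrite borelX; exact: sub_sigma_algebra.
have small x : exists n : nat, mu (ball x (n.+1%:R^-1 : R))^° < eps%:E.
  apply: contrapT => h.
  pose F n : set X := (ball x (n.+1%:R^-1 : R))^°.
  have Fm n : measurable (F n) by apply: openm; exact: open_interior.
  have Fx : \bigcap_n F n = [set x].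
    apply/seteqP; split=> [y Fy|_ -> n _].
      apply/esym/mdist_positivity/eqP; rewrite eq_le mdist_ge0 andbT leNgt.
      apply/negP => dxy; have [n _ /(_ n (leqnn n)) nd] := near_infty_natSinv_lt (PosNum dxy).
      have /interior_subset := Fy n I; rewrite ballEmdist /=.
      by apply/negP; rewrite -leNgt; exact: ltW.
    by apply: nbhsx_ballx.
  have cvgF : mu \o F @ \oo --> mu (\bigcap_n F n).
    apply: nonincreasing_cvg_mu => //; first by rewrite (le_lt_trans (probability_le1 mu (Fm 0%N))) ?ltry.
      by apply: bigcap_measurable.
    move=> m n mn; apply/subsetPset/interiorS/le_ball.
    by rewrite lef_pV2 ?posrE // ler_nat ltnS.
  have : eps%:E <= mu (\bigcap_n F n).
    rewrite -(cvg_lim _ cvgF) //; apply: lime_ge; first by apply/cvg_ex; eexists; exact: cvgF.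
    by apply: nearW => n; rewrite leNgt; apply/negP => Fn; apply: h; exists n.
  by rewrite Fx nonatomic_mu lee_fin leNgt eps0.
move: small => /choice[n nP].
pose U x : set X := (ball x ((n x).+1%:R^-1 : R))^°.
have Um x : measurable (U x) by apply: openm; exact: open_interior.
move: compactX; rewrite compact_cover => /(_ X setT U)[].
- by move=> x _; exact: open_interior.
- by move=> x _; exists x => //; exact: nbhsx_ballx.
move=> D _ cover; apply: contrapT => h.
have U0 x : mu (U x) = 0.
  apply/eqP; rewrite eq_le measure_ge0 andbT leNgt; apply/negP => Ux; apply: h.
  by exists (U x); split; [exact: Um|exact: Ux|exact: nP].
have [_ mu0] : measurable [set: X] /\ mu [set: X] = 0.
  have -> : [set: X] = \big[setU/set0]_(i <- D) U i.
    by rewrite -bigcup_fset; apply/seteqP.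
  elim/big_ind: _ => [|V W [mV V0] [mW W0]|i _]; first by split=> //; rewrite measure0.
    by split; [exact: measurableU|exact: null_set_setU].
  by split; [exact: Um|exact: U0].
by have := probability_setT mu; rewrite mu0 => /eqP; rewrite eq_sym onee_eq0.
Qed.

Section Skyscraper.
Context {d : measure_display} {X : measurableType d} {R : realType}
  (mu : probability X R) {T : X -> X} (mpT : measure_preserving mu T).
Implicit Types (A B S : set X) (i j k n : nat).

Definition preimage_iter k A : set X := [set x | A (iter k T x)].

Lemma preimage_iterS k A : preimage_iter k.+1 A = T @^-1` (preimage_iter k A).
Proof. by apply/seteqP; split=> x; rewrite /preimage_iter /= -iterSr. Qed.

Lemma measurable_preimage_iter k A : measurable A -> measurable (preimage_iter k A).
Proof.
move=> mA; elim: k => [//|k ih]; rewrite preimage_iterS -[X in measurable X]setTI.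
exact: mpT.1.
Qed.

Lemma measure_preimage_iter k A : measurable A -> mu (preimage_iter k A) = mu A.
Proof.
move=> mA; elim: k => [//|k ih]; rewrite preimage_iterS mpT.2 //.
exact: measurable_preimage_iter.
Qed.

Lemma measure_union_le n (F : nat -> set X) (b : R) :
  (forall i, measurable (F i)) -> (forall i, mu (F i) <= b%:E) ->
  mu (\bigcup_(i < n) F i) <= (n%:R * b)%:E.
Proof.
move=> mF Fb; elim: n => [|n ih]; first by rewrite bigcup_mkord big_ord0 measure0 mul0r.
rewrite bigcup_mkord big_ord_recr /= -bigcup_mkord.
rewrite -natr1 mulrDl mul1r EFinD.
have mU : measurable (\bigcup_(i < n) F i) by exact: bigcup_measurable.
by apply: le_trans (measureU2 _ mU (mF n)) _; exact: leeD ih (Fb n).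
Qed.

(** The points that visit [B] infinitely often form an invariant set, and its measure
    is at least [mu B] since the preimages of [B] all have measure [mu B]. *)
Lemma recurrence B : ergodic mu T -> measurable B -> 0 < mu B ->
  mu (\bigcup_k preimage_iter k B) = 1.
Proof.
move=> ergT mB B0; have mP k := measurable_preimage_iter k mB.
pose V := lim_sup_set (fun k => preimage_iter k B).
have mU : measurable (\bigcup_k preimage_iter k B) by exact: bigcup_measurable.
have mV : measurable V.
  by apply: bigcap_measurable => // n _; apply: bigcup_measurable => k _; exact: mP.
have VT : V = T @^-1` V.
  apply/seteqP; split=> x Vx n _.
    have [[|k] /= nk Bk] := Vx n.+1 I; first by [].
    by exists k => //; move: Bk; rewrite /preimage_iter /= -iterSr.
  have [k /= nk Bk] := Vx n I; exists k.+1; first exact: leqW.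
  by move: Bk; rewrite /preimage_iter /= -iterSr.
have VB : mu B <= mu V.
  have cvgV := lim_sup_set_cvg mu _ mP (le_lt_trans (probability_le1 mu _) (ltry 1)).
  rewrite -(cvg_lim _ (cvgV _)) //; last first.
    by apply: bigcup_measurable => k _; exact: mP.
  apply: lime_ge.
    apply/cvg_ex; eexists; apply: cvgV; by apply: bigcup_measurable => k _; exact: mP.
  apply: nearW => n; rewrite -(measure_preimage_iter n mB).
  apply: le_measure; rewrite ?inE //; first by apply: bigcup_measurable => k _; exact: mP.
  by move=> x Bx; exists n => /=.
have V1 : mu V = 1.
  by have [V0|//] := ergT V mV VT; move: VB; rewrite V0 leNgt B0.
apply/eqP; rewrite eq_le probability_le1 //= -V1; apply: le_measure; rewrite ?inE //.
by move=> x Vx; have [k _ Bk] := Vx 0%N I; exists k.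
Qed.

(** Cut the time to reach [B] into periods of length [m * l], and each period
    into [m] slots of length [l].  Some slot has measure at most [1 / m], and
    every point that is far from [B] runs through the whole slot within one
    period. *)
Lemma slab B (m l : nat) : ergodic mu T -> measurable B -> 0 < mu B ->
  (0 < m)%N -> (0 < l)%N -> exists S E : set X,
  [/\ measurable S, measurable E, mu S <= (m%:R^-1)%:E,
      mu E <= (2 * m * l)%:R%:E * mu B &
      forall x, ~ E x -> exists2 n, (n <= m * l)%N &
        forall k, (n <= k < n + l)%N -> S (iter k T x)].
Proof.
move=> ergT mB B0 m0 l0; have mP k := measurable_preimage_iter k mB.
pose h := (m * l)%N; have h0 : (0 < h)%N by rewrite muln_gt0 m0.
(* The points that reach [B] for the first time at time [k]. *)
pose H k := preimage_iter k B `\` \bigcup_(i < k) preimage_iter i B.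
have mH k : measurable (H k).
  by apply: measurableD => //; apply: bigcup_measurable => i _; exact: mP.
have HE k x : H k x <-> B (iter k T x) /\ forall i, (i < k)%N -> ~ B (iter i T x).
  split=> [[Bk nB]|[Bk nB]]; split=> //; first by move=> i ik Bi; apply: nB; exists i.
  by move=> [i ik Bi]; exact: nB ik Bi.
have Huniq k k' x : H k x -> H k' x -> k = k'.
  move=> /HE[Bk nk] /HE[Bk' nk']; case: (ltngtP k k') => // lt; exfalso.
    exact: nk' lt Bk.
  exact: nk lt Bk'.
pose S r := \bigcup_(k in [set k | (k %% h) %/ l = r]%N) H k.
have mS r : measurable (S r) by exact: bigcup_measurable.
have [r rm Sr] : exists2 r, (r < m)%N & mu (S r) <= (m%:R^-1)%:E.
  apply: contrapT => hS.
  have big (r : 'I_m) : (m%:R^-1)%:E < mu (S r).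
    by rewrite ltNge; apply/negP => Sr; apply: hS; exists r.
  have tS : trivIset setT (fun r : 'I_m => S r).
    apply/trivIsetP => r r' _ _ rr'; apply/seteqP; split=> // x [[k /= kr Hk] [k' /= kr' Hk']].
    by move/eqP: rr'; apply; apply/val_inj; rewrite /= -kr -kr' (Huniq k k' x).
  have : \sum_(r < m) mu (S r) <= 1.
    rewrite -(measure_bigsetU_ord mu xpredT _ tS) // probability_le1 //.
    exact: bigsetU_measurable.
  apply/negP; rewrite -ltNge.
  have fE r : mu (S r) = (fine (mu (S r)))%:E by rewrite fineK // fin_num_measure.
  under eq_bigr do rewrite fE; rewrite sumEFin lte_fin.
  have {1}<- : (\sum_(r < m) (m%:R^-1 : R) = 1)%R.
    by rewrite sumr_const card_ord -(mulr_natr m%:R^-1) mulVf // pnatr_eq0 -lt0n.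
  apply: ltr_sum => [|r _]; last by rewrite -lte_fin -fE.
  by apply/hasP; exists (Ordinal m0); rewrite ?mem_index_enum.
pose E := ~` (\bigcup_k preimage_iter k B) `|` \bigcup_(i < (2 * m * l)%N) preimage_iter i B.
have mU : measurable (\bigcup_k preimage_iter k B) by exact: bigcup_measurable.
have mU' : measurable (\bigcup_(i < (2 * m * l)%N) preimage_iter i B).
  by apply: bigcup_measurable => i _; exact: mP.
exists (S r), E; split=> //; first by apply: measurableU => //; exact: measurableC.
  apply: le_trans (measureU2 _ (measurableC mU) mU') _.
  rewrite -[leRHS]add0e; apply: leeD.
    by have := probability_setC mu mU; rewrite recurrence // subee // => U0; have := lexx (0 : \bar R); rewrite -{1}U0.
  have Bfin : mu B \is a fin_num by exact: fin_num_measure.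
  rewrite -(fineK Bfin) -EFinM; apply: measure_union_le => // i.
  by rewrite measure_preimage_iter // fineK.
move=> x /not_orP[/contrapT[k0 _ Bk0] nB].
have [t Ht] : exists t, H t x.
  have ex : exists k, `[< B (iter k T x) >] by exists k0; exact/asboolP.
  case: (ex_minnP ex) => t /asboolP Bt tmin; exists t; apply/HE; split=> // i it Bi.
  by have := tmin i (asboolT Bi); rewrite leqNgt it.
have th : (2 * h <= t)%N.
  rewrite leqNgt; apply/negP => lt; apply: nB; exists t; first by rewrite /= -mulnA.
  by case: Ht.
have shift k : (k <= t)%N -> H (t - k)%N (iter k T x).
  move=> kt; have [Bt nt] := (HE t x).1 Ht; apply/HE; rewrite -iterD subnK //.
  split=> // i ik; rewrite -iterD; apply: nt; lia.
pose top := (r * l + l.-1)%N.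
have toph : (top < h)%N.
  have : ((r.+1) * l <= m * l)%N by rewrite leq_mul2r rm orbT.
  rewrite /top /h mulSn; lia.
(* The first time at which the waiting time, which decreases by one at each step,
   is congruent to the top of the slot. *)
pose n := if (top <= t %% h)%N then (t %% h - top)%N else (t %% h + h - top)%N.
exists n.
  rewrite -/h /n; have := ltn_pmod t h0; move: (t %% h)%N => ? ?.
  by case: (leqP top) => ?; lia.
move=> k /andP[nk kn].
have tE := divn_eq t h; have tlt := ltn_pmod t h0.
have [q [u [ql uE]]] : exists q u, (u < l)%N /\ (t = k + (q * h + (r * l + u)))%N.
  have Q0 : (0 < t %/ h)%N by rewrite divn_gt0 // (leq_trans _ th) // leq_pmull.
  have QE : ((t %/ h).-1 * h + h = t %/ h * h)%N by rewrite -mulSnr prednK.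
  exists (if (top <= t %% h)%N then t %/ h else (t %/ h).-1)%N, (l.-1 - (k - n))%N.
  move: tE tlt toph nk kn Q0 QE; rewrite /n /top.
  move: (t %% h)%N (t %/ h)%N => u v tE ult toph; case: (leqP (r * l + l.-1)%N u) => c nk kn v0 vE;
    (split; first lia); move: tE vE toph c nk kn;
    move: (v.-1 * h)%N (v * h)%N (r * l)%N => ? ? ?; lia.
have kt : (k <= t)%N by rewrite uE leq_addr.
exists (t - k)%N; last exact: shift.
rewrite /= {1}uE addKn modnMDl modn_small; last by rewrite /top in toph; lia.
by rewrite divnMDl // divn_small // addn0.
Qed.

End Skyscraper.

(** * Strong sweeping out *)

Lemma limn_esup_eq1 (R : realType) (u : nat -> R) : (forall N, u N <= 1)%R ->
  (forall (e : R) N0, 0 < e -> exists2 N, (N0 <= N)%N & 1 - e <= u N)%R ->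
  limn_esup (fun N => (u N)%:E) = 1.
Proof.
move=> u1 uN; rewrite limn_esup_lim; apply/cvg_lim => //.
rewrite (_ : esups _ = fun=> 1); first exact: cvg_cst.
apply/funext => n; apply/eqP; rewrite eq_le; apply/andP; split.
  by apply: ge_ereal_sup => _ [N _ <-]; rewrite lee_fin.
apply/lee_addgt0Pr => e e0; have [N nN h] := uN e n e0.
apply: (@le_trans _ _ ((u N)%:E + e%:E)).
  by rewrite -EFinD lee_fin -lerBlDr.
by rewrite leeD2r //; apply: ereal_sup_ubound; exists N.
Qed.

Lemma limn_einf_eq0 (R : realType) (u : nat -> R) : (forall N, 0 <= u N)%R ->
  (forall (e : R) N0, 0 < e -> exists2 N, (N0 <= N)%N & u N <= e)%R ->
  limn_einf (fun N => (u N)%:E) = 0.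
Proof.
move=> u0 uN; rewrite limn_einf_lim; apply/cvg_lim => //.
rewrite (_ : einfs _ = fun=> 0); first exact: cvg_cst.
apply/funext => n; apply/eqP; rewrite eq_le; apply/andP; split; last first.
  by apply: le_ereal_inf_tmp => _ [N _ <-]; rewrite lee_fin.
apply/lee_addgt0Pr => e e0; have [N nN h] := uN e n e0; rewrite add0e.
apply: (@le_trans _ _ (u N)%:E); last by rewrite lee_fin.
by apply: ereal_inf_lbound; exists N.
Qed.

(** The average of order [N] gives mass at most [eta] to the times outside
    the interval of length [l] that starts at [n]. *)
Definition concentrated (R : realType) (X : Type) (T : X -> X)
    (avg : set X -> X -> nat -> R) (eta : R) (n l N : nat) : Prop := forall A x,
  ((forall k, (n <= k < n + l)%N -> A (iter k T x)) -> 1 - eta <= avg A x N)%R /\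
  ((forall k, (n <= k < n + l)%N -> ~ A (iter k T x)) -> avg A x N <= eta)%R.

Section Sweeping.
Context {d : measure_display} {X : measurableType d} {R : realType}
  (mu : probability X R) {T : X -> X} (mpT : measure_preserving mu T)
  (ergT : ergodic mu T).
Context (smallB : forall eps : R, (0 < eps)%R ->
  exists B : set X, [/\ measurable B, 0 < mu B & mu B < eps%:E]).
Implicit Types (A S E : set X) (x : X) (n l N i k m : nat) (eta : R).

Context (avg : set X -> X -> nat -> R).

Context (avg_ge0 : forall A x N, (0 <= avg A x N)%R)
        (avg_le1 : forall A x N, (avg A x N <= 1)%R).
Context (avg_concentrated : forall eta m N0, (0 < eta)%R ->
  exists2 l, (0 < l)%N & forall n, (n <= m * l)%N ->
    exists2 N, (N0 <= N)%N & concentrated T avg eta n l N).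

(** Stage [i], to be run after stages whose times are all below [h]: the slab
    [u.1.1], the set [u.1.2] of points that miss it, the new bound [u.2] on
    times. *)
Let sweeping_step (eps : R) i h : (0 < eps)%R -> exists u : set X * set X * nat,
  [/\ measurable u.1.1 /\ measurable u.1.2,
      mu u.1.1 <= (eps / (2 ^ i.+1)%:R)%:E /\ h%:R%:E * mu u.1.1 <= (1 / (2 ^ i.+1)%:R)%:E,
      mu u.1.2 <= (1 / (2 ^ i.+1)%:R)%:E, (h <= u.2)%N &
      forall x, ~ u.1.2 x -> exists n l N, [/\ (n + l <= u.2)%N, (i <= N)%N,
        forall k, (n <= k < n + l)%N -> u.1.1 (iter k T x) &
        concentrated T avg (1 / (2 ^ i.+1)%:R) n l N]].
Proof.
move=> eps0; set eta := (1 / (2 ^ i.+1)%:R)%R : R.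
have eta0 : (0 < eta)%R by rewrite divr_gt0 // ltr0n expn_gt0.
have [m m0 [m1 m2]] : exists2 m, (0 < m)%N &
    (m%:R^-1 <= eps / (2 ^ i.+1)%:R /\ h%:R * m%:R^-1 <= eta :> R)%R.
  have c0 : (0 < eps / (2 ^ i.+1)%:R :> R)%R by rewrite divr_gt0 // ltr0n expn_gt0.
  pose y : R := ((eps / (2 ^ i.+1)%:R)^-1 + h%:R / eta)%R.
  have y0 : (0 <= y)%R by rewrite addr_ge0 ?invr_ge0 ?divr_ge0 // ltW.
  exists (Num.bound y).+1 => //; have := archi_boundP y0; set b := Num.bound y => yb.
  have b0 : (0 < b.+1%:R :> R)%R by rewrite ltr0n.
  have yb' : (y <= b.+1%:R)%R by rewrite (le_trans (ltW yb)) // ler_nat.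
  split.
    rewrite -[leRHS]invrK lef_pV2 ?posrE ?invr_gt0 // (le_trans _ yb') // /y lerDl.
    by rewrite divr_ge0 // ltW.
  rewrite ler_pdivrMr // mulrC -ler_pdivrMr // (le_trans _ yb') // /y lerDr.
  by rewrite invr_ge0 ltW.
have [l l0 lP] := avg_concentrated m i eta0.
have M0 : (0 < (2 * m * l)%:R :> R)%R by rewrite ltr0n !muln_gt0 m0 l0.
have [B [mB B0 Bs]] := smallB (divr_gt0 eta0 M0).
have [S [E [mS mE muS muE SE]]] := slab mpT ergT mB B0 m0 l0.
exists (S, E, (h + m * l + l)%N); split=> //=.
- split; first by apply: le_trans muS _; rewrite lee_fin.
  apply: (@le_trans _ _ (h%:R%:E * (m%:R^-1)%:E)); last by rewrite -EFinM lee_fin.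
  by rewrite lee_wpmul2l // lee_fin.
- apply: (le_trans muE); apply: (@le_trans _ _ ((2 * m * l)%:R%:E * (eta / (2 * m * l)%:R)%:E)).
    by rewrite lee_wpmul2l ?lee_fin // ltW.
  by rewrite -EFinM lee_fin mulrC divfK // gt_eqF.
- lia.
- move=> x /SE[n nml Sx]; have [N iN cN] := lP n nml.
  exists n, l, N; split=> //; lia.
Qed.

(** The stages with even index put their slab into [A], those with odd index
    keep it out of [A], and later stages prevail over earlier ones.  As the slab
    of a stage is small compared with the times involved in the previous
    stages, almost every orbit meets only finitely many conflicts. *)
Theorem strong_sweeping (eps : R) : (0 < eps)%R ->
  exists A, [/\ measurable A, mu A < eps%:E &
    {ae mu, forall x, limn_esup (fun N => (avg A x N)%:E) = 1 /\
                      limn_einf (fun N => (avg A x N)%:E) = 0}].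
Proof.
move=> eps0; have eps2 : (0 < eps / 2)%R by rewrite divr_gt0.
have [g gP] := choice (fun ih : nat * nat => sweeping_step ih.1 ih.2 eps2).
pose f i h := g (i, h); have fP i h := gP (i, h).
pose H := fix H i := if i is j.+1 then (f j (H j)).2 else 0%N.
pose S i := (f i (H i)).1.1; pose E i := (f i (H i)).1.2.
have mS i : measurable (S i) by have [[]] := fP i (H i).
have mE i : measurable (E i) by have [[]] := fP i (H i).
have Hmono i j : (i <= j)%N -> (H i <= H j)%N.
  move=> /subnK <-; elim: (j - i)%N => // k; rewrite addSn => /leq_trans; apply.
  by have [] := fP (k + i)%N (H (k + i)%N).
pose A := \bigcup_j (S j.*2 `\` \bigcup_(i in [set i | (j.*2 < i)%N]) S i).
have mA : measurable A.
  by apply: bigcup_measurable => j _; apply: measurableD => //; exact: bigcup_measurable.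
exists A; split=> //.
  apply: (@le_lt_trans _ _ (eps / 2)%:E); last by rewrite lte_fin ltr_pdivrMr // ltr_pMr // ltr1n.
  apply: le_trans (epsilon_trick0 xpredT (ltW eps2)).
  apply: (@le_trans _ _ (\sum_(i <oo) mu (S i))).
    apply: measure_sigma_subadditive => //.
    by move=> x [j _ [Sx _]]; exists j.*2.
  by apply: lee_nneseries => // i _; have [_ []] := fP i (H i).
(* The points that miss the slab of stage [i], or meet it at a time used by an
   earlier stage. *)
pose F i := E i `|` \bigcup_(k < H i) preimage_iter (T := T) k (S i).
have mFb i : measurable (\bigcup_(k < H i) preimage_iter (T := T) k (S i)).
  by apply: bigcup_measurable => k _; exact: (measurable_preimage_iter mpT).
have mF i : measurable (F i) by exact: measurableU.
have muF i : mu (F i) <= (2 / (2 ^ i.+1)%:R)%:E.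
  have [_ [_ h1] h2 _ _] := fP i (H i).
  have -> : (2 / (2 ^ i.+1)%:R = 1 / (2 ^ i.+1)%:R + 1 / (2 ^ i.+1)%:R :> R)%R by lra.
  apply: le_trans (measureU2 _ (mE i) (mFb i)) _; rewrite EFinD; apply: leeD => //.
  have Sfin : mu (S i) \is a fin_num by exact: fin_num_measure.
  apply: le_trans h1; rewrite -/(S i) -(fineK Sfin) -EFinM.
  apply: measure_union_le => k; first exact: (measurable_preimage_iter mpT).
  by rewrite (measure_preimage_iter mpT) // fineK.
have limF : mu (lim_sup_set F) = 0.
  apply: lim_sup_set_cvg0 => //; apply: le_lt_trans (ltry 2%R).
  apply: le_trans (epsilon_trick0 xpredT _) => //.
  by apply: lee_nneseries => // i _; exact: muF.
exists (lim_sup_set F); split=> //.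
  by apply: bigcap_measurable => // n _; apply: bigcup_measurable => k _; exact: mF.
move=> x /= nx; apply: contrapT => nFx; apply: nx.
have [i0 good] : exists i0, forall i, (i0 <= i)%N -> ~ F i x.
  apply: contrapT => h; apply: nFx => n _; apply: contrapT => h'; apply: h.
  by exists n => i ni Fi; apply: h'; exists i.
have window i : (i0 <= i)%N -> exists n l N, [/\ (i <= N)%N,
    concentrated T avg (1 / (2 ^ i.+1)%:R) n l N,
    forall k, (n <= k < n + l)%N -> S i (iter k T x) &
    forall k j, (n <= k < n + l)%N -> (i < j)%N -> ~ S j (iter k T x)].
  move=> ii; have /not_orP[nE _] := good i ii.
  have [_ _ _ _ /(_ x nE)[n [l [N [nl iN Sx cN]]]]] := fP i (H i).
  exists n, l, N; split=> // k j /andP[_ kn] ij Sj.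
  have /not_orP[_] := good j (leq_trans ii (ltnW ij)); apply; exists k => //=.
  apply: leq_trans kn (leq_trans nl _); exact: (Hmono i.+1 j ij).
have arch (e : R) : (0 < e)%R -> exists i1, forall i, (i1 <= i)%N -> (1 / (2 ^ i.+1)%:R <= e)%R.
  move=> e0; exists (Num.bound e^-1) => i ii.
  rewrite ler_pdivrMr ?ltr0n ?expn_gt0 // mulrC -ler_pdivrMr //  mul1r.
  apply: (le_trans (ltW (archi_boundP _))); first by rewrite invr_ge0 ltW.
  by rewrite ler_nat (leq_trans ii) // ltnW // ltnW // ltn_expl.
split; [apply: limn_esup_eq1 | apply: limn_einf_eq0] => // e N0 e0; have [i1 ei] := arch e e0.
- pose i := (maxn i0 (maxn i1 N0)).*2.
  have ii : (i0 <= i)%N by rewrite /i -addnn; lia.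
  have [n [l [N [iN cN Sx nSx]]]] := window i ii.
  exists N; first by apply: leq_trans iN; rewrite /i -addnn; lia.
  have hA k : (n <= k < n + l)%N -> A (iter k T x).
    move=> nk; exists (maxn i0 (maxn i1 N0)) => //; split; first exact: Sx.
    by move=> [j /= ij Sj]; exact: nSx nk ij Sj.
  apply: le_trans ((cN A x).1 hA); rewrite lerB // ei // /i -addnn; lia.
- pose i := (maxn i0 (maxn i1 N0)).*2.+1.
  have ii : (i0 <= i)%N by rewrite /i -addnn; lia.
  have [n [l [N [iN cN Sx nSx]]]] := window i ii.
  exists N; first by apply: leq_trans iN; rewrite /i -addnn; lia.
  have hA k : (n <= k < n + l)%N -> ~ A (iter k T x).
    move=> nk [j _ [Sj nj]]; case: (ltngtP i j.*2) => ij.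
    + exact: nSx nk ij Sj.
    + by apply: nj; exists i => //; exact: Sx.
    + by move: ij; rewrite /i; lia.
  apply: le_trans ((cN A x).2 hA) _; rewrite ei // /i -addnn; lia.
Qed.

End Sweeping.

(** * Averages over ideals *)

Local Close Scope ereal_scope.

Section IdealAverages.
Context {R : realType} {K : fieldExtType rat} {X : Type} (T : X -> X)
  (c : set (ringOfIntegers K) -> nat).
Local Notation O := (ringOfIntegers K).
Local Notation upto N := (fset_set (@ideals_upto O N)).
Context (finO : forall N, finite_set (@ideals_upto O N)).

Lemma ideal_averageE (A : set X) x N : ideal_average R T c A x N =
  (\sum_(a <- upto N) (\1_A (iter (c a) T x) : R)) / (#|` upto N|)%:R.
Proof. by rewrite /ideal_average fsbig_finite //; exact: finO. Qed.

Lemma ideal_average_ge0 (A : set X) x N : 0 <= ideal_average R T c A x N.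
Proof. by rewrite ideal_averageE divr_ge0 // sumr_ge0. Qed.

Lemma ideal_average_le1 (A : set X) x N : ideal_average R T c A x N <= 1.
Proof.
rewrite ideal_averageE; have [->|n0] := eqVneq (#|` upto N|) 0%N.
  by rewrite invr0 mulr0 ler01.
rewrite ler_pdivrMr ?ltr0n ?lt0n // mul1r -sum1_size natr_sum.
by apply: ler_sum => a _; rewrite indicE lern1 leq_b1.
Qed.

(** If few ideals have their value of [c] outside an interval, a visit of [A]
    during that interval determines the average up to a small error. *)
Lemma ideal_average_concentrated (eta : R) n l N (bad : pred (set O)) :
  (0 < #|` upto N|)%N ->
  (forall a, ~~ bad a -> (n <= c a < n + l)%N) ->
  \sum_(a <- upto N | bad a) 1 <= eta * (#|` upto N|)%:R :> R ->
  forall (A : set X) x,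
  ((forall k, (n <= k < n + l)%N -> A (iter k T x)) ->
     1 - eta <= ideal_average R T c A x N) /\
  ((forall k, (n <= k < n + l)%N -> ~ A (iter k T x)) ->
     ideal_average R T c A x N <= eta).
Proof.
move=> n0 good few A x; rewrite ideal_averageE.
have N0 : 0 < (#|` upto N|)%:R :> R by rewrite ltr0n.
have total : (#|` upto N|)%:R = \sum_(a <- upto N | bad a) 1 +
    \sum_(a <- upto N | ~~ bad a) 1 :> R.
  by rewrite -sum1_size natr_sum (bigID bad).
split=> vis.
  rewrite ler_pdivlMr // mulrBl mul1r lerBlDr {1}total addrC.
  apply: lerD => //; rewrite [leRHS](bigID bad) /= -[leLHS]add0r.
  apply: lerD; first exact: sumr_ge0.
  by apply: ler_sum => a /good/vis Aa; rewrite indicE mem_set.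
rewrite ler_pdivrMr // (le_trans _ few) // (bigID bad) /= -[leRHS]addr0.
apply: lerD; first by apply: ler_sum => a _; rewrite indicE lern1 leq_b1.
by rewrite big1 // => a /good/vis Aa; rewrite indicE memNset.
Qed.

End IdealAverages.

(** The hypothesis on averages under which strong sweeping out was proved. *)
Lemma ideal_average_window (R : realType) (K : fieldExtType rat) (X : Type)
    (T : X -> X) (c : set (ringOfIntegers K) -> nat) :
  c = Omega_ideal \/ c = omega_ideal ->
  forall (eta : R) m N0, 0 < eta ->
  exists2 l, (0 < l)%N & forall n, (n <= m * l)%N ->
    exists2 N, (N0 <= N)%N &
      concentrated T (ideal_average R T c) eta n l N.
Proof.
move=> cE eta m N0 eta0.
have [n0 [e [q [D frame]]]] := @integral_coordinates_exist K.
have dedO := O_dedekind_frame frame.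
have [B _ finB] := ideals_upto_bound frame.
have [B' B'0 div] := inverse_norms_diverge frame.
have finO N : finite_set (@ideals_upto (ringOfIntegers K) N) by case: (finB N).
have bound N : (#|` fset_set (@ideals_upto (ringOfIntegers K) N)| <= B * N)%N.
  by case: (finB N).
(* The bound [1 / 2] forces [N0 <= N] below. *)
pose eta' := Num.min eta 2^-1.
have eta'0 : 0 < eta' by rewrite lt_min eta0 invr_gt0 /=.
have eta'half : eta' <= 2^-1 by rewrite ge_min lexx orbT.
have eta'1 : eta' < 1 by lra.
pose delta : R := (2 * m.+1%:R)^-1.
have m1 : 1 <= m.+1%:R :> R by rewrite ler1n.
have delta0 : 0 < delta by rewrite invr_gt0 mulr_gt0 // ltr0n.
have delta_half : delta <= 2^-1.
  by rewrite lef_pV2 ?posrE ?mulr_gt0 ?ltr0n // ler_peMr.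
have [M0 M0P] := prime_factor_concentration dedO finO bound B'0 div cE eta'0 delta0.
pose k0 := (\max_(a <- fset_set (@ideals_upto (ringOfIntegers K) N0)) c a)%N.
(* Long enough for the interval to be centred beyond [M0] and for every value of
   [c] on the ideals of norm at most [N0] to be far from its centre. *)
pose l := (4 * (Num.bound `|M0| + k0).+1)%N.
exists l => // n nl; pose M : R := n%:R + l%:R / 2.
have lE : l%:R = 4 * ((Num.bound `|M0|)%:R + k0%:R + 1) :> R.
  by rewrite /l natrM -[(_ + k0).+1]addn1 !natrD.
have bM0 : M0 < (Num.bound `|M0|)%:R.
  by apply: (le_lt_trans (ler_norm M0)); apply: archi_boundP.
have bM0' : 0 <= (Num.bound `|M0|)%:R :> R by [].
have k00 : 0 <= k0%:R :> R by [].
have nR : 0 <= n%:R :> R by [].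
have lR : 0 < l%:R :> R by rewrite ltr0n.
have [N Npos few] := M0P M ltac:(rewrite /M; lra).
have dM : delta * M <= l%:R / 2.
  have mE : m.+1%:R = m%:R + 1 :> R by rewrite natr1.
  rewrite mulrC ler_pdivrMr ?mulr_gt0 ?ltr0n // /M mE.
  have : n%:R <= m%:R * l%:R :> R by rewrite -natrM ler_nat.
  by move: (l%:R : R) lR (m%:R : R) (n%:R : R) => L L0 M' n'; lra.
have upto0 : (0 < #|` fset_set (@ideals_upto (ringOfIntegers K) N)|)%N.
  rewrite cardfs_gt0; apply/fset0Pn; exists setT.
  by apply: mem_upto => //; [exact: nonzero_idealT|rewrite ideal_normT].
exists N; last first.
  have conc := @ideal_average_concentrated R K X T c finO eta n l N (fun a => delta * M <= `|(c a)%:R - M|) upto0.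
  apply: conc => [a|].
    rewrite -ltNge => h; have {h} := lt_le_trans h dM.
    rewrite ltr_norml /M => /andP[h1 h2].
    by apply/andP; split; [rewrite -(ler_nat R)|rewrite -(ltr_nat R) natrD]; lra.
  by rewrite (le_trans few) // ler_wpM2r // ge_min lexx.
rewrite leqNgt; apply/negP => NN0.
move: few; rewrite (_ : \sum_(a <- _ | _) 1 = (#|` fset_set (@ideals_upto (ringOfIntegers K) N)|)%:R).
  by rewrite leNgt gtr_pMl ?ltr0n // eta'1.
rewrite -sum1_size natr_sum; rewrite big_seq_cond [RHS]big_seq; apply: eq_bigl => a.
case: (boolP (a \in _)) => //= aN.
have [Ga aN'] := upto_norm finO aN.
have ck : (c a <= k0)%N.
  by apply: (leq_bigmax_seq a) => //; apply: mem_upto => //; rewrite (leq_trans aN') // ltnW.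
have ckR : (c a)%:R <= k0%:R :> R by rewrite ler_nat.
have M00 : 0 <= M by rewrite /M; lra.
have : delta * M <= 2^-1 * M by rewrite ler_wpM2r.
rewrite distrC ger0_norm; last by rewrite /M; lra.
rewrite /M in M00 *; lra.
Qed.

Theorem theorem1p4 (R : realType) (K : fieldExtType rat)
    (d : measure_display) (X : metricMeasurableType d R)
    (compactX : compact [set: X])
    (borelX : @measurable d X = <<s @open X >>)
    (mu : probability X R) (T : X -> X)
    (mpT : measure_preserving mu T) (invT : measurably_invertible T)
    (ergT : ergodic mu T) (nonatomic_mu : non_atomic mu)
    (c : set (ringOfIntegers K) -> nat)
    (cE : c = Omega_ideal \/ c = omega_ideal)
    (eps : R) (eps_gt0 : 0 < eps) :
  exists A : set X,
    [/\ measurable A,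
        (mu A < eps%:E)%E &
        {ae mu, forall x,
          limn_esup (fun N => (ideal_average R T c A x N)%:E) = 1%E /\
          limn_einf (fun N => (ideal_average R T c A x N)%:E) = 0%E}].
Proof.
have [n [e [q [D frame]]]] := @integral_coordinates_exist K.
have [B _ finB] := ideals_upto_bound frame.
have finO N : finite_set (@ideals_upto (ringOfIntegers K) N) by case: (finB N).
apply: (strong_sweeping mpT ergT) => //.
- exact: small_positive_set.
- by move=> A x N; exact: ideal_average_ge0.
- by move=> A x N; exact: ideal_average_le1.
- by move=> eta m N0; exact: ideal_average_window.
Qed.
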